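(* There exist a real Banach space $E$, a $C_0$-semigroup $S=\{S(t)\}_{t\ge0}$ on $E$ with generator $A$, and an $E$-valued Brownian motion $W$ such that, with $T=1$, the problem $$dU(t)=AU(t)\,dt+dW(t),\quad t\in[0,1],\qquad U(0)=0,$$ admits a solution $U$ with continuous trajectories, whilst the associated splitting scheme fails to converge, that is, $U^{(n)}(1)$ does not converge to $U(1)$ in $L^p(\Omega;E)$ as $n\to\infty$, for any $1\le p<\infty$.
   Context: An $E$-valued Brownian motion $W$ is a process (on some probability space $(\Omega,\mathbb{P})$) with $W(0)=0$, continuous paths, independent increments, and such that $W(t)-W(s)$ is a centred Gaussian (Radon) random variable distributed as $\sqrt{t-s}\,W(1)$ for $t>s$. $H$ denotes the reproducing kernel Hilbert space of $W(1)$, with inclusion $i:H\hookrightarrow E$. Stochastic integral. $W$ induces an $H$-cylindrical Brownian motion $W_H:L^2(0,T;H)\to L^2(\Omega)$, i.e. a linear map into centred Gaussian variables with $\mathbb{E}\,W_H(h_1)W_H(h_2)=\langle h_1,h_2\rangle$, determined by $W_H(f\otimes i^*x^* )=\int_0^T f\,d\langle W,x^*\rangle$. For finite rank step functions put $\int_0^T 1_{(a,b]}\otimes(h\otimes x)\,dW_H:=W_H(1_{(a,b]}\otimes h)\,x$, extended linearly. A function $\Psi:(0,T)\to\mathscr{L}(H,E)$ is stochastically integrable with respect to $W_H$ if there are finite rank step functions $\Psi_n$ with $\Psi_nh\to\Psi h$ in measure on $(0,T)$ for all $h\in H$ and such that $\int_0^T\Psi_n\,dW_H$ converges in probability; the limit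 is $\int_0^T\Psi\,dW_H$. A function $\Psi:(0,T)\to\mathscr{L}(E)$ is stochastically integrable with respect to $W$ if $\Psi\circ i$ is stochastically integrable with respect to $W_H$, and $\int_0^T\Psi\,dW:=\int_0^T(\Psi\circ i)\,dW_H$. Solution. The problem admits a solution if and only if $t\mapsto S(t)$ is stochastically integrable on $(0,T)$ with respect to $W$, and the solution is then given (uniquely up to modification) by $U(t)=\int_0^tS(t-s)\,dW(s)$; ''with continuous trajectories'' means that it has a version with continuous paths in $E$. Splitting scheme (here $T=1$). Put $t_j^{(n)}:=jT/n$, $I_0^{(n)}:=\{0\}$, $I_j^{(n)}:=(t_{j-1}^{(n)},t_j^{(n)}]$ for $1\le j\le n$, $S^{(n)}(t):=\sum_{j=0}^n1_{I_j^{(n)}}(t)S(t_j^{(n)})$, and $U^{(n)}(t):=\int_0^tS^{(n)}(t-s)\,dW(s)$. At grid points this is $U^{(n)}(0)=0$, $U^{(n)}(t_j^{(n)})=S(T/n)\big(U^{(n)}(t_{j-1}^{(n)})+W(t_j^{(n)})-W(t_{j-1}^{(n)})\big)$. *)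

(* Defs.v *)
From HB Require Import structures.
From mathcomp Require Import all_boot all_order all_algebra.
From mathcomp Require Import all_classical all_reals all_analysis.

Set Implicit Arguments.
Unset Strict Implicit.
Unset Printing Implicit Defensive.

Import Order.TTheory GRing.Theory Num.Theory.
Import numFieldNormedType.Exports.

Local Open Scope classical_set_scope.
Local Open Scope ring_scope.

Definition bounded_operator (R : realType) (V U : normedModType R)
    (f : V -> U) : Prop :=
  linear f /\ continuous f.

Definition functional (R : realType) (V : normedModType R)
    (x' : V -> R) : Prop :=
  scalar x' /\ continuous x'.

Record C0_semigroup (R : realType) (E : normedModType R)
    (S : R -> E -> E) : Prop := {
  C0_bounded : forall t, 0 <= t -> bounded_operator (S t) ;
  C0_zero : forall x, S 0 x = x ;
  C0_add : forall s t x, 0 <= s -> 0 <= t -> S (s + t) x = S s (S t x) ;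
  C0_strong : forall x, S t x @[t --> 0^'+] --> x }.

(* [A] is only meaningful on its domain [DA], which is exactly the set of [x]
   where the limit exists. *)
Definition generator (R : realType) (E : normedModType R)
    (S : R -> E -> E) (DA : set E) (A : E -> E) : Prop :=
  forall x y, (DA x /\ A x = y) <->
    (t^-1 *: (S t x - x) @[t --> 0^'+] --> y).

Definition borel (T : ptopologicalType) : set (set T) := <<s @open T >>.

Definition borel_rv d (Omega : measurableType d) (R : realType)
    (E : normedModType R) (X : Omega -> E) : Prop :=
  forall B : set E, borel B -> measurable (X @^-1` B).

(* The law of [X] is a Radon measure on the Borel sets of [E]. *)
Definition radon_rv d (Omega : measurableType d) (R : realType)
    (P : probability Omega R) (E : normedModType R) (X : Omega -> E) : Prop :=
  borel_rv X /\
  forall (B : set E) (e : R), borel B -> 0 < e ->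
    exists K : set E, [/\ compact K, borel K, K `<=` B &
      (P (X @^-1` (B `\` K)) < e%:E)%E].

(* The law of [X] is that of [sigma * g] with [g] standard normal; this
   includes the degenerate case [sigma = 0]. *)
Definition centered_gaussian d (Omega : measurableType d) (R : realType)
    (P : probability Omega R) (X : Omega -> R) : Prop :=
  measurable_fun setT X /\
  exists sigma : R, forall A : set R, measurable A ->
    P (X @^-1` A) = normal_prob 0 1 ((fun r => sigma * r) @^-1` A).

Definition centered_gaussian_vec d (Omega : measurableType d) (R : realType)
    (P : probability Omega R) (E : normedModType R) (X : Omega -> E) : Prop :=
  radon_rv P X /\
  forall x', functional x' -> centered_gaussian P (x' \o X).

Record brownian_motion d (Omega : measurableType d) (R : realType)
    (P : probability Omega R) (E : normedModType R)
    (W : R -> Omega -> E) : Prop := {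
  bm_zero : forall w, W 0 w = 0 ;
  bm_continuous : forall w,
    {within `[0, +oo[, continuous (fun t => W t w)} ;
  bm_independent : forall (t : nat -> R) (n : nat) (B : nat -> set E),
    0 <= t 0%N -> {homo t : i j / (i <= j)%N >-> i <= j} ->
    (forall i, borel (B i)) ->
    P (\bigcap_(i < n) ((W (t i.+1) \- W (t i)) @^-1` B i)) =
    (\prod_(i < n) P ((W (t i.+1) \- W (t i))%R @^-1` B i))%E ;
  bm_gaussian : forall s t, 0 <= s -> s < t ->
    centered_gaussian_vec P (W t \- W s) ;
  bm_scaling : forall s t, 0 <= s -> s < t -> forall B, borel B ->
    P ((W t \- W s) @^-1` B) =
    P ((fun w => Num.sqrt (t - s) *: W 1 w) @^-1` B) }.

(* No measurability of [f] is presupposed: [lebesgue_measure] evaluated at a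
   non-measurable set is the outer measure, so that a limit in this sense of
   step functions is automatically strongly measurable up to a null set. *)
Definition cvg_in_measure d (T : measurableType d) (R : realType)
    (V : normedModType R) (mu : {measure set T -> \bar R}) (D : set T)
    (f_ : nat -> T -> V) (f : T -> V) : Prop :=
  forall e : R, 0 < e ->
    mu (D `&` [set x | e <= `|f_ n x - f x|]) @[n --> \oo] --> 0%E.

Record hilbert_product (R : realType) (H : completeNormedModType R)
    (dot : H -> H -> R) : Prop := {
  dotC : forall h k, dot h k = dot k h ;
  dot_linear : forall k, scalar (dot ^~ k) ;
  dot_norm : forall h, dot h h = `|h| ^+ 2 }.

(* [k = i^* x'] *)
Definition adjoint_at (R : realType) (E : normedModType R)
    (H : completeNormedModType R) (dot : H -> H -> R) (i : H -> E)
    (x' : E -> R) (k : H) : Prop :=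
  forall h, dot h k = x' (i h).

(* With [Q] the covariance operator of the centred variable [X], given by
   [y' (Q x') = E (x' X * y' X)], the space [i @` H] contains every [Q x'], and
   [Q x'] represents the functional [x'] on it (reproducing property). This
   determines [(H, i)] up to isometric isomorphism. *)
Record is_rkhs d (Omega : measurableType d) (R : realType)
    (P : probability Omega R) (E : normedModType R) (X : Omega -> E)
    (H : completeNormedModType R) (dot : H -> H -> R) (i : H -> E) : Prop := {
  rkhs_hilbert : hilbert_product dot ;
  rkhs_bounded : bounded_operator i ;
  rkhs_injective : injective i ;
  rkhs_reproducing : forall x', functional x' ->
    exists2 k, adjoint_at dot i x' k &
      forall y', functional y' ->
        (y' (i k))%:E = 'E_P[fun w => (x' (X w) * y' (X w))%R]%E }.

Definition simple_fun (R : realType) (H : normedModType R) (f : R -> H) : Prop :=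
  finite_set (range f) /\ forall h, measurable (f @^-1` [set h]).

Definition strongly_measurable (R : realType) (H : normedModType R)
    (D : set R) (f : R -> H) : Prop :=
  exists f_ : nat -> R -> H, (forall n, simple_fun (f_ n)) /\
    forall t, D t -> f_ n t @[n --> \oo] --> f t.

(* Representatives of the elements of L^2(0,T;H). *)
Definition L2 (R : realType) (H : normedModType R) (T : R) (f : R -> H) : Prop :=
  strongly_measurable `]0, T[ f /\
  (\int[lebesgue_measure]_(t in `]0%R, T[) (`|f t| ^+ 2)%:E < +oo)%E.

(* [1_{(a,b]} \otimes h] *)
Definition step (R : realType) (V : normedModType R) (a b : R) (h : V) :
    R -> V :=
  fun t => \1_(`]a, b] : set R) t *: h.

(* By linearity, isometry and density it is enough to prescribe
   [W_H (f \otimes i^* x') = \int_0^T f d<W, x'>] for [f = 1_{(a,b]}], where the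
   right-hand side is the increment of [<W, x'>] over [(a,b]]. *)
Record induced_cylindrical_bm d (Omega : measurableType d) (R : realType)
    (P : probability Omega R) (E : normedModType R) (W : R -> Omega -> E)
    (H : completeNormedModType R) (dot : H -> H -> R) (i : H -> E) (T : R)
    (WH : (R -> H) -> Omega -> R) : Prop := {
  cbm_gaussian : forall f, L2 T f -> centered_gaussian P (WH f) ;
  cbm_linear : forall c f g, L2 T f -> L2 T g ->
    {ae P, forall w, WH (fun t => c *: f t + g t) w = c * WH f w + WH g w} ;
  cbm_isometry : forall f g, L2 T f -> L2 T g ->
    'E_P[fun w => (WH f w * WH g w)%R]%E =
    (\int[lebesgue_measure]_(t in `]0%R, T[) (dot (f t) (g t))%:E)%E ;
  cbm_induced : forall (a b : R) (x' : E -> R) (k : H), 0 <= a -> a <= b -> b <= T ->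
    functional x' -> adjoint_at dot i x' k ->
    {ae P, forall w, WH (step a b k) w = x' (W b w - W a w)} }.

(* The elementary operator-valued function [1_{(lo,hi]} \otimes (vH \otimes vE)],
   where [vH \otimes vE] is the operator [g |-> [g, vH]_H vE]. *)
Record step_term (R : realType) (H E : normedModType R) := StepTerm {
  lo : R ; hi : R ; vH : H ; vE : E }.

Definition step_in (R : realType) (H E : normedModType R) (T : R)
    (q : step_term H E) : bool :=
  [&& 0 <= lo q, lo q <= hi q & hi q <= T].

(* A finite rank step function is a finite sum of such elementary functions. *)
Definition frstep (R : realType) (H E : normedModType R) (dot : H -> H -> R)
    (s : seq (step_term H E)) (t : R) (g : H) : E :=
  \sum_(q <- s) step (lo q) (hi q) (dot g (vH q) *: vE q) t.

Definition frstep_integral (Omega : Type) (R : realType)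
    (H E : normedModType R) (WH : (R -> H) -> Omega -> R)
    (s : seq (step_term H E)) (w : Omega) : E :=
  \sum_(q <- s) WH (step (lo q) (hi q) (vH q)) w *: vE q.

(* [X] is (a version of) [\int_0^T Psi dW_H]. The limit [X] of the elementary
   integrals is almost surely separably valued, so Borel measurability of [X]
   amounts to [X] belonging to [L^0(Omega;E)]. *)
Definition is_cyl_integral d (Omega : measurableType d) (R : realType)
    (P : probability Omega R) (E : normedModType R)
    (H : completeNormedModType R) (dot : H -> H -> R)
    (WH : (R -> H) -> Omega -> R) (T : R) (Psi : R -> H -> E)
    (X : Omega -> E) : Prop :=
  [/\ forall s, 0 < s < T -> bounded_operator (Psi s),
      borel_rv X &
      exists Psi_ : nat -> seq (step_term H E),
        [/\ forall n, all (step_in T) (Psi_ n),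
            forall h, cvg_in_measure lebesgue_measure `]0, T[
              (fun n t => frstep dot (Psi_ n) t h) (fun t => Psi t h) &
            cvg_in_measure P setT (fun n => frstep_integral WH (Psi_ n)) X]].

(* [X] is (a version of) [\int_0^T Psi dW]. Since [(H, i)] is unique up to
   isomorphism and [W_H] up to modification, the existential quantifiers only
   name them. *)
Definition is_stoch_integral d (Omega : measurableType d) (R : realType)
    (P : probability Omega R) (E : normedModType R) (W : R -> Omega -> E)
    (T : R) (Psi : R -> E -> E) (X : Omega -> E) : Prop :=
  exists (H : completeNormedModType R) (dot : H -> H -> R) (i : H -> E)
         (WH : (R -> H) -> Omega -> R),
    [/\ is_rkhs P (W 1) dot i,
        induced_cylindrical_bm P W dot i T WH &
        is_cyl_integral P dot WH T (fun s => Psi s \o i) X].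

Definition stoch_integrable d (Omega : measurableType d) (R : realType)
    (P : probability Omega R) (E : normedModType R) (W : R -> Omega -> E)
    (T : R) (Psi : R -> E -> E) : Prop :=
  exists X, is_stoch_integral P W T Psi X.

(* [U] solves [dU = AU dt + dW] on [0,T] with [U(0) = 0]; the semigroup [S] is
   the one generated by [A], hence unique. *)
Definition is_solution d (Omega : measurableType d) (R : realType)
    (P : probability Omega R) (E : normedModType R) (DA : set E) (A : E -> E)
    (W : R -> Omega -> E) (T : R) (U : R -> Omega -> E) : Prop :=
  exists S : R -> E -> E,
    [/\ C0_semigroup S, generator S DA A,
        stoch_integrable P W T S &
        forall t, 0 <= t <= T ->
          is_stoch_integral P W t (fun s => S (t - s)) (U t)].

Definition continuous_trajectories (Omega : Type) (R : realType)
    (E : normedModType R) (T : R) (U : R -> Omega -> E) : Prop :=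
  forall w, {within `[0, T], continuous (fun t => U t w)}.

Definition grid (R : realType) (T : R) (n j : nat) : R := j%:R * T / n%:R.

Definition grid_cell (R : realType) (T : R) (n j : nat) : set R :=
  if j is j'.+1 then [set` `]grid T n j', grid T n j]] else [set 0].

Definition split_semigroup (R : realType) (E : normedModType R)
    (S : R -> E -> E) (T : R) (n : nat) (t : R) (x : E) : E :=
  \sum_(0 <= j < n.+1) \1_(grid_cell T n j) t *: S (grid T n j) x.

Definition is_splitting_scheme d (Omega : measurableType d) (R : realType)
    (P : probability Omega R) (E : normedModType R) (S : R -> E -> E)
    (W : R -> Omega -> E) (T : R) (n : nat) (Un : R -> Omega -> E) : Prop :=
  forall t, 0 <= t <= T ->
    is_stoch_integral P W t (fun s => split_semigroup S T n (t - s)) (Un t).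

(* Main.v *)
(** The noise is one-dimensional, W(t) = B(t) phi with B a real Brownian motion, and S is the
    shift (S(t) f)(x) = f(x + t) on bounded families f(m, eps, .), indexed by m : nat and a
    sequence eps of signs, of uniformly equicontinuous functions.  The component (m, eps) of phi
    is 2^-m times the sum, over j = 1, ..., 4^m, of eps_j times a tent of height 1 centred at
    j/4^m, so narrow that its integral against any shift of dB is small compared with 4^-m: hence
    the Riemann sums of the stochastic convolution converge pathwise, uniformly on [0,1], and U
    has continuous trajectories, with small (m, eps) component as m grows.  With n = 4^m steps,
    however, the splitting scheme evaluates phi exactly at the centres of these tents: choosing
    for eps the signs of the n increments of B, it sees 2^-m times the sum of their absolute
    values, which is of order 1.

    Brownian motion is built on a space whose sample point splits into two independent copies of
    itself, together with a normal variable X satisfying X = (X' + X'')/sqrt 2 for the two copies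
    X', X'' of X; iterating the splitting yields consistent dyadic increments. *)

Require Import Defs.
From HB Require Import structures.
From mathcomp Require Import all_boot all_order all_algebra.
From mathcomp Require Import all_classical all_reals all_analysis.
From mathcomp Require Import measurable_realfun ring lra.

Set Implicit Arguments.
Unset Strict Implicit.
Unset Printing Implicit Defensive.

Import Order.TTheory GRing.Theory Num.Theory.
Import numFieldNormedType.Exports.

Local Open Scope classical_set_scope.
Local Open Scope ring_scope.

(** * Measures on the line *)

(** The favourable signs are random whereas the direction of the noise is deterministic: indexing by
    all sign sequences at once under a supremum norm lets each path find its own signs. Increments
    over a mesh 4^-m have size 2^-m, so a weight 2^-m against 4^m of them gives order 1, while the
    weight still tends to 0 and leaves [phi] uniformly equicontinuous, as strong continuity of the
    shift requires. The obstacle is to integrate [phi] against a path uniformly in the signs. A path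
    with modulus C rho^K at scale 2^-K integrates a tent of width 2^-K to O(rho^K): Riemann sums at
    the scale of the tent are bounded by a partition of unity, and each refinement costs the current
    modulus times the variation of the tent. Absolute values over all tents of a component then give
    2^m rho^K, whence K of order 11 m. The ratio rho must leave room for Borel-Cantelli over the 2^m
    increments of level m, and fourth moments are the first even ones to suffice. All integrals are
    obtained as limits path by path. *)

Lemma half_pow_cvg0 (R : realType) : (2^-1 : R) ^+ m @[m --> \oo] --> (0 : R).
Proof. by apply: cvg_expr; rewrite ger0_norm ?invr_ge0// invf_lt1// ltr1n. Qed.

Lemma scaled_cvg0 (R : realType) (c : R) (u : nat -> R) :
  u m @[m --> \oo] --> (0 : R) -> c * u m @[m --> \oo] --> (0 : R).
Proof. by move=> u0; rewrite -[X in _ --> X](mulr0 c); apply: cvgM => //; exact: cvg_cst. Qed.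

Lemma sum_double (V : nmodType) (F : nat -> V) n :
  \sum_(0 <= j < n.*2) F j = \sum_(0 <= j < n) (F j.*2 + F j.*2.+1).
Proof.
elim: n => [|n IH]; first by rewrite !big_geq.
by rewrite doubleS !big_nat_recr//= IH addrA.
Qed.

Section superlevel.
Context d (T : measurableType d) (R : realType) (f : T -> R) (r : R).
Hypothesis mf : measurable_fun setT f.

Let preimage_itv (i : interval R) : measurable (f @^-1` [set` i]).
Proof. by rewrite -[_ @^-1` _]setTI; exact: mf. Qed.

Lemma measurable_ge : measurable [set w | r <= f w].
Proof.
rewrite (_ : [set w | _] = f @^-1` `[r, +oo[); first exact: preimage_itv.
by apply/seteqP; split=> w /=; rewrite in_itv/= andbT.
Qed.

Lemma measurable_gt : measurable [set w | r < f w].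
Proof.
rewrite (_ : [set w | _] = f @^-1` `]r, +oo[); first exact: preimage_itv.
by apply/seteqP; split=> w /=; rewrite in_itv/= andbT.
Qed.

Lemma measurable_lt : measurable [set w | f w < r].
Proof.
rewrite (_ : [set w | _] = f @^-1` `]-oo, r[); first exact: preimage_itv.
by apply/seteqP; split=> w /=; rewrite in_itv.
Qed.

End superlevel.

(** Open right rays generate the Borel sets and are stable under intersection, so the uniqueness
    theorem for measures applies. *)
Lemma ray_measure_unique (R : realType)
    (m1 m2 : {measure set (measurableTypeR R) -> \bar R}) :
  (m1 setT < +oo)%E ->
  (forall a : R, m1 `]a, +oo[%classic = m2 `]a, +oo[%classic) ->
  forall A, measurable A -> m1 A = m2 A.
Proof.
move=> m1fin m12 A mA.
apply: (@measure_unique _ R (measurableTypeR R)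
  [set A | exists a : R, A = `]a, +oo[%classic] (fun n => `](- n%:R), +oo[%classic)) => //.
- rewrite RGenOInfty.measurableE; congr (<<s _ >>).
- move=> _ _ [a ->] [b ->]; exists (Num.max a b).
  by apply/seteqP; split=> x /=; rewrite !in_itv/= !andbT gt_max => /andP.
- by move=> n; exists (- n%:R).
- apply/seteqP; split=> // x _ /=.
  exists (Num.truncn `|x|).+1 => //=; rewrite in_itv/= andbT.
  rewrite ltrNl; apply: le_lt_trans (_ : `|x| < _); last exact: truncnS_gt.
  by rewrite -normrN ler_norm.
- by move=> _ [a ->].
- move=> n; apply: le_lt_trans m1fin; apply: le_measure; rewrite ?inE//.
Qed.

Lemma measurable_affine (R : realType) (a b : R) :
  measurable_fun [set: R] (fun x : R => a * x + b).
Proof. by apply: measurable_funD => //; apply: measurable_funM. Qed.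

(** The image of Lebesgue measure under the affine map, rescaled by |a|, gives intervals their
    length, which characterises Lebesgue measure. For a < 0 the preimage of ]l, r] is closed on the
    left instead, hence the two cases. *)
Lemma lebesgue_affine (R : realType) (a b : R) (A : set (measurableTypeR R)) :
  a != 0 -> measurable A ->
  lebesgue_measure A =
    (`|a|%:E * lebesgue_measure ((fun x => (a * x + b)%R) @^-1` A))%E.
Proof.
move=> a0 mA.
pose f : measurableTypeR R -> measurableTypeR R := fun x : R => a * x + b.
have mf : measurable_fun setT f by exact: measurable_affine.
pose ff : {mfun measurableTypeR R >-> measurableTypeR R} :=
  HB.pack f (isMeasurableFun.Build _ _ _ _ f mf).
pose k : {nonneg R} := NngNum (normr_ge0 a).
rewrite (@lebesgue_measure_unique R (mscale k (pushforward lebesgue_measure ff)))//.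
move=> _ [[l r] _ <-].
rewrite [RHS](_ : _ = (`|a|%:E * lebesgue_measure (f @^-1` `]l, r]))%E)//=.
have := a0; rewrite neq_lt => /orP[an|ap].
- rewrite (_ : f @^-1` _ = `[(r - b) / a, (l - b) / a[%classic); last first.
    apply/seteqP; split=> x /=; rewrite !in_itv/= /f.
      by rewrite ler_ndivrMr// ltr_ndivlMr// lerBrDr ltrBlDr (mulrC x) andbC.
    by rewrite ler_ndivrMr// ltr_ndivlMr// lerBrDr ltrBlDr (mulrC x) andbC.
  rewrite !lebesgue_measure_itv/= !lte_fin.
  rewrite ltr_nM2r ?invr_lt0// ltrD2r; case: ifP => // lr; rewrite ?mule0//.
  by rewrite -!EFinB -EFinM ltr0_norm//; congr (_%:E); field.
- rewrite (_ : f @^-1` _ = `](l - b) / a, (r - b) / a]%classic); last first.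
    apply/seteqP; split=> x /=; rewrite !in_itv/= /f.
      by rewrite ltr_pdivrMr// ler_pdivlMr// lerBrDr ltrBlDr (mulrC x).
    by rewrite ltr_pdivrMr// ler_pdivlMr// lerBrDr ltrBlDr (mulrC x).
  rewrite !lebesgue_measure_itv/= !lte_fin.
  rewrite ltr_pM2r ?invr_gt0// ltrD2r; case: ifP => // lr; rewrite ?mule0//.
  by rewrite -!EFinB -EFinM gtr0_norm//; congr (_%:E); field.
Qed.

Lemma integral_affine (R : realType) (a b : R) (f : _ -> \bar R) :
  a != 0 -> measurable_fun [set: R] f -> (forall x, (0 <= f x)%E) ->
  (\int[lebesgue_measure]_x f x =
    `|a|%:E * \int[lebesgue_measure]_x f (a * x + b)%R)%E.
Proof.
move=> a0 mf f0.
pose g : measurableTypeR R -> measurableTypeR R := fun x : R => a * x + b.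
have mg : measurable_fun setT g by exact: measurable_affine.
pose gg : {mfun measurableTypeR R >-> measurableTypeR R} :=
  HB.pack g (isMeasurableFun.Build _ _ _ _ g mg).
pose k : {nonneg R} := NngNum (normr_ge0 a).
rewrite [RHS](_ : _ = \int[mscale k (pushforward lebesgue_measure gg)]_x f x)%E; last first.
  by rewrite ge0_integral_mscale// ge0_integral_pushforward//=.
by apply: eq_measure_integral => A mA _; exact: (lebesgue_affine b a0 mA).
Qed.

(** [D] carries what is already known about the other variables and [k] stands for its probability;
    independence can thus be tested on rays, one variable at a time. *)
Lemma restr_law d (T : measurableType d) (R : realType) (P : probability T R)
    (nu : probability (measurableTypeR R) R) (D : set T) (X : T -> R) (k : R) :
  measurable D -> measurable_fun setT X -> 0 <= k ->
  (forall a : R, P (D `&` X @^-1` `]a, +oo[) = (k%:E * nu `]a, +oo[%classic)%E) ->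
  forall A, measurable A -> P (D `&` X @^-1` A) = (k%:E * nu A)%E.
Proof.
move=> mD mX k0 H A mA.
pose XX : {mfun T >-> measurableTypeR R} :=
  HB.pack (X : T -> measurableTypeR R) (isMeasurableFun.Build _ _ _ _ (X : T -> measurableTypeR R) mX).
pose K : {nonneg R} := NngNum k0.
have E1 B : pushforward (mrestr P mD) XX B = P (D `&` X @^-1` B).
  by rewrite /pushforward/= /mrestr setIC.
rewrite -E1 -[RHS]/(mscale K nu A).
apply: (ray_measure_unique (m1 := pushforward (mrestr P mD) XX)) => //.
- rewrite [X in (X < _)%E]E1 (le_lt_trans (probability_le1 P _))// ?ltry//.
  by apply: measurableI => //; rewrite preimage_setT.
- by move=> a; rewrite [LHS]E1 H.
Qed.

(** * Binary digits of a uniform variable *)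

Section digits.
Context {R : realType}.

Definition unif : probability (measurableTypeR R) R := uniform_prob (@ltr01 R).

Lemma unifE (A : set (measurableTypeR R)) : measurable A ->
  unif A = lebesgue_measure (A `&` `[0, 1[).
Proof.
move=> mA; rewrite /unif/= /uniform_prob integral_uniform_pdf.
rewrite (eq_integral (cst 1%E)); last first.
  by move=> x; rewrite inE/= in_itv/= => -[_ x01]; rewrite /uniform_pdf x01 subr0 invr1.
rewrite integral_cst/=; last exact: measurableI.
rewrite mul1e.
have -> : (A `&` `[0, 1]) = (A `&` `[0, 1[) `|` (A `&` [set (1:R)]).
  rewrite -setIUr; congr (_ `&` _).
  apply/seteqP; split=> x /=; rewrite !in_itv/=.
    by move=> /andP[x0]; rewrite le_eqVlt => /orP[/eqP ->|x1]; [right|left; rewrite x0].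
  by move=> [/andP[-> /ltW]//|->]; rewrite lexx ler01.
apply: measureU0; first exact: measurableI.
- by apply: measurableI => //; exact: measurable_set1.
- apply/eqP; rewrite eq_le measure_ge0 andbT -(lebesgue_measure_set1 (1:R)).
  apply: le_measure; rewrite ?inE; [|exact: measurable_set1|exact: subIsetr].
  by apply: measurableI => //; exact: measurable_set1.
Qed.

Lemma unif_oo (A : set (measurableTypeR R)) : measurable A ->
  unif A = lebesgue_measure (A `&` `]0, 1[).
Proof.
move=> mA; rewrite unifE//.
have -> : (A `&` `[0, 1[) = (A `&` `]0, 1[) `|` (A `&` [set (0:R)]).
  rewrite -setIUr; congr (_ `&` _).
  apply/seteqP; split=> x /=; rewrite !in_itv/=.
    by rewrite le_eqVlt => /andP[/orP[/eqP<-|->] x1]; [right|left].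
  by move=> [/andP[/ltW-> ->]//|->]; rewrite lexx ltr01.
apply: measureU0; first exact: measurableI.
- by apply: measurableI => //; exact: measurable_set1.
- apply/eqP; rewrite eq_le measure_ge0 andbT -(lebesgue_measure_set1 (0:R)).
  apply: le_measure; rewrite ?inE; [|exact: measurable_set1|exact: subIsetr].
  by apply: measurableI => //; exact: measurable_set1.
Qed.

(** Endpoints are null, so identities between events that are checked inside ]0, 1[ can be used. *)
Lemma eq_unif (A B : set (measurableTypeR R)) : measurable A -> measurable B ->
  (forall x, 0 < x < 1 -> A x <-> B x) -> unif A = unif B.
Proof.
move=> mA mB AB; rewrite !unif_oo//; congr (lebesgue_measure _).
by apply/seteqP; split=> x /=; rewrite in_itv/= => -[? x01]; split=> //; apply/AB.
Qed.

(** Maps [0, 1[ onto its k-th quarter, where the two leading binary digits are constant. *)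
Let h (k : nat) (y : R) : R := 4^-1 * y + k%:R / 4.

Let mh k : measurable_fun [set: R] (h k).
Proof. exact: measurable_affine. Qed.

Lemma unif_split4 (B : set (measurableTypeR R)) : measurable B ->
  unif B = (\sum_(k < 4) (4^-1)%:E * unif (h k @^-1` B))%E.
Proof.
move=> mB; rewrite unifE//.
pose Q (k : nat) : set (measurableTypeR R) := `[(k%:R / 4 : R), k.+1%:R / 4[%classic.
have -> : B `&` `[0, 1[ = \big[setU/set0]_(k < 4) (B `&` Q k).
  rewrite -big_distrr/=; congr (_ `&` _); apply/seteqP; split=> x.
    rewrite /= in_itv/= => /andP[x0 x1].
    rewrite !big_ord_recl big_ord0 /Q/= /bump/= !in_itv/= !add1n.
    have [?|?] := ltP x (1/4); first by left; apply/andP; lra.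
    have [?|?] := ltP x (2/4); first by right; left; apply/andP; lra.
    have [?|?] := ltP x (3/4); first by right; right; left; apply/andP; lra.
    by right; right; right; left; apply/andP; lra.
  rewrite !big_ord_recl big_ord0 /Q/= /bump/= !in_itv/= !add1n.
  by move=> [|[|[|[|//]]]] /andP[? ?]; apply/andP; split; lra.
rewrite measure_semi_additive_ord//=; last 3 first.
- by move=> k; apply: measurableI => //; exact: measurable_itv.
- apply/trivIsetP => i j _ _ ij; apply/seteqP; split=> // x [[_ +] [_ +]].
  rewrite /Q/= !in_itv/= => /andP[i1 i2] /andP[j1 j2].
  have := ij; rewrite -(inj_eq val_inj)/= neq_ltn => /orP[] lt.
    have : (i.+1%:R : R) <= j%:R by rewrite ler_nat.
    by lra.
  have : (j.+1%:R : R) <= i%:R by rewrite ler_nat.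
  by lra.
- by apply: bigsetU_measurable => k _; apply: measurableI => //; exact: measurable_itv.
apply: eq_bigr => k _.
have k4 : (4^-1 : R) != 0 by rewrite invr_neq0.
rewrite (lebesgue_affine (k%:R/4) k4); last by apply: measurableI => //; exact: measurable_itv.
rewrite ger0_norm ?invr_ge0//; congr (_ * _)%E.
rewrite unifE; last by rewrite -[X in measurable X]setTI; exact: mh.
congr lebesgue_measure.
have kk : (k.+1%:R : R) = k%:R + 1 by rewrite -natr1.
by apply/seteqP; split=> x; rewrite /= /Q /h/= !in_itv/= kk => -[? /andP[? ?]];
  split=> //; apply/andP; split; lra.
Qed.

Let d0 (x : R) : R := (2^-1 <= x)%R%:R.
Let d1 (x : R) : R := ((4^-1 <= x < 2^-1) || (3/4 <= x))%:R.
Let tau (x : R) : R := 4 * x - 2 * d0 x - d1 x.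

Let dig (b : bool) (x : R) : R := if b then d0 x else d1 x.

(* [digits true] and [digits false] read off the binary digits of odd and even
   rank of [x]: the first two digits are [d0 x], [d1 x] and [tau] shifts by two. *)
Fixpoint digits (b : bool) (n : nat) (x : R) : R :=
  if n is n'.+1 then (dig b x + digits b n' (tau x)) / 2 else 0.

Let measurable_ge_indic (c : R) :
  measurable_fun [set: R] (fun x : R => (c <= x)%R%:R : R).
Proof.
rewrite (_ : (fun _ => _) = \1_(`[c, +oo[%classic : set (measurableTypeR R))).
  by apply: measurable_indic; exact: measurable_itv.
by apply/funext => x; rewrite indicE/= mem_setE in_itv/= andbT.
Qed.

Let mdig b : measurable_fun [set: R] (dig b).
Proof.
case: b; first exact: measurable_ge_indic.
rewrite (_ : dig _ = fun x => (4^-1 <= x)%R%:R - (2^-1 <= x)%R%:R + (3/4 <= x)%R%:R).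
  by apply: measurable_funD => //; apply: measurable_funB.
apply/funext => x; rewrite /dig /d1.
case: (lerP 4^-1 x) => x1; case: (lerP 2^-1 x) => x2; case: (lerP (3/4) x) => x3 /=;
  rewrite ?(subrr,subr0,sub0r,add0r,addr0)//; lra.
Qed.

Let mtau : measurable_fun [set: R] tau.
Proof.
apply: measurable_funB; last exact: (mdig false).
apply: measurable_funB; first exact: measurable_funM.
apply: measurable_funM => //; exact: (mdig true).
Qed.

Lemma measurable_digits b n : measurable_fun [set: R] (digits b n).
Proof.
elim: n => [|n IH] //=.
apply: measurable_funM => //; apply: measurable_funD => //.
exact: measurableT_comp.
Qed.

Lemma digits_bound b n x : 0 <= digits b n x <= 1.
Proof.
elim: n x => [|n IH] x /=; first by rewrite lexx ler01.
have /andP[? ?] := IH (tau x).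
suff /andP[? ?] : 0 <= dig b x <= 1 by apply/andP; split; lra.
have b01 (B : bool) : 0 <= (B%:R : R) <= 1 by case: B; rewrite ?lexx ler01.
by rewrite /dig /d0 /d1; case: (b); exact: b01.
Qed.

Lemma digits_nondecreasing b x : nondecreasing_seq (digits b ^~ x).
Proof.
apply/nondecreasing_seqP => n.
elim: n x => [|n IH] x.
  by have /andP[] := digits_bound b 1 x.
have := IH (tau x).
rewrite [digits b n.+2 x]/= -/(digits b n.+1 (tau x)) [digits b n.+1 x]/=; lra.
Qed.

(** The probability that a number with n fair random binary digits exceeds a: with leading digit d
    and remainder y, (d + y) / 2 > a means y > 2 a - d. *)
Fixpoint tail (n : nat) (a : R) : R :=
  if n is n'.+1 then (tail n' (2 * a) + tail n' (2 * a - 1)) / 2 else (a < 0)%R%:R.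

(** Induction by conditioning on the quarter that contains x: it fixes the first digit of both
    sequences, the four pairs of digits are equally likely, and the remaining digits are again read
    off a uniform variable. *)
Lemma digits_law n (a c : R) :
  unif [set x | a < digits true n x /\ c < digits false n x] =
  (tail n a * tail n c)%:E.
Proof.
have mS m a' c' : measurable [set x | a' < digits true m x /\ c' < digits false m x].
  rewrite (_ : [set _ | _] = (digits true m @^-1` `]a', +oo[) `&`
                             (digits false m @^-1` `]c', +oo[)); last first.
    by apply/seteqP; split=> x /=; rewrite !in_itv/= !andbT.
  apply: measurableI; rewrite -[X in measurable X]setTI; apply: measurable_digits => //.
elim: n a c => [|n IH] a c.
  rewrite /=; have [a0|a0] := ltP a 0; have [c0|c0] := ltP c 0;
    rewrite ?(mul1r,mul0r) /=.
  - rewrite (_ : [set _ | _] = setT) ?probability_setT//.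
    by apply/seteqP; split.
  - rewrite (_ : [set _ | _] = set0) ?measure0//.
    by apply/seteqP; split=> // x [].
  - rewrite (_ : [set _ | _] = set0) ?measure0//.
    by apply/seteqP; split=> // x [].
  - rewrite (_ : [set _ | _] = set0) ?measure0//.
    by apply/seteqP; split=> // x [].
rewrite unif_split4//.
(* On the k-th quarter the leading digits are the binary digits of k = 2 d0 + d1. *)
pose e (b : bool) (k : nat) : R := (if b then (2 <= k)%N else odd k)%:R.
rewrite (eq_bigr (fun k : 'I_4 => (4^-1 * (tail n (2 * a - e true k) *
    tail n (2 * c - e false k)))%:E)); last first.
  move=> k _; rewrite EFinM -IH; congr (_ * _)%E.
  apply: eq_unif => [||x /andP[x0 x1]]; first 2 last.
    have [E1 E2 E3] : [/\ d0 (h k x) = e true k, d1 (h k x) = e false k & tau (h k x) = x].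
      rewrite /tau /d0 /d1 /h /e.
      case: k => -[|[|[|[|//]]]] _ /=.
      - have [?|?] := lerP 2^-1 (4^-1 * x + 0 / 4); first lra.
        have [?|?] := lerP 4^-1 (4^-1 * x + 0 / 4); first lra.
        have [?|?] := lerP (3/4) (4^-1 * x + 0 / 4); first lra.
        by split=> //=; lra.
      - have [?|?] := lerP 2^-1 (4^-1 * x + 1 / 4); first lra.
        have [?|?] := lerP 4^-1 (4^-1 * x + 1 / 4); last lra.
        by split=> //=; lra.
      - have [?|?] := lerP 2^-1 (4^-1 * x + 2 / 4); last lra.
        have [?|?] := lerP 4^-1 (4^-1 * x + 2 / 4); last lra.
        have [?|?] := lerP (3/4) (4^-1 * x + 2 / 4); first lra.
        by split=> //=; lra.
      - have [?|?] := lerP 2^-1 (4^-1 * x + 3 / 4); last lra.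
        have [?|?] := lerP (3/4) (4^-1 * x + 3 / 4); last lra.
        by rewrite orbT; split=> //=; lra.
    rewrite /= E1 E2 E3.
    by split=> -[? ?]; split; lra.
  - by rewrite -[X in measurable X]setTI; apply: mh.
  - exact: mS.
rewrite sumEFin; congr EFin.
rewrite !big_ord_recl big_ord0 /bump /e/= ?subr0.
by field.
exact: mS n.+1 a c.
Qed.

(** The survival function of the uniform law on [0, 1], towards which [tail n] converges. *)
Let G (a : R) : R := Num.max 0 (Num.min 1 (1 - a)).

Let tail_lt0 n a : a < 0 -> tail n a = 1.
Proof.
elim: n a => [|n IH] a a0 /=; first by rewrite a0.
by rewrite !IH; lra.
Qed.

Let tail_ge1 n a : 1 <= a -> tail n a = 0.
Proof.
elim: n a => [|n IH] a a0 /=; first by rewrite ltNge (le_trans ler01 a0).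
by rewrite !IH; lra.
Qed.

Let GE1 a : 0 <= a <= 1 -> G a = 1 - a.
Proof.
by move=> /andP[? ?]; rewrite /G; have -> : Num.min 1 (1 - a) = 1 - a;
  [rewrite min_r//; lra|rewrite max_r//; lra].
Qed.

(** In one step of the recursion one of the two terms is saturated at 0 or 1, where it is exact, so
    the error is halved. *)
Let tail_bound n a : `|tail n a - G a| <= (2^-1) ^+ n.
Proof.
have pos m : 0 <= (2^-1 : R) ^+ m by rewrite exprn_ge0// invr_ge0.
have aux1 (g t z : R) : `|t - g| <= z -> `|(t + 1) / 2 - (g + 1) / 2| <= 2^-1 * z.
  by rewrite !ler_norml => /andP[? ?]; apply/andP; split; lra.
have aux0 (g t z : R) : `|t - g| <= z -> `|(0 + t) / 2 - g / 2| <= 2^-1 * z.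
  by rewrite !ler_norml => /andP[? ?]; apply/andP; split; lra.
elim: n a => [|n IH] a.
  rewrite expr0 /G /=; have [a0|a0] := ltP a 0.
    by rewrite min_l ?max_r ?subrr ?normr0//; lra.
  rewrite sub0r normrN; have [?|?] := lerP 1 (1 - a).
    by rewrite max_r// normr1.
  by have [?|?] := lerP 0 (1 - a); rewrite ler_norml; apply/andP; split; lra.
have [a0|a0] := ltP a 0.
  by rewrite tail_lt0// /G min_l ?max_r ?subrr ?normr0//; lra.
have [a1|a1] := leP 1 a.
  by rewrite tail_ge1// /G min_r ?max_l ?subrr ?normr0//; lra.
rewrite exprS [tail _ _]/=.
have [ah|ah] := ltP a 2^-1.
  rewrite (@tail_lt0 _ (2 * a - 1)); last lra.
  rewrite (_ : G a = (G (2 * a) + 1) / 2); first exact: aux1.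
  by rewrite !GE1; try (apply/andP; split); lra.
rewrite (@tail_ge1 _ (2 * a)); last lra.
rewrite (_ : G a = G (2 * a - 1) / 2); first exact: aux0.
by rewrite !GE1; try (apply/andP; split); lra.
Qed.

Let cvg_tail a : tail n a @[n --> \oo] --> G a.
Proof.
apply/cvgrPdist_le => e e0.
have : (2^-1 : R) ^+ n @[n --> \oo] --> (0:R).
  by apply: cvg_expr; rewrite ger0_norm; lra.
move/cvgrPdist_le => /(_ _ e0); apply: filterS => n.
rewrite sub0r normrN => le; rewrite distrC; apply: le_trans (tail_bound n a) _.
by apply: le_trans le; rewrite ler_norm.
Qed.

Definition halves (b : bool) (x : R) : R := limn (digits b ^~ x).

Let digits_cvg b x : digits b ^~ x @ \oo --> halves b x.
Proof.
apply: nondecreasing_is_cvgn; first exact: digits_nondecreasing.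
by exists 1 => _ [n _ <-]; have /andP[] := digits_bound b n x.
Qed.

Lemma measurable_halves b : measurable_fun [set: R] (halves b).
Proof.
apply: (measurable_fun_cvg (h := digits b)) => [n|x _].
  exact: measurable_digits.
exact: digits_cvg.
Qed.

(** The partial sums increase, so a strict inequality is already witnessed at a finite stage; the
    event becomes an increasing union. *)
Let halves_gt b a x : a < halves b x <-> exists n, a < digits b n x.
Proof.
split=> [ax|[n /lt_le_trans]]; last first.
  by apply; apply: nondecreasing_cvgn_le;
     [exact: digits_nondecreasing|exact: digits_cvg].
have [n _ /(_ n)] : \forall n \near \oo, a < digits b n x.
  by have := @digits_cvg b x; move/cvgr_gt; exact.
by move=> /(_ (leqnn _)) ?; exists n.
Qed.

Lemma halves_law_rays (a c : R) :
  unif [set x | a < halves true x /\ c < halves false x] = (G a * G c)%:E.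
Proof.
pose F n := [set x | a < digits true n x /\ c < digits false n x].
have mF n : measurable (F n : set (measurableTypeR R)).
  rewrite (_ : F n = (digits true n @^-1` `]a, +oo[) `&`
                             (digits false n @^-1` `]c, +oo[)); last first.
    by apply/seteqP; split=> x /=; rewrite !in_itv/= !andbT.
  apply: measurableI; rewrite -[X in measurable X]setTI; apply: measurable_digits => //.
have dig_le b m n x : (m <= n)%N -> digits b m x <= digits b n x.
  by move=> mn; exact: digits_nondecreasing.
have -> : [set x | a < halves true x /\ c < halves false x] = \bigcup_n F n.
  apply/seteqP; split=> [x [/halves_gt[n na] /halves_gt[m mc]]|x [n _ [na nc]]].
    exists (maxn n m) => //; split.
      by apply: lt_le_trans na _; apply: dig_le; exact: leq_maxl.
    by apply: lt_le_trans mc _; apply: dig_le; exact: leq_maxr.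
  by split; apply/halves_gt; exists n.
have : unif (F n) @[n --> \oo] --> unif (\bigcup_n F n).
  apply: nondecreasing_cvg_mu => //; first exact: bigcup_measurable.
  move=> n m nm; apply/subsetPset => x [? ?].
  by split; [apply: lt_le_trans (dig_le _ _ _ _ nm)|apply: lt_le_trans (dig_le _ _ _ _ nm)].
move=> /cvg_unique; apply => //.
rewrite (_ : (fun n => _) = (fun n => (tail n a * tail n c)%:E)).
  by apply: cvg_EFin; [exact: nearW|apply: cvgM; exact: cvg_tail].
by apply/funext => n; exact: digits_law.
Qed.

Let unif_ray a : unif `]a, +oo[%classic = (G a)%:E.
Proof.
rewrite unifE//.
have -> : `]a, +oo[%classic `&` `[0, 1[ = [set` Interval (if a < 0 then BLeft 0 else BRight a) (BLeft 1)].
  apply/seteqP; split=> x; case: ifP => a0; rewrite /= !in_itv/= ?andbT.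
  - by case.
  - by case=> -> /andP[].
  - by move=> /andP[x0 x1]; rewrite x0 x1 (lt_le_trans a0 x0).
  - move=> /andP[ax x1]; rewrite ax x1 andbT; split=> //.
    by apply: ltW; apply: le_lt_trans ax; rewrite leNgt a0.
case: ifPn => a0; rewrite lebesgue_measure_itv/= lte_fin.
  by rewrite ltr01 oppr0 adde0 /G min_l ?max_r//; lra.
case: ifPn => a1; rewrite -?EFinB /G; rewrite -?leNgt in a0 a1; congr EFin.
  by rewrite min_r ?max_r//; lra.
by rewrite min_r ?max_l//; lra.
Qed.

Lemma unif_ray01 a : 0 <= a <= 1 -> unif `]a, +oo[%classic = (1 - a)%:E.
Proof. by move=> a01; rewrite unif_ray GE1. Qed.

(** One uniform variable contains two independent ones. The joint survival function factorises;
    [restr_law] then replaces the rays by Borel sets in one coordinate after the other. *)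
Lemma halves_law (A C : set (measurableTypeR R)) : measurable A -> measurable C ->
  unif (halves true @^-1` A `&` halves false @^-1` C) = (unif A * unif C)%E.
Proof.
move=> mA mC.
have mpre b B : measurable B -> measurable (halves b @^-1` B : set (measurableTypeR R)).
  by move=> mB; rewrite -[X in measurable X]setTI; exact: measurable_halves.
rewrite -(fineK (fin_num_measure unif A mA)).
apply: restr_law => //.
- exact: mpre.
- exact: measurable_halves.
- exact: fine_ge0.
move=> c; rewrite fineK ?fin_num_measure// unif_ray muleC setIC.
apply: restr_law => //.
- exact: mpre.
- exact: measurable_halves.
- by rewrite /G le_max lexx.
move=> a; rewrite unif_ray -EFinM mulrC -halves_law_rays; congr (unif _).
by apply/seteqP; split=> x /=; rewrite !in_itv/= !andbT => -[].
Qed.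

End digits.

Definition gaussian {R : realType} : probability (measurableTypeR R) R :=
  normal_prob 0 1.

(** * Sampling a law from a uniform variable *)

Section quantile.
Context {R : realType} (nu : probability (measurableTypeR R) R).

Let cdf_ (r : R) : R := fine (nu `]-oo, r]%classic).

Let idX : {RV nu >-> R} := HB.pack (fun x : measurableTypeR R => (x : R))
  (isMeasurableFun.Build _ _ _ _ (fun x : measurableTypeR R => (x : R)) (@measurable_id _ (measurableTypeR R) setT)).

Let cdfE r : (cdf_ r)%:E = cdf idX r.
Proof. by rewrite fineK ?fin_num_measure. Qed.

Let cdf_nd : {homo cdf_ : x y / x <= y}.
Proof. by move=> x y xy; rewrite -lee_fin !cdfE; exact: cdf_nondecreasing. Qed.

(** The generalised inverse of the distribution function. Outside ]0, 1[ the set may be empty or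
    unbounded below, whence the default value. *)
Definition quantile (u : R) : R :=
  if 0 < u < 1 then inf [set r | u <= cdf_ r] else 0.

Let cdf_large u : u < 1 -> exists r, u <= cdf_ r.
Proof.
move=> u1; have /cvgr_gt /(_ _ u1) [M [_ HM]] : cdf_ r @[r --> +oo] --> (1:R).
  by apply: fine_cvg; exact: (cvg_cdfy1 idX).
by exists (M + 1); rewrite ltW// HM// ltrDl.
Qed.

Let cdf_small u : 0 < u -> exists r, cdf_ r < u.
Proof.
move=> u0; have /cvgr_lt /(_ _ u0) [M [_ HM]] : cdf_ r @[r --> -oo] --> (0:R).
  by apply: fine_cvg; exact: (cvg_cdfNy0 idX).
by exists (M - 1); rewrite HM// gtrBl.
Qed.

(** Galois connection between quantiles and distribution function. From F(a) < u, right continuity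
    gives F < u on a whole interval to the right of a, which makes the inequality between a and the
    infimum strict. *)
Let quantile_gt (u a : R) : 0 < u < 1 -> (a < quantile u) = (cdf_ a < u).
Proof.
move=> u01; have /andP[u0 u1] := u01; rewrite /quantile u01.
have [r0 r0u] := cdf_large u1; have [r1 r1u] := cdf_small u0.
have hi : has_inf [set r | u <= cdf_ r].
  split; first by exists r0.
  exists r1 => x /= ux; rewrite leNgt; apply/negP => /ltW /cdf_nd.
  by rewrite leNgt (lt_le_trans r1u ux).
apply/idP/idP => [ain|].
  rewrite ltNge; apply/negP => ua.
  by move: ain; rewrite ltNge => /negP; apply; apply: ge_inf => //; case: hi.
move=> Fa.
have /cvgr_lt /(_ _ Fa) [d /= d0 Hd] : cdf_ r @[r --> a^'+] --> cdf_ a.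
  have H := @cdf_right_continuous _ _ R nu idX a; rewrite -cdfE in H.
  exact: (fine_cvg H).
apply: lt_le_trans (_ : a + d / 2 <= _); first by rewrite ltrDl divr_gt0.
apply: lb_le_inf; first by exists r0.
move=> x /= ux; rewrite leNgt; apply/negP => xlt.
have : cdf_ (a + d / 2) < u.
  apply: Hd; last by rewrite ltrDl divr_gt0.
  by rewrite /ball/= opprD addrA subrr sub0r normrN ger0_norm ?divr_ge0 ?ltW//; lra.
by rewrite ltNge (le_trans ux)// cdf_nd// ltW.
Qed.

Let cdf01 r : 0 <= cdf_ r <= 1.
Proof. by rewrite -!lee_fin cdfE cdf_ge0 cdf_le1. Qed.

Lemma measurable_quantile : measurable_fun [set: R] quantile.
Proof.
rewrite (_ : quantile = fun u => if 0 < u < 1 then quantile u else 0); last first.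
  by apply/funext => u; rewrite /quantile; case: ifP.
move=> mD; apply: (measurability _ (RGenOInfty.measurableE R)) => //.
move=> _ [_ [a ->] <-]; rewrite setTI.
rewrite (_ : _ @^-1` _ = (`]cdf_ a, +oo[ `&` `]0, 1[) `|`
   ([set x | a < 0] `&` ~` `]0, 1[)).
  apply: measurableU; apply: measurableI => //.
  - by have [a0|a0] := boolP (a < 0); [rewrite (_ : [set _ | _] = setT)//|
      rewrite (_ : [set _ | _] = set0)//]; apply/seteqP; split=> // x.
  - exact: measurableC.
apply/seteqP; split=> u /=; rewrite !in_itv/= !andbT; case: ifP => u01.
- by rewrite quantile_gt// => ?; left.
- by right.
- by rewrite quantile_gt// => -[[]|[]].
- by move=> [[]|[]].
Qed.

Lemma quantile_law (A : set (measurableTypeR R)) : measurable A ->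
  unif (quantile @^-1` A) = nu A.
Proof.
move=> mA; rewrite -[quantile @^-1` _]setTI -[RHS]mul1e.
apply: (restr_law (k := 1)) => //; first exact: measurable_quantile.
move=> a; rewrite setTI mul1e.
have -> : nu `]a, +oo[%classic = (1 - cdf_ a)%:E.
  rewrite EFinB cdfE /cdf /distribution /pushforward/=.
  rewrite preimage_id -(probability_setC nu)//; congr (nu _).
  by apply/seteqP; split=> x /=; rewrite !in_itv/= andbT ltNge => /negP.
rewrite -unif_ray01//; apply: eq_unif => //.
  by rewrite -[X in measurable X]setTI; exact: measurable_quantile.
by move=> x x01; rewrite /= !in_itv/= !andbT quantile_gt.
Qed.

End quantile.

(** * Gaussian product measures *)

Section density.
Context d (T : measurableType d) {R : realType}.
Variables (mu nu : {measure set T -> \bar R}) (g : T -> R).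
Hypotheses (mg : measurable_fun setT g) (g0 : forall x, 0 <= g x).
Hypothesis nuE : forall A, measurable A -> nu A = (\int[mu]_(x in A) (g x)%:E)%E.
Local Open Scope ereal_scope.
Import HBNNSimple.

Let integral_density_nnsfun (f : {nnsfun T >-> R}) :
  \int[nu]_x (f x)%:E = \int[mu]_x ((f x)%:E * (g x)%:E).
Proof.
under [LHS]eq_integral do rewrite fimfunE -fsumEFin//.
rewrite [LHS]ge0_integral_fsum//; last 2 first.
  - by move=> r; exact/measurable_EFinP/measurableT_comp.
  - by move=> n x _; rewrite EFinM nnfun_muleindic_ge0.
under [RHS]eq_integral.
  move=> x xD; rewrite muleC fimfunE -fsumEFin// ge0_mule_fsumr; last first.
    by move=> r; rewrite EFinM nnfun_muleindic_ge0.
  over.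
rewrite [RHS]ge0_integral_fsum//; last 2 first.
  - move=> r; apply: emeasurable_funM; first exact/measurable_EFinP.
    by apply/measurable_EFinP; apply/measurableT_comp => //.
  - move=> n x _; rewrite EFinM mule_ge0 ?lee_fin//.
    by rewrite -lee_fin EFinM nnfun_muleindic_ge0.
apply: eq_fsbigr => r _.
rewrite integralZl_indic_nnsfun// (integral_indic _ measurableT)// setIT nuE//.
have [r0|r0] := ltP r 0%R.
  rewrite preimage_nnfun0// integral_set0 mule0; apply/esym; apply: integral0_eq => x _.
  by rewrite indic0 mulr0 mule0.
rewrite -ge0_integralZl//; last 2 first.
  - exact/measurable_EFinP/measurable_funTS.
  - by move=> x _; rewrite lee_fin.
rewrite [LHS]integral_mkcond; apply: eq_integral => x _.
rewrite patchE indicE; case: ifPn => _; first by rewrite mulr1 muleC.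
by rewrite mulr0 mule0.
Qed.

(** Linearity carries [nuE] to simple functions, monotone convergence to nonnegative measurable
    ones. *)
Lemma ge0_integral_density (f : T -> \bar R) :
  measurable_fun setT f -> (forall x, 0 <= f x) ->
  \int[nu]_x f x = \int[mu]_x (f x * (g x)%:E).
Proof.
move=> mf f0.
pose f_ := nnsfun_approx measurableT mf.
transitivity (lim (\int[nu]_x (f_ n x)%:E @[n --> \oo])).
  rewrite -monotone_convergence//=.
  - apply: eq_integral => x /[!inE] xD; apply/esym/cvg_lim => //=.
    exact: cvg_nnsfun_approx.
  - by move=> n; exact/measurable_EFinP/measurable_funTS.
  - by move=> n x _; rewrite lee_fin.
  - by move=> x _ m n mn; rewrite lee_fin; exact/lefP/nd_nnsfun_approx.
under eq_fun do rewrite integral_density_nnsfun.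
rewrite -monotone_convergence//=.
- apply: eq_integral => x /[!inE] xD.
  by apply: cvg_lim => //; apply: cvgeZr => //; exact: cvg_nnsfun_approx.
- move=> n; apply: emeasurable_funM; apply/measurable_EFinP => //.
- by move=> n x _; rewrite mule_ge0 ?lee_fin.
- move=> x _ m n mn; apply: lee_wpmul2r; first by rewrite lee_fin.
  by rewrite lee_fin; exact/lefP/nd_nnsfun_approx.
Qed.

End density.

Lemma ge0_integral_gaussian {R : realType} (f : _ -> \bar R) :
  measurable_fun [set: R] f -> (forall x, 0 <= f x)%E ->
  (\int[gaussian]_x f x =
   \int[lebesgue_measure]_x (f x * (normal_pdf 0 1 x)%:E))%E.
Proof.
move=> mf f0; apply: ge0_integral_density => //.
- exact: measurable_normal_pdf.
- by move=> x; exact: normal_pdf_ge0.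
Qed.

Section rotation.
Context {R : realType} (c s : R).
Hypothesis cs1 : c ^+ 2 + s ^+ 2 = 1.
Hypothesis c0 : c != 0.
Local Notation mu := (@lebesgue_measure R).
Local Notation g := (normal_pdf (0 : R) 1).

Let hZ (k : \bar R) (h : R -> \bar R) : (0 <= k)%E ->
  measurable_fun [set: R] h -> (forall x, (0 <= h x)%E) ->
  (k * \int[mu]_x h x)%E = (\int[mu]_x (k * h x))%E.
Proof. by move=> k0 mh h0; rewrite ge0_integralZl. Qed.

Let swap (F : R * R -> \bar R) : measurable_fun [set: R * R] F ->
  (forall p, (0 <= F p)%E) ->
  (\int[mu]_x \int[mu]_y F (x, y) = \int[mu]_y \int[mu]_x F (x, y))%E.
Proof. by move=> mF F0; exact: (@fubini_tonelli _ _ _ _ _ mu mu F). Qed.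

(** The map (x, y) |-> (c x + s y, s x - c y) is a reflection. It factors as x |-> c x + s y at
    fixed y followed by y |-> (s x - y) / c at fixed x, so two one-dimensional affine substitutions,
    joined by Tonelli exchanges, give the cancelling factors 1/|c| and |c|; this is where c != 0
    enters. *)
Lemma integral_rotation (F : R * R -> \bar R) :
  measurable_fun [set: R * R] F -> (forall p, (0 <= F p)%E) ->
  (\int[mu]_x \int[mu]_y F ((c * x + s * y)%R, (s * x - c * y)%R) =
   \int[mu]_x \int[mu]_y F (x, y))%E.
Proof.
move=> mF F0.
pose u (p : R * R) : R * R := (c * p.1 + s * p.2, s * p.1 - c * p.2).
have mu_ : measurable_fun [set: R * R] u.
  apply: measurable_fun_pair.
    by apply: measurable_funD; apply: measurable_funM.
  by apply: measurable_funB; apply: measurable_funM.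
pose v (p : R * R) : R * R := (p.1, (s * p.1 - p.2) / c).
have mv_ : measurable_fun [set: R * R] v.
  apply: measurable_fun_pair => //.
  by apply: measurable_funM => //; apply: measurable_funB => //; apply: measurable_funM.
have mFv : measurable_fun [set: R * R] (F \o v) by exact: measurableT_comp.
have Fv0 p : (0 <= (F \o v) p)%E by exact: F0.
have Fu0 p : (0 <= (F \o u) p)%E by exact: F0.
have ic0 : `|c| != 0 by rewrite normr_eq0.
have ci0 : - c^-1 != 0 by rewrite oppr_eq0 invr_eq0.
have fiber1 (G : R * R -> \bar R) x : measurable_fun [set: R * R] G ->
    measurable_fun [set: R] (fun y => G (x, y)).
  by move=> mG; apply: measurableT_comp => //; exact: measurable_pair1.
have fiber2 (G : R * R -> \bar R) y : measurable_fun [set: R * R] G ->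
    measurable_fun [set: R] (fun x => G (x, y)).
  by move=> mG; apply: measurableT_comp => //; exact: measurable_pair2.
have mG (G : R * R -> \bar R) : measurable_fun [set: R * R] G ->
    (forall p, (0 <= G p)%E) ->
    measurable_fun [set: R] (fun y => \int[mu]_x G (x, y))%E.
  by move=> mG G0; apply: measurable_fun_fubini_tonelli_G.
have mG' (G : R * R -> \bar R) : measurable_fun [set: R * R] G ->
    (forall p, (0 <= G p)%E) ->
    measurable_fun [set: R] (fun x => \int[mu]_y G (x, y))%E.
  by move=> mG0 G0; apply: measurable_fun_fubini_tonelli_F.
have E1 y : (\int[mu]_x (F \o u) (x, y) = `|c|^-1%:E * \int[mu]_x (F \o v) (x, y))%E.
  rewrite [in RHS](integral_affine (s * y) c0); last 2 first.
  - exact: fiber2.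
  - by move=> x.
  rewrite muleA -EFinM mulVf// mul1e; apply: eq_integral => x _.
  congr F; rewrite /u /v/=; congr pair; apply: (mulIf c0); rewrite divfK//.
  have := cs1; move=> /(canRL (addrK _)) cE.
  by rewrite mulrDr !mulrA -!expr2 mulrBl -[c * _ * c]mulrAC -expr2 cE; ring.
have E2 x : (\int[mu]_y (F \o v) (x, y) = `|c|%:E * \int[mu]_y F (x, y))%E.
  rewrite [in RHS](integral_affine (s * x / c) ci0); last 2 first.
  - exact: fiber1.
  - by move=> y.
  rewrite normrN normfV muleA -EFinM mulfV// mul1e; apply: eq_integral => y _.
  by congr F; rewrite /v/= mulrBl addrC mulNr (mulrC y).
rewrite (swap (measurableT_comp mF mu_) Fu0).
under eq_integral do rewrite E1.
rewrite -(hZ _ (mG _ mFv Fv0)) ?lee_fin ?invr_ge0//; last first.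
  by move=> y; exact: integral_ge0.
rewrite -(swap mFv Fv0).
under eq_integral do rewrite E2.
rewrite -(hZ _ (mG' _ mF F0)) ?lee_fin//; last first.
  by move=> y; exact: integral_ge0.
by rewrite muleA -EFinM mulVf// mul1e.
Qed.

Let g_rot (x y : R) : g x * g y = g (c * x + s * y) * g (s * x - c * y).
Proof.
rewrite !normal_pdfE ?oner_neq0// /normal_fun.
rewrite mulrACA [RHS]mulrACA -!expRD; congr (_ * expR _).
rewrite !subr0 -!mulrDl; congr (_ / _).
have -> : - x ^+ 2 + - y ^+ 2 = - ((c ^+ 2 + s ^+ 2) * (x ^+ 2 + y ^+ 2)).
  by rewrite cs1 mul1r opprD.
ring.
Qed.

Let gE x : (0 <= (g x)%:E)%E. Proof. by rewrite lee_fin normal_pdf_ge0. Qed.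

Let mg' : measurable_fun [set: R] (fun y : R => (g y)%:E).
Proof. by apply/measurable_EFinP; exact: measurable_normal_pdf. Qed.

Lemma gaussian_productE (E : set (measurableTypeR R * measurableTypeR R)) :
  measurable E ->
  ((gaussian \x gaussian) E =
   \int[mu]_x \int[mu]_y ((\1_E (x, y))%:E * ((g x)%:E * (g y)%:E)))%E.
Proof.
move=> mE.
have mI : measurable_fun [set: R * R] (fun p : R * R => (\1_E p)%:E : \bar R).
  exact/measurable_EFinP/measurable_indic.
have I0 p : (0 <= (\1_E p)%:E :> \bar R)%E by rewrite lee_fin.
have fiber1 x : measurable_fun [set: R] (fun y => (\1_E (x, y))%:E : \bar R).
  by apply: (measurableT_comp (f := fun p : R * R => (\1_E p)%:E)) => //; exact: measurable_pair1.
rewrite -[E in LHS]setIT -(integral_indic _ measurableT)//.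
rewrite (@fubini_tonelli1 _ _ _ _ R gaussian gaussian (fun p => (\1_E p)%:E))//.
rewrite ge0_integral_gaussian; last 2 first.
- by apply: measurable_fun_fubini_tonelli_F.
- by move=> x; apply: integral_ge0 => y _.
apply: eq_integral => x _; rewrite /fubini_F.
rewrite ge0_integral_gaussian//.
rewrite muleC hZ//; last 2 first.
- by apply: emeasurable_funM => //; exact: fiber1.
- by move=> y; rewrite mule_ge0.
by apply: eq_integral => y _; rewrite muleCA.
Qed.

(** The product density depends on x^2 + y^2 alone, which the reflection preserves. With c = s =
    1/sqrt 2 this makes the normalised sum and difference of two independent normal variables
    independent and normal. *)
Lemma gaussian_rotation (A B : set (measurableTypeR R)) :
  measurable A -> measurable B ->
  (gaussian \x gaussian)%E
    [set p : measurableTypeR R * measurableTypeR R |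
      A (c * p.1 + s * p.2) /\ B (s * p.1 - c * p.2)] =
  (gaussian A * gaussian B)%E.
Proof.
move=> mA mB.
set E := [set _ | _].
pose u (p : R * R) : R := c * p.1 + s * p.2.
pose v (p : R * R) : R := s * p.1 - c * p.2.
have mE : measurable (E : set (measurableTypeR R * measurableTypeR R)).
  have mu_ : measurable_fun [set: R * R] u.
    by apply: measurable_funD; apply: measurable_funM.
  have mv_ : measurable_fun [set: R * R] v.
    by apply: measurable_funB; apply: measurable_funM.
  rewrite (_ : E = u @^-1` A `&` v @^-1` B)//.
  by apply: measurableI; rewrite -[X in measurable X]setTI; [exact: mu_|exact: mv_].
have mAB : measurable (A `*` B) by exact: measurableX.
rewrite -(product_measure1E gaussian gaussian mA mB).
rewrite (gaussian_productE mE) (gaussian_productE mAB).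
pose F (p : R * R) : \bar R := ((\1_(A `*` B) p)%:E * ((g p.1)%:E * (g p.2)%:E))%E.
rewrite -[RHS](integral_rotation (F := F)).
- apply: eq_integral => x _; apply: eq_integral => y _.
  by rewrite /F -!EFinM g_rot; congr (_ * _)%:E; rewrite !indicE.
- apply: emeasurable_funM; first exact/measurable_EFinP/measurable_indic.
  by apply: emeasurable_funM; apply: (measurableT_comp mg').
- by move=> p; rewrite /F !mule_ge0// lee_fin.
Qed.

End rotation.

(** * A self-similar probability space *)

Lemma rect_measure_unique d1 d2 (T1 : measurableType d1) (T2 : measurableType d2)
    (R : realType) (m1 m2 : {measure set (T1 * T2) -> \bar R}) :
  (m1 setT < +oo)%E ->
  (forall A B, measurable A -> measurable B -> m1 (A `*` B) = m2 (A `*` B)) ->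
  forall E, measurable E -> m1 E = m2 E.
Proof.
move=> m1fin m12.
pose C : set (set (T1 * T2)) :=
  [set C | exists A, measurable A /\ exists B, measurable B /\ C = A `*` B].
have CI : setI_closed C.
  move=> /= _ _ [X1 [mX1 [X2 [mX2 ->]]]] [Y1 [mY1 [Y2 [mY2 ->]]]].
  rewrite -setXI; exists (X1 `&` Y1); split; first exact: measurableI.
  by exists (X2 `&` Y2); split => //; exact: measurableI.
move=> X mX; apply: (measure_unique C (fun=> setT)) => //.
- rewrite measurable_prod_measurableType //; congr (<<s _ >>).
  rewrite predeqE; split => [[A mA [B mB <-]]|[A [mA [B [mB ->]]]]].
    by exists A; split => //; exists B.
  by exists A => //; exists B.
- by move=> n; exists setT; split=> //; exists setT; split=> //; rewrite setXTT.
- by apply/seteqP; split=> // x _; exists 0%N.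
- by move=> A [A1 [mA1 [A2 [mA2 ->]]]]; exact: m12.
Qed.

Lemma restr_rect_law d d1 d2 (T : measurableType d) (T1 : measurableType d1)
    (T2 : measurableType d2) (R : realType) (P : probability T R)
    (nu : probability (T1 * T2)%type R) (D : set T) (X : T -> T1 * T2) (k : R) :
  measurable D -> measurable_fun setT X -> 0 <= k ->
  (forall A B, measurable A -> measurable B ->
    P (D `&` X @^-1` (A `*` B)) = (k%:E * nu (A `*` B))%E) ->
  forall E, measurable E -> P (D `&` X @^-1` E) = (k%:E * nu E)%E.
Proof.
move=> mD mX k0 H E mE.
pose XX : {mfun T >-> (T1 * T2)%type} :=
  HB.pack X (isMeasurableFun.Build _ _ _ _ X mX).
pose K : {nonneg R} := NngNum k0.
have E1 B : pushforward (mrestr P mD) XX B = P (D `&` X @^-1` B).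
  by rewrite /pushforward/= /mrestr setIC.
rewrite -E1 -[RHS]/(mscale K nu E).
apply: (rect_measure_unique (m1 := pushforward (mrestr P mD) XX)) => //.
- rewrite [X in (X < _)%E]E1 (le_lt_trans (probability_le1 P _))// ?ltry//.
  by apply: measurableI => //; rewrite preimage_setT.
- by move=> A B mA mB; rewrite [LHS]E1 H.
Qed.

Lemma measurable_preimage d1 d2 (T1 : measurableType d1) (T2 : measurableType d2)
    (f : T1 -> T2) (B : set T2) :
  measurable_fun setT f -> measurable B -> measurable (f @^-1` B).
Proof. by move=> mf mB; rewrite -[X in measurable X]setTI; exact: mf. Qed.

Lemma joint_law d d1 d2 (T : measurableType d) (T1 : measurableType d1)
    (T2 : measurableType d2) (R : realType) (P : probability T R)
    (nu1 : probability T1 R) (nu2 : probability T2 R) (D : set T)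
    (X : T -> T1) (Y : T -> T2) (k : R) :
  measurable D -> measurable_fun setT X -> measurable_fun setT Y -> 0 <= k ->
  (forall A B, measurable A -> measurable B ->
    P (D `&` (X @^-1` A `&` Y @^-1` B)) = (k%:E * (nu1 A * nu2 B))%E) ->
  forall E, measurable E ->
    P (D `&` [set w | E (X w, Y w)]) = (k%:E * (nu1 \x nu2) E)%E.
Proof.
move=> mD mX mY k0 H E mE.
apply: (restr_rect_law (X := fun w => (X w, Y w)) (nu := (nu1 \x nu2)%E)) => //.
  exact: measurable_fun_pair.
move=> A B mA mB; transitivity (k%:E * (nu1 A * nu2 B))%E; first exact: H.
congr (_ * _)%E; exact: (esym (product_measure1E nu1 nu2 mA mB)).
Qed.

(** With [B = setT], [splitting_law] says that [L false] preserves [P], and likewise for [L true].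
    The root identity holds at every sample point, so the dyadic increments built from it are
    consistent for every path. *)
Record splitting d (T : measurableType d) (R : realType) (P : probability T R)
    (L : bool -> T -> T) (X : T -> R) : Prop := {
  splitting_measurable : forall b, measurable_fun setT (L b) ;
  splitting_root_measurable : measurable_fun setT X ;
  splitting_law : forall A B, measurable A -> measurable B ->
    P (L false @^-1` A `&` L true @^-1` B) = (P A * P B)%E ;
  splitting_gaussian : forall A, measurable A -> P (X @^-1` A) = gaussian A ;
  splitting_root : forall w, X w = (X (L false w) + X (L true w)) / Num.sqrt 2 }.

Section splitting_space.
Context (R : realType).
Local Notation T := (measurableTypeR R * measurableTypeR R)%type.

Let P : probability T R := (gaussian \x unif)%E.

Let P_rect (A B : set (measurableTypeR R)) : measurable A -> measurable B ->
  P (A `*` B) = (gaussian A * unif B)%E.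
Proof. exact: product_measure1E. Qed.

Let r2 : R := Num.sqrt 2.
Let r20 : r2 != 0. Proof. by rewrite sqrtr_eq0 -ltNge. Qed.
Let r22 : r2 ^+ 2 = 2. Proof. by rewrite sqr_sqrtr. Qed.

(** A uniform seed u yields three independent variables: the normal [p u] and two fresh uniform
    seeds [q true u] and [q false u]. *)
Let p (u : R) : R := quantile gaussian (halves true u).
Let q (b : bool) (u : R) : R := halves b (halves false u).

Let mp : measurable_fun [set: R] p.
Proof.
by apply: measurableT_comp; [exact: measurable_quantile|exact: measurable_halves].
Qed.

Let mq b : measurable_fun [set: R] (q b).
Proof. by apply: measurableT_comp; exact: measurable_halves. Qed.

Let pq_law (A B C : set (measurableTypeR R)) :
  measurable A -> measurable B -> measurable C ->
  unif (p @^-1` A `&` (q true @^-1` B `&` q false @^-1` C)) =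
  (gaussian A * (unif B * unif C))%E.
Proof.
move=> mA mB mC.
rewrite -(quantile_law gaussian mA) -halves_law// -halves_law//.
- exact: (measurable_preimage (@measurable_quantile _ _)).
- by apply: measurableI; apply: (measurable_preimage (@measurable_halves _ _)).
Qed.

(** The midpoint construction: the first coordinate x is a normalised increment, [p u] is the
    independent deviation that distributes it over its two halves (x + p u) / sqrt 2 and (x - p u) /
    sqrt 2, and each half receives its own seed. *)
Let move_ (b : bool) (w : T) : T :=
  (r2^-1 * w.1 + (if b then - r2^-1 else r2^-1) * p w.2, q b w.2).

Let m1 : measurable_fun setT (fst : T -> R). Proof. exact: measurable_fst. Qed.
Let m2 : measurable_fun setT (snd : T -> R). Proof. exact: measurable_snd. Qed.

Let mmove b : measurable_fun setT (move_ b).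
Proof.
apply: measurable_fun_pair; last by apply: measurableT_comp => //; exact: mq.
by apply: measurable_funD; apply: measurable_funM => //; apply: measurableT_comp.
Qed.

(** The two normal coordinates come from reflecting the independent pair (x, p u); the event [D] on
    the two fresh seeds is independent of that pair. *)
Let move_rect (A1 A2 B1 B2 : set (measurableTypeR R)) :
  measurable A1 -> measurable A2 -> measurable B1 -> measurable B2 ->
  P (move_ false @^-1` (A1 `*` A2) `&` move_ true @^-1` (B1 `*` B2)) =
  (P (A1 `*` A2) * P (B1 `*` B2))%E.
Proof.
move=> mA1 mA2 mB1 mB2.
pose D : set T := setT `*` (q true @^-1` B2 `&` q false @^-1` A2).
pose F : set T := [set w | A1 (r2^-1 * w.1 + r2^-1 * w.2) /\ B1 (r2^-1 * w.1 - r2^-1 * w.2)].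
have mF : measurable F.
  apply: measurableI.
    apply: (measurable_preimage (f := fun w : T => r2^-1 * w.1 + r2^-1 * w.2)) => //.
    by apply: measurable_funD; apply: measurable_funM.
  apply: (measurable_preimage (f := fun w : T => r2^-1 * w.1 - r2^-1 * w.2)) => //.
  by apply: measurable_funB; apply: measurable_funM.
have mD2 : measurable (q true @^-1` B2 `&` q false @^-1` A2).
  by apply: measurableI; apply: (measurable_preimage (@mq _)).
have mD : measurable D by exact: measurableX.
have -> : move_ false @^-1` (A1 `*` A2) `&` move_ true @^-1` (B1 `*` B2) =
    D `&` [set w | F (w.1, p w.2)].
  apply/seteqP; split=> -[x u] /=; rewrite /move_/= mulNr.
    by move=> [[? ?] [? ?]]; split.
  by move=> [[_ [? ?]] [? ?]]; split.
have U0 E : measurable E -> (0 <= fine (unif (E : set (measurableTypeR R)))) by move=> _; exact: fine_ge0.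
rewrite (joint_law (k := fine (unif B2) * fine (unif A2)) (nu1 := gaussian) (nu2 := gaussian))//.
- rewrite gaussian_rotation//; last 2 first.
  + rewrite exprVn r22; lra.
  + by rewrite invr_eq0.
  rewrite EFinM !fineK ?fin_num_measure// !P_rect//.
  move: (unif B2) (unif A2) (gaussian A1) (gaussian B1) => x y z t.
  by rewrite (muleC x) muleACA (muleC y) (muleC x).
- by apply: measurableT_comp.
- by rewrite mulr_ge0// U0.
- move=> A B mA mB.
  have -> : D `&` (fst @^-1` A `&` (fun w : T => p w.2) @^-1` B) =
     A `*` (p @^-1` B `&` (q true @^-1` B2 `&` q false @^-1` A2)).
    by apply/seteqP; split=> -[x u] /= => [[[_ [? ?]] [? ?]]|[? [? [? ?]]]]; split.
  rewrite P_rect//; last first.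
    by apply: measurableI => //; exact: (measurable_preimage mp).
  rewrite pq_law// EFinM !fineK ?fin_num_measure//.
  by rewrite muleC -!muleA muleCA; congr (_ * _)%E; rewrite muleC -muleA; congr (_ * _)%E; rewrite muleC.
Qed.

Lemma splitting_space_exists : exists (d : measure_display) (T : measurableType d)
  (P : probability T R) (L : bool -> T -> T) (X : T -> R), splitting P L X.
Proof.
exists _, T, P, move_, fst; split=> //.
- move=> A B mA mB.
  rewrite -(fineK (fin_num_measure P A mA)).
  apply: (restr_rect_law (D := move_ false @^-1` A)) => //.
  + exact: (measurable_preimage (mmove _)).
  + exact: fine_ge0.
  move=> B1 B2 mB1 mB2; rewrite fineK ?fin_num_measure// muleC setIC.
  rewrite -(fineK (fin_num_measure P _ (measurableX mB1 mB2))).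
  apply: (restr_rect_law (D := move_ true @^-1` (B1 `*` B2))) => //.
  + by apply: (measurable_preimage (mmove _)); exact: measurableX.
  + exact: fine_ge0.
  move=> A1 A2 mA1 mA2; rewrite fineK ?fin_num_measure//; last exact: measurableX.
  by rewrite setIC (move_rect mA1 mA2 mB1 mB2); exact: muleC.
- move=> A mA; rewrite -[RHS]mule1 -(probability_setT unif).
  have -> : fst @^-1` A = A `*` (setT : set (measurableTypeR R)).
    by apply/seteqP; split=> -[x u] // [].
  exact: P_rect.
- move=> w; rewrite /move_/= mulNr addrACA subrr addr0 mulrDl mulrAC -invfM -expr2 r22.
  by rewrite mulrC -splitr.
Qed.

End splitting_space.

(** * Weighted sums of independent normal variables *)

Lemma measurable_scale (R : realType) (s : R) :
  measurable_fun [set: R] (fun x : R => s * x).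
Proof. exact: measurable_funM. Qed.

Definition scale_mfun {R : realType} (s : R) : {mfun measurableTypeR R >-> measurableTypeR R} :=
  let f : measurableTypeR R -> measurableTypeR R := fun x : R => s * x in
  let mf : @measurable_fun _ _ (measurableTypeR R) (measurableTypeR R) setT f := measurable_scale s in
  HB.pack_for {mfun measurableTypeR R >-> measurableTypeR R} f (isMeasurableFun.Build _ _ _ _ f mf).

(** Parametrised by a scaling of the standard law, as in [centered_gaussian]; s = 0 gives the point
    mass at 0. *)
Definition gauss_law {R : realType} (s : R) : probability (measurableTypeR R) R :=
  distribution gaussian (scale_mfun s).

Section gauss_law.
Context {R : realType}.
Implicit Types (s a : R) (B : set (measurableTypeR R)).

Lemma gauss_lawE s B : gauss_law s B = normal_prob 0 1 ((fun r : R => s * r) @^-1` B).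
Proof. by []. Qed.

Let product_sum s a B : measurable B ->
  ((gauss_law s \x gaussian) [set p : measurableTypeR R * measurableTypeR R | B (p.1 + a * p.2)%R] =
   (gaussian \x gaussian) [set p : measurableTypeR R * measurableTypeR R | B (s * p.1 + a * p.2)%R])%E.
Proof.
move=> mB.
have mE : measurable [set p : measurableTypeR R * measurableTypeR R | B (p.1 + a * p.2)%R].
  apply: (measurable_preimage (f := fun p : measurableTypeR R * measurableTypeR R => (p.1 + a * p.2 : R))) => //.
  by apply: measurable_funD => //; apply: measurable_funM.
have J : forall E, measurable E ->
    (gaussian \x gaussian)%E (setT `&` [set w : measurableTypeR R * measurableTypeR R | E ((s * w.1)%R, w.2)]) =
    (1%:E * (gauss_law s \x gaussian) E)%E.
  apply: (joint_law (P := (gaussian \x gaussian)%E)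
    (X := fun p : measurableTypeR R * measurableTypeR R => (s * p.1)%R : measurableTypeR R)
    (Y := snd)) => //.
    exact: measurable_funM.
  move=> A C mA mC; rewrite setTI mul1e.
  exact: (product_measure1E gaussian gaussian (measurable_preimage (measurable_scale s) mA) mC).
by have := J _ mE; rewrite setTI mul1e => <-.
Qed.

(** Symmetry is the case c = -1, s = 0 of [gaussian_rotation], read off the first coordinate. *)
Lemma gauss_lawN s B : measurable B -> gauss_law (- s) B = gauss_law s B.
Proof.
move=> mB; have c0 : (-1 : R) != 0 by rewrite oppr_eq0 oner_neq0.
have cs : (-1 : R) ^+ 2 + 0 ^+ 2 = 1 by rewrite sqrrN expr1n expr0n addr0.
have mA := measurable_preimage (measurable_scale s) mB.
have mA' := measurable_preimage (measurable_scale (- s)) mB.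
have E := gaussian_rotation cs c0 mA (@measurableT _ _).
rewrite probability_setT mule1 in E.
transitivity (gaussian ((fun r : R => s * r) @^-1` B)); last by [].
rewrite -E -[LHS]mule1 -(probability_setT (@gaussian R)).
rewrite -(product_measure1E gaussian gaussian mA' measurableT).
congr ((_ \x _)%E _); apply/seteqP; split=> -[x y]/=.
  by rewrite mul0r addr0 mulrA mulrN1 => -[].
by rewrite mul0r addr0 mulrA mulrN1 => -[].
Qed.

(** With r^2 = s^2 + a^2, the sum s x + a y is r times a reflected coordinate with c = s/r. The
    reflection needs c != 0, so s = 0 is separate; there r = |a| and symmetry concludes. *)
Lemma gauss_law_sum s a B : measurable B ->
  ((gauss_law s \x gaussian) [set p : measurableTypeR R * measurableTypeR R | B (p.1 + a * p.2)%R])%E =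
  gauss_law (Num.sqrt (s ^+ 2 + a ^+ 2)) B.
Proof.
move=> mB; rewrite product_sum//.
have [->|s0] := eqVneq s 0.
  rewrite expr0n add0r sqrtr_sqr.
  rewrite (_ : [set _ | _] = setT `*` ((fun r : R => a * r) @^-1` B)); last first.
    by apply/seteqP; split=> -[x y]/=; rewrite mul0r add0r => // -[].
  rewrite (product_measure1E gaussian gaussian measurableT (measurable_preimage (measurable_scale a) mB)).
  have gT : gaussian (setT : set (measurableTypeR R)) = 1%E by exact: probability_setT.
  have aux (x y : \bar R) : x = 1%E -> (x * y = 1 * y)%E by move=> ->.
  rewrite (aux _ _ gT).
  rewrite mul1e.
  transitivity (gauss_law a B); first by [].
  by have [a0|a0] := ger0P a; [|exact: esym (gauss_lawN a mB)].
pose r : R := Num.sqrt (s ^+ 2 + a ^+ 2); rewrite -/r.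
have r0 : r != 0.
  rewrite sqrtr_eq0 -ltNge ltr_pwDl ?sqr_ge0//.
  by rewrite exprn_even_gt0.
have r2 : r ^+ 2 = s ^+ 2 + a ^+ 2 by rewrite sqr_sqrtr// addr_ge0// sqr_ge0.
have cs : (s / r) ^+ 2 + (a / r) ^+ 2 = 1.
  by rewrite !expr_div_n -mulrDl -r2 divff// expf_neq0.
have c0 : s / r != 0 by rewrite mulf_neq0// invr_eq0.
have mA := measurable_preimage (measurable_scale r) mB.
have E := gaussian_rotation cs c0 mA (@measurableT _ _).
rewrite probability_setT mule1 in E.
transitivity (gaussian ((fun x : R => r * x) @^-1` B)); last by [].
rewrite -E; congr ((_ \x _)%E _).
have rE (x y : R) : r * (s / r * x + a / r * y) = s * x + a * y by field.
by apply/seteqP; split=> -[x y]/=; rewrite rE => // -[].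
Qed.

End gauss_law.

Definition iid_gaussian d (T : measurableType d) (R : realType) (P : probability T R)
    (xi : nat -> T -> R) : Prop :=
  (forall j, measurable_fun setT (xi j)) /\
  forall (A : nat -> set R) n, (forall i, measurable (A i)) ->
    P [set w | forall i, (i < n)%N -> A i (xi i w)] =
    (\prod_(i < n) gaussian (A i : set (measurableTypeR R)))%E.

Section blocks.
Context d (T : measurableType d) (R : realType) (P : probability T R).
Variable xi : nat -> T -> R.
Hypothesis xi_iid : iid_gaussian P xi.
Variable a : nat -> R.

Let mxi j : measurable_fun setT (xi j). Proof. by case: xi_iid. Qed.

Definition block (k l : nat) (w : T) : R := \sum_(k <= j < l) a j * xi j w.

Definition block_sd (k l : nat) : R := Num.sqrt (\sum_(k <= j < l) a j ^+ 2).

Lemma measurable_block k l : measurable_fun setT (block k l).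
Proof. by apply: measurable_sum => j; apply: measurable_funM. Qed.

Let future k n (A : nat -> set R) : set T :=
  [set w | forall i, (i < n)%N -> A i (xi (k + i) w)].

Let mfuture k n A : (forall i, measurable (A i)) -> measurable (future k n A).
Proof.
move=> mA; rewrite (_ : future k n A = \bigcap_(i in `I_n) (xi (k + i) @^-1` A i)).
  by apply: bigcap_measurableType => i _; exact: measurable_preimage.
by apply/seteqP; split=> w Hw i /=; exact: Hw.
Qed.

(* [D] is independent of the variables of rank at least [k] *)
Let past k (D : set T) : Prop := measurable D /\
  forall n A, (forall i, measurable (A i)) ->
    P (D `&` future k n A) = (P D * \prod_(i < n) gaussian (A i : set (measurableTypeR R)))%E.

Let past0 : past 0 setT.
Proof.
split=> // n A mA; rewrite setTI probability_setT mul1e.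
exact: (proj2 xi_iid).
Qed.

(** The induction adds one variable to the block. Keeping an arbitrary event of the future in the
    statement is what allows the next variable to be taken from that future. *)
Let past_block_aux k l D (B : set R) n A : past k D -> measurable B ->
  (forall i, measurable (A i)) ->
  P (D `&` block k (k + l) @^-1` B `&` future (k + l) n A) =
  (P D * gauss_law (block_sd k (k + l)) B * \prod_(i < n) gaussian (A i : set (measurableTypeR R)))%E.
Proof.
move=> [mD pD]; elim: l B n A => [|l IH] B n A mB mA.
  rewrite addn0 /block_sd big_geq// sqrtr0 gauss_lawE.
  have [B0|B0] := pselect (B 0).
    rewrite (_ : block _ _ @^-1` B = setT); last first.
      by apply/seteqP; split=> // w _; rewrite /block/preimage/= big_geq.
    rewrite (_ : _ @^-1` B = setT); last first.
      by apply/seteqP; split=> // x _; rewrite /preimage/= mul0r.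
    by rewrite setIT pD// [normal_prob _ _ _](probability_setT (@gaussian R)) mule1.
  rewrite (_ : block _ _ @^-1` B = set0); last first.
    by apply/seteqP; split=> // w; rewrite /block/preimage/= big_geq.
  rewrite (_ : _ @^-1` B = set0); last first.
    by apply/seteqP; split=> // x; rewrite /preimage/= mul0r.
  by rewrite setI0 set0I !measure0 mule0 mul0e.
set F := future _ n A.
have mF : measurable F by exact: mfuture.
have mDF : measurable (D `&` F) by exact: measurableI.
set pn := (\prod_(i < n) _)%E.
have pn_fin : pn \is a fin_num by apply: prode_fin_num => i _; rewrite fin_num_measure//; exact: mA.
have pn0 : (0 <= pn)%E by apply: prode_ge0 => i _.
have sdE : block_sd k (k + l.+1) = Num.sqrt (block_sd k (k + l) ^+ 2 + a (k + l) ^+ 2).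
  rewrite /block_sd sqr_sqrtr ?sumr_ge0// => [|i _]; last exact: sqr_ge0.
  by rewrite addnS big_nat_recr//= leq_addr.
have -> : D `&` block k (k + l.+1) @^-1` B `&` F =
    (D `&` F) `&` [set w | [set p : measurableTypeR R * measurableTypeR R | B (p.1 + a (k + l)%N * p.2)%R]
      (block k (k + l) w, xi (k + l) w)].
  rewrite setIAC; congr (_ `&` _); apply/seteqP; split=> w;
  by rewrite /preimage/= /block addnS big_nat_recr//= leq_addr.
rewrite (joint_law (k := fine (P D) * fine pn) (nu1 := gauss_law (block_sd k (k + l)))
   (nu2 := gaussian) (X := block k (k + l)) (Y := xi (k + l)) (T1 := measurableTypeR R) (T2 := measurableTypeR R))//.
- rewrite gauss_law_sum// -sdE EFinM !fineK ?fin_num_measure//.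
  by rewrite muleAC.
- exact: measurable_block.
- exact: mxi.
- by rewrite mulr_ge0// fine_ge0.
- move=> B1 B2 mB1 mB2; rewrite EFinM !fineK ?fin_num_measure//.
  (* The condition [B2] on the next variable is put in front of those on the later ones. *)
  pose A' i := if i is i'.+1 then A i' else B2.
  have -> : D `&` F `&` (block k (k + l) @^-1` B1 `&` xi (k + l) @^-1` B2) =
     D `&` block k (k + l) @^-1` B1 `&` future (k + l) n.+1 A'.
    apply/seteqP; split=> w.
      move=> [[Dw Fw] [? ?]]; split=> //; move=> [_|i /Fw]; first by rewrite addn0.
      by rewrite !addnS addSn.
    move=> [[Dw ?] Fw]; split; split=> //; last by have := Fw 0%N isT; rewrite addn0.
    by move=> i ni; have := Fw i.+1 ni; rewrite !addnS addSn.
  rewrite IH//; last by case.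
  rewrite big_ord_recl/= -/pn.
  by rewrite -!muleA; congr (_ * _)%E; rewrite [RHS]muleCA; congr (_ * _)%E; rewrite muleC.
apply: (measurable_preimage (f := fun p : measurableTypeR R * measurableTypeR R => (p.1 + a (k + l) * p.2 : R))) => //.
by apply: measurable_funD => //; apply: measurable_funM.
Qed.

Let past_block k l D (B : set R) : (k <= l)%N -> past k D -> measurable B ->
  P (D `&` block k l @^-1` B) = (P D * gauss_law (block_sd k l) B)%E /\
  past l (D `&` block k l @^-1` B).
Proof.
move=> kl pD mB; rewrite -(subnKC kl).
have E : P (D `&` block k (k + (l - k)) @^-1` B) = (P D * gauss_law (block_sd k (k + (l - k))) B)%E.
  have := past_block_aux (l - k) 0 pD mB (A := fun=> setT) (fun=> measurableT).
  rewrite big_ord0 mule1 => <-; congr (P _).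
  by rewrite [X in _ = _ `&` X](_ : _ = setT) ?setIT//; apply/seteqP; split.
split=> //; split.
  by apply: measurableI; [case: pD|exact: (measurable_preimage (measurable_block _ _))].
by move=> n A mA; rewrite past_block_aux// E.
Qed.

Lemma blocks_law (k : nat -> nat) n (B : nat -> set R) :
  {homo k : i j / (i <= j)%N} -> (forall i, measurable (B i)) ->
  P [set w | forall i, (i < n)%N -> B i (block (k i) (k i.+1) w)] =
  (\prod_(i < n) gauss_law (block_sd (k i) (k i.+1)) (B i))%E.
Proof.
move=> kh mB.
suff [] : P [set w | forall i, (i < n)%N -> B i (block (k i) (k i.+1) w)] =
  (\prod_(i < n) gauss_law (block_sd (k i) (k i.+1)) (B i))%E /\
  past (k n) [set w | forall i, (i < n)%N -> B i (block (k i) (k i.+1) w)] by [].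
elim: n => [|n [IH1 IH2]].
  rewrite big_ord0 (_ : [set _ | _] = setT); last by apply/seteqP; split.
  split; first exact: probability_setT.
  split=> // n A mA.
  have := past_block (leq0n (k 0%N)) past0 measurableT.
  by rewrite preimage_setT setTI => -[_ [_ ->]].
have -> : [set w | forall i, (i < n.+1)%N -> B i (block (k i) (k i.+1) w)] =
  [set w | forall i, (i < n)%N -> B i (block (k i) (k i.+1) w)] `&`
    block (k n) (k n.+1) @^-1` B n.
  apply/seteqP; split=> w.
    by move=> H; split; [move=> i /ltnW ni; exact: H|exact: H].
  by move=> [H1 H2] i; rewrite ltnS leq_eqVlt => /orP[/eqP->//|/H1].
have [-> pS] := past_block (kh _ _ (leqnSn n)) IH2 (mB n).
by rewrite IH1 big_ord_recr.
Qed.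

Lemma block_law k l (B : set R) : (k <= l)%N -> measurable B ->
  P (block k l @^-1` B) = gauss_law (block_sd k l) B.
Proof.
move=> kl mB; have [_ p1] := past_block (leq0n k) past0 measurableT.
have [+ _] := past_block kl p1 mB.
by rewrite preimage_setT !setTI probability_setT mul1e.
Qed.

End blocks.

(** * The tree of independent seeds *)

Section tree.
Context d (T : measurableType d) (R : realType) (P : probability T R)
  (L : bool -> T -> T) (X : T -> R).
Hypothesis S : splitting P L X.

(* The seeds [node m j], for fixed [m], are independent copies of the sample
   point; [node m j] splits into [node m.+1 j.*2] and [node m.+1 j.*2.+1]. *)
Fixpoint node (m j : nat) (w : T) : T :=
  if m is m'.+1 then L (odd j) (node m' j./2 w) else L false (iter j (L true) w).

Definition eta (m j : nat) (w : T) : R := X (node m j w).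

Lemma eta_split m j w :
  eta m j w = (eta m.+1 j.*2 w + eta m.+1 j.*2.+1 w) / Num.sqrt 2.
Proof.
by rewrite /eta (splitting_root S) /= !doubleK odd_double uphalf_double.
Qed.

Lemma measurable_node m j : measurable_fun setT (node m j).
Proof.
have mL b : measurable_fun setT (L b) := splitting_measurable S b.
elim: m j => [|m IH] j /=; last exact: measurableT_comp.
apply: measurableT_comp => //.
by elim: j => [|j IH] /=; [exact: measurable_id|exact: measurableT_comp].
Qed.

Lemma measurable_eta m j : measurable_fun setT (eta m j).
Proof.
by apply: measurableT_comp; [exact: (splitting_root_measurable S)|exact: measurable_node].
Qed.

Let mset (A : nat -> set T) n (f : nat -> T -> T) :
  (forall i, measurable (A i)) -> (forall i, measurable_fun setT (f i)) ->
  measurable [set w | forall i, (i < n)%N -> A i (f i w)].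
Proof.
move=> mA mf.
rewrite (_ : [set _ | _] = \bigcap_(i in `I_n) (f i @^-1` A i)).
  by apply: bigcap_measurableType => i _; exact: measurable_preimage.
by apply/seteqP; split=> w Hw i /=; exact: Hw.
Qed.

(** At m = 0 the seeds are split off one by one along the branch of [L true], and the induction is
    on n. From m to m + 1, conditions on two siblings are merged into one condition on their parent,
    where [splitting_law] separates them. *)
Lemma node_law m n (A : nat -> set T) : (forall i, measurable (A i)) ->
  P [set w | forall i, (i < n)%N -> A i (node m i w)] = (\prod_(i < n) P (A i))%E.
Proof.
elim: m n A => [|m IH] n A mA.
  elim: n A mA => [|n IH] A mA.
    rewrite big_ord0 (_ : [set _ | _] = setT) ?probability_setT//.
    by apply/seteqP; split.
  have -> : [set w | forall i, (i < n.+1)%N -> A i (node 0 i w)] =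
      L false @^-1` A 0%N `&`
      L true @^-1` [set w | forall i, (i < n)%N -> A i.+1 (node 0 i w)].
    apply/seteqP; split=> w.
      move=> H; split; first exact: (H 0%N).
      by move=> i ni; have := H i.+1 ni; rewrite /node iterSr.
    by move=> [H0 H] [_|i ni]; [exact: H0|rewrite /node iterSr; exact: (H i ni)].
  rewrite (splitting_law S)//; last first.
    by apply: (mset (A := fun i => A i.+1)) => // i; exact: measurable_node.
  by rewrite (IH (fun i => A i.+1))// big_ord_recl.
(* Siblings are handled in pairs: the first n parents have 2n children, and those of rank at least n
   are left unconstrained. *)
pose A2 j := if (j < n)%N then A j else setT.
have mA2 j : measurable (A2 j) by rewrite /A2; case: ifP.
pose A' i := L false @^-1` A2 i.*2 `&` L true @^-1` A2 i.*2.+1.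
have mA' i : measurable (A' i).
  by apply: measurableI; apply: (measurable_preimage (splitting_measurable S _)).
have -> : [set w | forall i, (i < n)%N -> A i (node m.+1 i w)] =
    [set w | forall i, (i < n)%N -> A' i (node m i w)].
  apply/seteqP; split=> w H i ni.
    split; rewrite /preimage/= /A2; case: ifP => // lt.
      by have := H _ lt; rewrite /= odd_double doubleK.
    by have := H _ lt; rewrite /= odd_double uphalf_double.
  have lt : (i./2 < n)%N by apply: leq_ltn_trans ni; rewrite leq_half_double -addnn -addnS leq_addr.
  have [] := H _ lt; rewrite /preimage/= /A2 => H1 H2.
  have := odd_double_half i; case: (odd i) => /=; rewrite ?(add0n, add1n) => E.
    by move: H2; rewrite E ni.
  by move: H1; rewrite E ni.
rewrite IH//.
rewrite (eq_bigr (fun i : 'I_n => P (A2 i.*2) * P (A2 i.*2.+1))%E); last first.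
  by move=> i _; rewrite (splitting_law S).
have -> : (\prod_(i < n) (P (A2 i.*2) * P (A2 i.*2.+1)) = \prod_(i < n.*2) P (A2 i))%E.
  move: A2 {mA2 A' mA'} => A2.
  elim: {mA} n => [|n IHn]; first by rewrite !big_ord0.
  by rewrite doubleS !big_ord_recr /= IHn muleA.
have nn : (n <= n.*2)%N by rewrite -addnn leq_addr.
rewrite (big_ord_widen _ (fun i => P (A i)) nn) [RHS]big_mkcond /=.
by apply: eq_bigr => i _; rewrite /A2; case: ifP => // _; rewrite probability_setT.
Qed.

Lemma eta_iid m : iid_gaussian P (eta m).
Proof.
split=> [j|A n mA]; first exact: measurable_eta.
rewrite [LHS](node_law _ _ (A := fun i => X @^-1` A i)).
  by apply: eq_bigr => i _; rewrite (splitting_gaussian S).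
by move=> i; exact: (measurable_preimage (splitting_root_measurable S)).
Qed.

End tree.

(** * Equality of joint laws under limits in probability *)

Section law_lim.
Context d (T : measurableType d) (R : realType) (P : probability T R).
Implicit Types (Y Z : nat -> T -> R).

Lemma restr_law2 (D D' : set T) (X X' : T -> R) :
  measurable D -> measurable D' ->
  measurable_fun setT X -> measurable_fun setT X' ->
  (forall a : R, P (D `&` X @^-1` `]a, +oo[) = P (D' `&` X' @^-1` `]a, +oo[)) ->
  forall A : set R, measurable A -> P (D `&` X @^-1` A) = P (D' `&` X' @^-1` A).
Proof.
move=> mD mD' mX mX' H A mA.
pose XX : {mfun T >-> measurableTypeR R} :=
  HB.pack (X : T -> measurableTypeR R) (isMeasurableFun.Build _ _ _ _ (X : T -> measurableTypeR R) mX).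
pose XX' : {mfun T >-> measurableTypeR R} :=
  HB.pack (X' : T -> measurableTypeR R) (isMeasurableFun.Build _ _ _ _ (X' : T -> measurableTypeR R) mX').
have E1 B : pushforward (mrestr P mD) XX B = P (D `&` X @^-1` B).
  by rewrite /pushforward/= /mrestr setIC.
have E2 B : pushforward (mrestr P mD') XX' B = P (D' `&` X' @^-1` B).
  by rewrite /pushforward/= /mrestr setIC.
rewrite -E1 -E2.
apply: (ray_measure_unique (m1 := pushforward (mrestr P mD) XX)) => //.
- rewrite [X in (X < _)%E]E1 (le_lt_trans (probability_le1 P _))// ?ltry//.
  by apply: measurableI => //; rewrite preimage_setT.
- by move=> a; rewrite [LHS]E1 [RHS]E2 H.
Qed.

Let event n Y (A : nat -> set R) : set T := [set w | forall i, (i < n)%N -> A i (Y i w)].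

Let mevent n Y A : (forall i, measurable_fun setT (Y i)) -> (forall i, measurable (A i)) ->
  measurable (event n Y A).
Proof.
move=> mY mA.
rewrite (_ : event n Y A = \bigcap_(i in `I_n) (Y i @^-1` A i)).
  by apply: bigcap_measurableType => i _; exact: measurable_preimage.
by apply/seteqP; split=> w Hw i /=; exact: Hw.
Qed.

(** Rays are replaced by Borel sets one coordinate at a time: in [claim k] the coordinates below k
    are arbitrary and the others are still rays. *)
Lemma ray_law_eq n Y Z :
  (forall i, measurable_fun setT (Y i)) -> (forall i, measurable_fun setT (Z i)) ->
  (forall a : nat -> R, P (event n Y (fun i => `]a i, +oo[%classic)) =
                        P (event n Z (fun i => `]a i, +oo[%classic))) ->
  forall A, (forall i, measurable (A i)) -> P (event n Y A) = P (event n Z A).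
Proof.
move=> mY mZ H.
suff claim k A : (forall i, measurable (A i)) ->
    (forall i, (k <= i < n)%N -> exists a : R, A i = `]a, +oo[%classic) ->
    P (event n Y A) = P (event n Z A).
  by move=> A mA; apply: (claim n) => // i; rewrite ltnNge andbN.
elim: k A => [|k IH] A mA rA.
  have ch i : exists a : R, (i < n)%N -> A i = `]a, +oo[%classic.
    have [ni|ni] := boolP (i < n)%N; last by exists 0.
    by have [|a Ha] := rA i; [rewrite ni|exists a].
  have [a Ha] := choice ch.
  have E V : event n V A = event n V (fun i => `]a i, +oo[%classic).
    by apply/seteqP; split=> w Hw i ni; have := Hw i ni; rewrite Ha.
  by rewrite !E H.
have [nk|kn] := leqP n k.
  by apply: IH => // i /andP[ki ni]; exfalso; have := leq_trans ni nk; rewrite ltnNge ki.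
pose A' i := if i == k then setT else A i.
have mA' i : measurable (A' i) by rewrite /A'; case: ifP.
have E V (B : set R) : event n V (fun i => if i == k then B else A i) =
    event n V A' `&` V k @^-1` B.
  apply/seteqP; split=> w.
    move=> Hw; split; last by have := Hw k kn; rewrite eqxx.
    by move=> i ni; have := Hw i ni; rewrite /A'; case: ifP.
  by move=> [Hw HB] i ni; case: eqP => [->//|/eqP/negbTE ik]; have := Hw i ni; rewrite /A' ik.
have EA : A = fun i => if i == k then A k else A i.
  by apply/funext => i; case: eqP => [->|].
rewrite EA (E Y) (E Z); apply: restr_law2 => //; try exact: mevent.
move=> a; rewrite -(E Y) -(E Z); apply: IH => i.
  by case: ifP.
move=> /andP[ki ni]; case: eqP => [_|/eqP ik]; first by exists a.
by apply: rA; rewrite ni andbT ltn_neqAle eq_sym ik.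
Qed.

Lemma cvge0_near (u : nat -> \bar R) (e : R) :
  u n @[n --> \oo] --> 0%E -> 0 < e -> \forall n \near \oo, (u n < e%:E)%E.
Proof.
move=> /fine_cvgP[ufin uc] e0.
have /cvgr_lt/(_ _ e0) ue := uc.
by apply: filterS (filterI ufin ue) => n [un lt]; rewrite -(fineK un) lte_fin.
Qed.

Definition far (U V : T -> R) (e : R) : set T := [set w | e <= `|U w - V w|].

Lemma measurable_far (U V : T -> R) (e : R) :
  measurable_fun setT U -> measurable_fun setT V ->
  measurable (far U V e).
Proof.
by move=> mU mV; apply: measurable_ge; apply: measurableT_comp => //; exact: measurable_funB.
Qed.

Let G n U (a : nat -> R) := event n U (fun i => `]a i, +oo[%classic).

Let mG n U a : (forall i, measurable_fun setT (U i)) -> measurable (G n U a).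
Proof. by move=> mV; apply: mevent => // i; exact: measurable_itv. Qed.

Let shift n U V (a : nat -> R) (e : R) :
  (forall i, measurable_fun setT (U i)) -> (forall i, measurable_fun setT (V i)) ->
  (P (G n U (fun i => (a i + e)%R)) <=
   P (G n V a) + \sum_(i < n) P (far (U i) (V i) e))%E.
Proof.
move=> mU mV.
pose B i : set T := far (U i) (V i) e.
have mB i : measurable (B i) by exact: measurable_far.
have mUB : measurable (\big[setU/set0]_(i < n) B i) by exact: bigsetU_measurable.
apply: (@le_trans _ _ (P (G n V a `|` \big[setU/set0]_(i < n) B i))).
  apply: le_measure; rewrite ?inE; [exact: mG|by apply: measurableU => //; exact: mG|].
  move=> w GU; have [[i iB]|noB] := pselect (exists i : 'I_n, B i w).
    by right; rewrite -bigcup_mkord; exists i => /=.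
  left=> i ni /=; rewrite in_itv/= andbT.
  have := GU i ni; rewrite /= in_itv/= andbT => lt.
  rewrite ltNge; apply/negP => le; apply: noB; exists (Ordinal ni); rewrite /B/far/=.
  by apply: le_trans (ler_norm _); lra.
apply: le_trans (measureU2 _ _ _) _ => //; first exact: mG.
by apply: leeD2l; exact: Boole_inequality.
Qed.

Let half n (U_ V_ : nat -> nat -> T -> R) U V a :
  (forall m i, measurable_fun setT (U_ m i)) ->
  (forall m i, measurable_fun setT (V_ m i)) ->
  (forall i, measurable_fun setT (U i)) -> (forall i, measurable_fun setT (V i)) ->
  (forall i, cvg_in_measure P setT (U_ ^~ i) (U i : T -> R)) ->
  (forall i, cvg_in_measure P setT (V_ ^~ i) (V i : T -> R)) ->
  (forall m A, (forall i, measurable (A i)) ->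
    P (event n (U_ m) A) = P (event n (V_ m) A)) ->
  (P (G n U a) <= P (G n V a))%E.
Proof.
move=> mU_ mV_ mU mV cU cV UV.
have step (e : R) : 0 < e -> (P (G n U (fun i => (a i + e)%R)) <= P (G n V a))%E.
  move=> e0; pose e2 : R := e / 2; have e20 : 0 < e2 by rewrite divr_gt0.
  apply/lee_addgt0Pr => /= eps eps0.
  (* Each of two families of n exceptional events may use eps/2; the denominator n + 1 also covers n
     = 0. *)
  pose d' : R := eps / (n.+1%:R * 2).
  have d'0 : 0 < d' by rewrite divr_gt0.
  have nearU : \forall m \near \oo, forall i : 'I_n, (P (far (U_ m i) (U i) e2) < d'%:E)%E.
    apply: filter_forall => i; apply: cvge0_near => //.
    by have := cU i e2 e20; under eq_fun do rewrite setTI.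
  have nearV : \forall m \near \oo, forall i : 'I_n, (P (far (V_ m i) (V i) e2) < d'%:E)%E.
    apply: filter_forall => i; apply: cvge0_near => //.
    by have := cV i e2 e20; under eq_fun do rewrite setTI.
  have [m [mU' mV']] : exists m, (forall i : 'I_n, (P (far (U_ m i) (U i) e2) < d'%:E)%E)
      /\ (forall i : 'I_n, (P (far (V_ m i) (V i) e2) < d'%:E)%E).
    by have [m0 _ H] := filterI nearU nearV; exists m0; apply: H => /=.
  have aE : (fun i => (a i + e)%R) = (fun i => ((a i + e2) + e2)%R).
    by apply/funext => i; rewrite /e2; lra.
  have s1 := shift n (fun i => (a i + e2)%R) e2 mU (mU_ m).
  have s2 := shift n a e2 (mV_ m) mV.
  have UVm : P (G n (U_ m) (fun i => (a i + e2)%R)) = P (G n (V_ m) (fun i => (a i + e2)%R)).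
    by apply: UV => i; exact: measurable_itv.
  rewrite aE; apply: le_trans s1 _; rewrite UVm.
  have sumle (F : 'I_n -> \bar R) : (forall i, (F i < d'%:E)%E) ->
      (\sum_(i < n) F i <= (eps / 2)%:E)%E.
    move=> Fd; apply: (@le_trans _ _ (\sum_(i < n) d'%:E)%E).
      by apply: lee_sum => i _; exact: ltW.
    rewrite sumEFin lee_fin sumr_const card_ord -[_ *+ n]mulr_natr /d'.
    have -> : eps / (n.+1%:R * 2) * n%:R = (eps / 2) * (n%:R / n.+1%:R).
      have n0 : n.+1%:R != 0 :> R by rewrite pnatr_eq0.
      by field.
    rewrite ler_piMr ?divr_ge0 ?ltW//.
    by rewrite ltr_pdivrMr// mul1r ltr_nat.
  apply: le_trans (leeD s2 (sumle _ _)) _.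
    by move=> i; rewrite (_ : far _ _ _ = far (U_ m i) (U i) e2)//;
      apply/seteqP; split=> w; rewrite /far/= distrC.
  rewrite -addeA; apply: leeD2l.
  apply: le_trans (leeD2r _ (sumle _ mV')) _.
  by rewrite -EFinD lee_fin -splitr.
pose dl k : R := k.+1%:R^-1.
have cvgG : P (G n U (fun i => (a i + dl k)%R)) @[k --> \oo] --> P (\bigcup_k G n U (fun i => (a i + dl k)%R)).
  apply: nondecreasing_cvg_mu => //.
  - by move=> k; exact: mG.
  - by apply: bigcup_measurable => k _; exact: mG.
  move=> k l kl; apply/subsetPset => w H i ni; have := H i ni.
  rewrite /= !in_itv/= !andbT; apply: le_lt_trans.
  by rewrite lerD2l lef_pV2 ?posrE// ler_nat.
have -> : G n U a = \bigcup_k G n U (fun i => (a i + dl k)%R).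
  apply/seteqP; split=> [w H|w [k _ H] i ni]; last first.
    have := H i ni; rewrite /= !in_itv/= !andbT; apply: le_lt_trans.
    by rewrite lerDl invr_ge0.
  have ev : \forall k \near \oo, forall i : 'I_n, a i + dl k < U i w.
    apply: filter_forall => i.
    have := H i (ltn_ord i); rewrite /= in_itv/= andbT -subr_gt0 => gt.
    have [k _ Hk] := near_infty_natSinv_lt (PosNum gt).
    by exists k => // l /Hk /=; rewrite /dl ltrBrDl.
  have [k _ Hk] := ev; exists k => // i ni.
  by rewrite /= in_itv/= andbT (Hk k _ (Ordinal ni)) //=.
rewrite -(cvg_lim _ cvgG)//; apply: lime_le; first by apply/cvg_ex; eexists; exact: cvgG.
by apply: nearW => k; apply: step; rewrite invr_gt0 ltr0Sn.
Qed.

Lemma law_lim n (Y_ Z_ : nat -> nat -> T -> R) Y Z :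
  (forall m i, measurable_fun setT (Y_ m i)) ->
  (forall m i, measurable_fun setT (Z_ m i)) ->
  (forall i, measurable_fun setT (Y i)) -> (forall i, measurable_fun setT (Z i)) ->
  (forall i, cvg_in_measure P setT (Y_ ^~ i) (Y i : T -> R)) ->
  (forall i, cvg_in_measure P setT (Z_ ^~ i) (Z i : T -> R)) ->
  (forall m A, (forall i, measurable (A i)) ->
    P [set w | forall i, (i < n)%N -> A i (Y_ m i w)] =
    P [set w | forall i, (i < n)%N -> A i (Z_ m i w)]) ->
  forall A, (forall i, measurable (A i)) ->
    P [set w | forall i, (i < n)%N -> A i (Y i w)] =
    P [set w | forall i, (i < n)%N -> A i (Z i w)].
Proof.
move=> mY_ mZ_ mY mZ cY cZ YZ; apply: ray_law_eq => // a.
apply/eqP; rewrite eq_le; apply/andP; split.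
  exact: (half _ mY_ mZ_ mY mZ cY cZ YZ).
by apply: (half _ mZ_ mY_ mZ mY cZ cY) => m A mA; rewrite [RHS]YZ.
Qed.

End law_lim.

(** * Paths with prescribed dyadic increments *)

Lemma geometric_cauchy (R : realType) (V : completeNormedModType R)
    (u : nat -> V) (K q : R) : 0 <= q -> q < 1 ->
  (forall n, `|u n.+1 - u n| <= K * q ^+ n) ->
  cvgn u /\ forall n, `|limn u - u n| <= K * q ^+ n / (1 - q).
Proof.
move=> q0 q1 H.
have q10 : 0 < 1 - q by rewrite subr_gt0.
have K0 : 0 <= K by have := H 0%N; rewrite expr0 mulr1; apply: le_trans.
have B n p : `|u (n + p)%N - u n| <= K * q ^+ n / (1 - q).
  suff : `|u (n + p)%N - u n| <= K * q ^+ n * (1 - q ^+ p) / (1 - q).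
    move/le_trans; apply; rewrite ler_pM2r ?invr_gt0//.
    by rewrite ler_piMr ?mulr_ge0 ?exprn_ge0// lerBlDr lerDl exprn_ge0.
  elim: p => [|p IH]; first by rewrite addn0 subrr normr0 expr0 subrr mulr0 mul0r.
  rewrite addnS -(subrK (u (n + p)%N) (u (n + p).+1)) -addrA.
  apply: le_trans (ler_normD _ _) _; apply: le_trans (lerD (H _) IH) _.
  rewrite le_eqVlt; apply/orP; left; apply/eqP.
  rewrite exprD [q ^+ p.+1]exprSr; have : 1 - q != 0 by rewrite gt_eqF.
  move: (q ^+ n) (q ^+ p) => a b q1n0; field; exact: q1n0.
have Kq : K * q ^+ n / (1 - q) @[n --> \oo] --> (0 : R).
  rewrite (_ : 0 = K * 0 / (1 - q)); last by rewrite mulr0 mul0r.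
  apply: cvgM; last exact: cvg_cst.
  apply: cvgM; first exact: cvg_cst.
  by apply: cvg_expr; rewrite ger0_norm.
have cu : cvgn u.
  apply: cauchy_cvg; apply: cauchy_exP => e e0.
  have [N _ /(_ _ (leqnn _)) HN] : \forall n \near \oo, K * q ^+ n / (1 - q) < e.
    by have /cvgr_lt := Kq; apply.
  exists (u N), N => // n /= Nn; rewrite -ball_normE /ball_/=.
  by rewrite distrC -(subnKC Nn); apply: le_lt_trans (B _ _) HN.
split=> // n.
have dc : `|u (n + p)%N - u n| @[p --> \oo] --> `|limn u - u n|.
  apply: cvg_norm; apply: cvgB; last exact: cvg_cst.
  by rewrite (_ : (fun p => u (n + p)%N) = (fun p => u (p + n)%N)) ?cvg_shiftn//;
    apply/funext => p; rewrite addnC.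
rewrite -(cvg_lim _ dc)//; apply: limr_le; first by apply/cvg_ex; eexists; exact: dc.
by apply: nearW => p; exact: B.
Qed.

Lemma within_continuous_dist (R : realType) (V : normedModType R) (A : set R) (f : R -> V) :
  (forall x, A x -> forall e, 0 < e -> exists2 d, 0 < d &
    forall y, A y -> `|y - x| < d -> `|f y - f x| < e) ->
  {within A, continuous f}.
Proof.
move=> H; apply/subspace_continuousP => x Ax.
apply/cvgrPdist_lt => e e0; have [d d0 Hd] := H x Ax e e0.
rewrite near_withinE; exists d => //= y; rewrite /ball/= => xy Ay.
by rewrite distrC; apply: Hd => //; rewrite distrC.
Qed.

(* With [1/2 < rho^4 < 1], fourth moments bound the increments of level [m] by [rho^m] off a
   summable event. *)
Definition rho {R : realType} : R := 7 / 8.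
Lemma rho_ge0 {R : realType} : 0 <= rho :> R.
Proof. by rewrite /rho; lra. Qed.

Lemma rho_gt0 {R : realType} : 0 < rho :> R.
Proof. by rewrite /rho; lra. Qed.

Lemma rho_lt1 {R : realType} : rho < 1 :> R.
Proof. by rewrite /rho; lra. Qed.

Lemma rho_cvg0 {R : realType} : (rho : R) ^+ m @[m --> \oo] --> (0 : R).
Proof. by apply: cvg_expr; rewrite ger0_norm ?rho_ge0// rho_lt1. Qed.

Section path.
Context {R : realType}.
Implicit Types (e : nat -> nat -> R) (s t C : R).

Definition ticks (m : nat) t : nat := Num.truncn (2 ^+ m * t).

Definition psum e m t : R := \sum_(0 <= i < ticks m t) e m i.

Definition consistent e : Prop := forall m i, e m i = e m.+1 i.*2 + e m.+1 i.*2.+1.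

(** The first M 2^m increments of level m are those over [0, M]. *)
Definition controlled e (M : nat) C : Prop :=
  forall m i, (i < M * 2 ^ m)%N -> `|e m i| <= C * rho ^+ m.

Lemma ticks_itv m t : 0 <= t -> (ticks m t)%:R <= 2 ^+ m * t < (ticks m t).+1%:R.
Proof. by move=> t0; apply: truncn_itv; rewrite mulr_ge0// exprn_ge0. Qed.

Lemma ticks_mono m s t : s <= t -> (ticks m s <= ticks m t)%N.
Proof. by move=> st; apply: le_truncn; rewrite ler_pM2l// exprn_gt0. Qed.

Lemma ticksS m t : 0 <= t ->
  ((ticks m t).*2 <= ticks m.+1 t <= (ticks m t).*2.+1)%N.
Proof.
move=> t0; have /andP[l1 u1] := ticks_itv m t0; have /andP[l2 u2] := ticks_itv m.+1 t0.
have E : (2 : R) ^+ m.+1 * t = 2 * (2 ^+ m * t) by rewrite exprS mulrA.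
rewrite E in l2 u2; apply/andP; split.
  rewrite -ltnS -(ltr_nat R); apply: le_lt_trans u2.
  by rewrite -muln2 natrM mulrC ler_pM2l.
rewrite -ltnS -(ltr_nat R); apply: le_lt_trans l2 _.
rewrite -doubleS -muln2 natrM mulrC ltr_pM2r//.
Qed.

Lemma ticks_le m t (M : nat) : 0 <= t -> t <= M%:R -> (ticks m t <= M * 2 ^ m)%N.
Proof.
move=> t0 tM; have /andP[l1 _] := ticks_itv m t0.
rewrite -(ler_nat R); apply: le_trans l1 _.
by rewrite natrM natrX mulrC ler_pM2r// exprn_gt0.
Qed.

Lemma sum_refine e m j : consistent e ->
  \sum_(0 <= i < j) e m i = \sum_(0 <= i < j.*2) e m.+1 i.
Proof.
by move=> ce; rewrite sum_double; apply: eq_bigr => i _.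
Qed.

(** Refining the partial sum up to t adds at most one increment, since the number of ticks is
    doubled up to one unit and consistency absorbs the doubling. *)
Lemma psum_step e M C m t : consistent e -> controlled e M C ->
  0 <= t -> t <= M%:R -> 0 <= C -> `|psum e m.+1 t - psum e m t| <= C * rho ^+ m.+1.
Proof.
move=> ce Ce t0 tM C0; rewrite /psum (sum_refine m (ticks m t) ce).
have /andP[l u] := ticksS m t0; have := ticks_le m.+1 t0 tM.
move: l; rewrite leq_eqVlt => /orP[/eqP <- _|l].
  by rewrite subrr normr0 mulr_ge0// exprn_ge0// rho_ge0.
have -> : ticks m.+1 t = (ticks m t).*2.+1 by apply/eqP; rewrite eqn_leq u.
by move=> lt; rewrite big_nat_recr//= [_ + e _ _]addrC addrK; exact: Ce.
Qed.

Lemma psum_incr e M C m s t : controlled e M C -> 0 <= s -> s <= t ->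
  t <= M%:R -> 0 <= C -> t - s <= 2^-1 ^+ m ->
  `|psum e m t - psum e m s| <= C * rho ^+ m.
Proof.
move=> Ce s0 st tM C0 d; have t0 := le_trans s0 st.
have := ticks_mono m st; rewrite leq_eqVlt /psum => /orP[/eqP ->|l].
  by rewrite subrr normr0 mulr_ge0// exprn_ge0// rho_ge0.
have /andP[l1 u1] := ticks_itv m s0; have /andP[l2 u2] := ticks_itv m t0.
have u : (ticks m t <= (ticks m s).+1)%N.
  rewrite -ltnS -(ltr_nat R); apply: le_lt_trans l2 _.
  rewrite -natr1; have : 2 ^+ m * t <= 2 ^+ m * s + 1; last by lra.
  have e1 : (2 : R) ^+ m * 2^-1 ^+ m = 1 by rewrite -exprMn mulfV// expr1n.
  have := @ler_wpM2l R (2 ^+ m) (exprn_ge0 _ (ler0n _ _)) _ _ d.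
  by rewrite e1 mulrBr; lra.
have -> : ticks m t = (ticks m s).+1 by apply/eqP; rewrite eqn_leq u.
rewrite big_nat_recr//= [_ + e _ _]addrC addrK; apply: Ce.
by apply: leq_trans l _; exact: ticks_le.
Qed.

Definition path_lim e t : R := limn (fun m => psum e m t).

(** The sum of rho^k over k > m is 7 rho^m, as rho / (1 - rho) = 7; the constant is rounded up to
    8. *)
Lemma path_lim_approx e M C t m : consistent e -> controlled e M C ->
  0 <= t -> t <= M%:R -> 0 <= C ->
  psum e n t @[n --> \oo] --> path_lim e t /\
  `|path_lim e t - psum e m t| <= 8 * C * rho ^+ m.
Proof.
move=> ce Ce t0 tM C0.
have [|cu H] := @geometric_cauchy R R^o (fun m => psum e m t) (C * rho) rho
  rho_ge0 rho_lt1.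
  by move=> n; rewrite -mulrA -exprS; exact: (psum_step n ce Ce t0 tM C0).
split=> //; apply: le_trans (H m) _.
have : 0 <= C * rho ^+ m by rewrite mulr_ge0// exprn_ge0// rho_ge0.
have -> : C * rho * rho ^+ m / (1 - rho) = (C * rho ^+ m) * (rho / (1 - rho)) by rewrite mulrA; congr (_ / _); ring.
have -> : rho / (1 - rho) = 7 :> R by rewrite /rho; field.
by rewrite -[8 * C * _]mulrA; move: (C * rho ^+ m) => z z0; lra.
Qed.

(** Two approximations cost 8 each, and at distance at most 2^-m the partial sums of level m differ
    by at most one increment, whence 17. *)
Lemma path_lim_modulus e M C s t m : consistent e -> controlled e M C ->
  0 <= s -> s <= M%:R -> 0 <= t -> t <= M%:R -> 0 <= C -> `|t - s| <= 2^-1 ^+ m ->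
  `|path_lim e t - path_lim e s| <= 17 * C * rho ^+ m.
Proof.
move=> ce Ce.
wlog st : s t / s <= t.
  move=> H s0 sM t0 tM C0; have [st|/ltW ts] := leP s t; first exact: H.
  by rewrite distrC => ?; rewrite distrC; apply: H.
move=> s0 sM t0 tM C0; rewrite ger0_norm ?subr_ge0// => d.
have [_ Ht] := path_lim_approx m ce Ce t0 tM C0.
have [_ Hs] := path_lim_approx m ce Ce s0 sM C0.
have Hi := psum_incr Ce s0 st tM C0 d.
have -> : path_lim e t - path_lim e s = (path_lim e t - psum e m t) +
  ((psum e m t - psum e m s) - (path_lim e s - psum e m s)) by ring.
apply: le_trans (ler_normD _ _) _; apply: le_trans (lerD Ht (ler_normB _ _)) _.
apply: le_trans (lerD (lexx _) (lerD Hi Hs)) _.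
by rewrite -!mulrA; move: (C * rho ^+ m) => z; lra.
Qed.

Lemma path_lim_continuous e : consistent e ->
  (forall M, exists2 C, 0 <= C & controlled e M C) ->
  {within `[0, +oo[, continuous (path_lim e)}.
Proof.
move=> ce Ce; apply: within_continuous_dist => x /=.
rewrite in_itv/= andbT => x0 r r0.
pose M := (Num.truncn x).+2.
have xM : x + 1 <= M%:R.
  by rewrite /M -natr1 lerD2r ltW// truncnS_gt.
have [C C0 CeM] := Ce M.
have : 17 * C * rho ^+ m @[m --> \oo] --> (0 : R) by apply: scaled_cvg0; exact: rho_cvg0.
move=> /cvgr_lt /(_ _ r0) [m _ /(_ m (leqnn _)) Hm].
exists (2^-1 ^+ m); first by rewrite exprn_gt0// invr_gt0.
move=> y; rewrite in_itv/= andbT => y0 xy.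
have d1 : (2^-1 : R) ^+ m <= 1 by rewrite exprn_ile1// ?invr_ge0// invf_le1// ler1n.
apply: le_lt_trans Hm; apply: (path_lim_modulus ce CeM) => //.
- by lra.
- by have := ler_norm (y - x); lra.
- exact: ltW.
Qed.

End path.

(** * Gaussian moments *)

Section gaussian_moments.
Context {R : realType}.
Local Notation mu := (@lebesgue_measure R).
Local Notation g := (normal_pdf (0 : R) 1).
Local Notation r2 := (Num.sqrt (2 : R)).

Let r20 : r2 != 0. Proof. by rewrite sqrtr_eq0 -ltNge. Qed.
Let r22 : r2 ^+ 2 = 2. Proof. by rewrite sqr_sqrtr. Qed.
Let r2_le2 : r2 <= 2.
Proof. by rewrite -(@ler_pXn2r _ 2%N) ?nnegrE// r22 -natrX ler_nat. Qed.

Let sq_exp (y : R) : 0 <= y -> y ^+ 2 * expR (- y) <= 4.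
Proof.
move=> y0; rewrite expRN ler_pdivrMr ?expR_gt0//.
have h : 1 + y / 2 <= expR (y / 2) by exact: expR_ge1Dx.
have -> : expR y = expR (y / 2) ^+ 2 by rewrite -expRM_natl mulrC divfK.
have : (y / 2) ^+ 2 <= expR (y / 2) ^+ 2.
  by rewrite ler_pXn2r ?nnegrE ?expR_ge0 ?divr_ge0//; lra.
by rewrite expr_div_n; lra.
Qed.

(* comparison with the density of [N(0, 2)] *)
Let pdf_bound (x : R) : x ^+ 4 * g x <= 128 * normal_pdf 0 r2 x.
Proof.
rewrite !normal_pdfE ?oner_neq0// /normal_fun /normal_peak !subr0 expr1n r22.
set y : R := x ^+ 2 / 4; have y0 : 0 <= y by rewrite divr_ge0// sqr_ge0.
have -> : - x ^+ 2 / (1 *+ 2) = - y + - y by rewrite /y; lra.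
have -> : - x ^+ 2 / (2 *+ 2) = - y :> R by rewrite /y -mulr_natl; lra.
have -> : Num.sqrt (2 * pi *+ 2) = Num.sqrt (1 * pi *+ 2) * r2 :> R.
  have p0 : 0 <= 1 * pi *+ 2 :> R by rewrite mul1r mulrn_wge0// pi_ge0.
  rewrite -(sqrtrM _ p0) mul1r [pi *+ 2 * 2]mulrC.
  by congr Num.ExtraDef.sqrtr; rewrite -mulrnAr.
rewrite expRD invfM.
have -> : x ^+ 4 = 16 * y ^+ 2 by rewrite /y; field.
have s0 : 0 <= (Num.sqrt (1 * pi *+ 2))^-1 :> R by rewrite invr_ge0.
move: (_^-1) s0 => k k0.
have E0 := expR_ge0 (- y); have := sq_exp y0; move: (expR (- y)) E0 => E E0 yE.
have := r2_le2; move: r20 => /[swap] r2le r2n.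
have r2i : 1 <= 2 * r2^-1 by rewrite ler_pdivlMr ?mul1r// sqrtr_gt0.
apply: (@le_trans _ _ (64 * (k * E))).
  have -> : 16 * y ^+ 2 * (k * (E * E)) = 16 * (y ^+ 2 * E) * (k * E) by ring.
  apply: ler_wpM2r; first exact: mulr_ge0.
  by lra.
have -> : 128 * (k / r2 * E) = 64 * (k * E) * (2 * r2^-1) by ring.
by rewrite ler_peMr// !mulr_ge0.
Qed.

Let m4 : measurable_fun [set: R] (fun x : R => (x ^+ 4)%:E).
Proof. by apply/measurable_EFinP; exact: measurable_funX. Qed.

Let x4 (x : R) : (0 <= (x ^+ 4)%:E)%E.
Proof. by rewrite lee_fin exprn_even_ge0. Qed.

(** The exact value is 3; comparison with a normal density of larger variance gives a crude bound
    without integration by parts, which is enough for summable tails. *)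
Lemma gaussian_moment4 : (\int[gaussian]_x (x ^+ 4)%:E <= 128%:E :> \bar R)%E.
Proof.
rewrite ge0_integral_gaussian//.
apply: (@le_trans _ _ (\int[mu]_x (128 * normal_pdf 0 r2 x)%:E)%E).
  apply: ge0_le_integral => //.
  - by move=> x _; rewrite mule_ge0// lee_fin normal_pdf_ge0.
  - by apply: emeasurable_funM => //; apply/measurable_EFinP; exact: measurable_normal_pdf.
  - by apply/measurable_EFinP/measurable_funM => //; exact: measurable_normal_pdf.
  - by move=> x _; rewrite -EFinM lee_fin; exact: pdf_bound.
under eq_integral do rewrite EFinM.
rewrite ge0_integralZl//.
- by rewrite integral_normal_pdf mule1.
- by apply/measurable_EFinP; exact: measurable_normal_pdf.
- by move=> x _; rewrite lee_fin normal_pdf_ge0.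
Qed.

(** Markov's inequality for the fourth power. With second moments, the probability that an increment
    of variance 2^-m exceeds rho^m would only be bounded by a multiple of 2^-m rho^(-2m), too much
    for the 2^m increments of a level. *)
Lemma gaussian_tail (c r : R) : 0 < r ->
  (gaussian [set x : measurableTypeR R | (r < `|c * x|)%R] <= (128 * c ^+ 4 / r ^+ 4)%:E)%E.
Proof.
move=> r0; set A := [set x | _].
have mA : measurable (A : set (measurableTypeR R)).
  by apply: measurable_gt; apply: measurableT_comp => //; exact: measurable_scale.
have r40 : 0 < r ^+ 4 by rewrite exprn_gt0.
apply: (@le_trans _ _ (\int[gaussian]_x ((c ^+ 4 / r ^+ 4)%:E * (x ^+ 4)%:E))%E).
  rewrite -[A in leLHS]setIT -(integral_indic _ measurableT)//.
  apply: ge0_le_integral => //.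
  - exact/measurable_EFinP/measurable_indic.
  - exact: emeasurable_funM.
  - move=> x _; rewrite -EFinM lee_fin indicE.
    have [/set_mem xA|_] := boolP (x \in A); last first.
      by rewrite mulr_ge0 ?divr_ge0 ?exprn_even_ge0.
    rewrite mulrAC -exprMn ler_pdivlMr// mul1r.
    have -> : (c * x) ^+ 4 = `|c * x| ^+ 4 by rewrite -normrX ger0_norm// exprn_even_ge0.
    by rewrite ler_pXn2r ?nnegrE// ltW.
rewrite ge0_integralZl//; last by rewrite lee_fin divr_ge0// exprn_even_ge0.
have -> : (128 * c ^+ 4 / r ^+ 4)%:E = ((c ^+ 4 / r ^+ 4)%:E * 128%:E)%E.
  by rewrite -EFinM; congr EFin; rewrite -mulrA mulrC.
apply: lee_wpmul2l; last exact: gaussian_moment4.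
by rewrite lee_fin divr_ge0// exprn_even_ge0.
Qed.

(* Equal to 1, but its value is irrelevant: [embed] below normalizes it away. *)
Definition gauss_var : R := fine (\int[gaussian]_x (x ^+ 2)%:E).

Lemma gauss_varE : (\int[gaussian]_x (x ^+ 2)%:E = (gauss_var)%:E)%E.
Proof.
rewrite fineK// ge0_fin_numE; last by apply: integral_ge0 => x _; rewrite lee_fin sqr_ge0.
apply: (@le_lt_trans _ _ (\int[gaussian]_x ((1:R)%:E + (x ^+ 4)%:E))%E).
  apply: ge0_le_integral => //.
  - by move=> x _; rewrite lee_fin sqr_ge0.
  - by apply/measurable_EFinP; exact: measurable_funX.
  - exact: emeasurable_funD.
  - move=> x _; rewrite -EFinD lee_fin.
    have := sqr_ge0 (x ^+ 2 - 1); have := sqr_ge0 x.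
    by rewrite sqrrB -exprM mulr1 expr1n; nra.
rewrite ge0_integralD//.
have -> : (\int[gaussian]_(x in [set: R]) (1:R)%:E = 1%:E :> \bar R)%E.
  by rewrite integral_cst// mul1e; exact: probability_setT.
apply: le_lt_trans (leeD (lexx _) gaussian_moment4) _.
by rewrite -EFinD ltry.
Qed.

(** A vanishing second moment would concentrate the normal law at 0, but it is dominated by Lebesgue
    measure. *)
Lemma gauss_var_gt0 : 0 < gauss_var.
Proof.
rewrite lt_neqAle eq_sym; apply/andP; split; last first.
  by rewrite fine_ge0// integral_ge0// => x _; rewrite lee_fin sqr_ge0.
apply/eqP => v0.
have : (\int[gaussian]_x `|(x ^+ 2)%:E| = 0 :> \bar R)%E.
  by under eq_integral do rewrite gee0_abs ?lee_fin ?sqr_ge0//; rewrite gauss_varE v0.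
have mX : measurable_fun [set: R] (fun x : R => (x ^+ 2)%:E).
  by apply/measurable_EFinP; exact: measurable_funX.
move=> /(ae_eq_integral_abs gaussian measurableT mX).
case=> N [mN N0 sub].
have : (gaussian (~` [set 0%R] : set (measurableTypeR R)) <= 0)%E.
  rewrite -N0; apply: le_measure; rewrite ?inE//.
    by apply: measurableC; exact: measurable_set1.
  move=> x x0; apply: sub => /= /(_ I) [] /eqP; rewrite sqrf_eq0 => /eqP.
  exact: x0.
rewrite leNgt => /negP; apply.
rewrite probability_setC; last exact: measurable_set1.
have -> : gaussian ([set 0%R] : set (measurableTypeR R)) = 0%E.
  have := @normal_prob_dominates R 0 1 => /null_content_dominatesP; apply.
    exact: measurable_set1.
  exact: lebesgue_measure_set1.
by rewrite sube0 lte01.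
Qed.

Lemma law_integral d (T : measurableType d) (P : probability T R) (X : T -> R) (s : R)
    (f : R -> \bar R) : measurable_fun setT X ->
  (forall A, measurable A -> P (X @^-1` A) = gauss_law s A) ->
  measurable_fun [set: R] f -> (forall x, 0 <= f x)%E ->
  (\int[P]_w f (X w) = \int[gaussian]_x f (s * x)%R)%E.
Proof.
move=> mX lX mf f0.
have -> : (\int[P]_w f (X w) = \int[pushforward P (X : T -> measurableTypeR R)]_x f x)%E.
  by rewrite ge0_integral_pushforward.
have -> : (\int[gaussian]_x f (s * x)%R = \int[pushforward gaussian (scale_mfun s)]_x f x)%E.
  by rewrite ge0_integral_pushforward.
by apply: eq_measure_integral => A mA _; exact: lX.
Qed.

Lemma law_second_moment d (T : measurableType d) (P : probability T R) (X : T -> R) (s : R) :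
  measurable_fun setT X ->
  (forall A, measurable A -> P (X @^-1` A) = gauss_law s A) ->
  (\int[P]_w (X w ^+ 2)%:E = (s ^+ 2 * gauss_var)%:E)%E.
Proof.
move=> mX lX; rewrite (law_integral mX lX (f := fun x => (x ^+ 2)%:E)).
- under eq_integral do rewrite exprMn EFinM.
  rewrite ge0_integralZl//.
  + by rewrite gauss_varE -EFinM.
  + by apply/measurable_EFinP; exact: measurable_funX.
  + by move=> x _; rewrite lee_fin sqr_ge0.
  + by rewrite lee_fin sqr_ge0.
- by apply/measurable_EFinP; exact: measurable_funX.
- by move=> x; rewrite lee_fin sqr_ge0.
Qed.

End gaussian_moments.

(** * Brownian motion *)

(** The event of being far at index n lies in the union of such events over all later indices, and
    these unions decrease to a null set. *)
Lemma ae_cvg_in_measure d (T : measurableType d) (R : realType) (P : probability T R)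
    (X_ : nat -> T -> R) (X : T -> R) (G : set T) :
  (forall n, measurable_fun setT (X_ n)) -> measurable_fun setT X ->
  measurable G -> P (~` G) = 0%E ->
  (forall w, G w -> X_ n w @[n --> \oo] --> X w) ->
  cvg_in_measure P setT X_ (X : T -> R).
Proof.
move=> mX_ mX mG G0 XX e e0.
pose F n : set T := far (X_ n) X e.
have mF n : measurable (F n) by exact: measurable_far.
pose H n := \bigcup_(j >= n) F j.
have mH n : measurable (H n) by apply: bigcup_measurable.
have cH : P (H n) @[n --> \oo] --> P (\bigcap_n H n).
  apply: nonincreasing_cvg_mu => //.
  - by apply: le_lt_trans (probability_le1 P (mH 0%N)) _; rewrite ltry.
  - exact: bigcapT_measurable.
  - move=> n m nm; apply/subsetPset => w [j /= mj Fj].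
    by exists j => //=; exact: leq_trans mj.
have H0 : P (\bigcap_n H n) = 0%E.
  apply/eqP; rewrite eq_le measure_ge0 andbT -G0; apply: le_measure; rewrite ?inE//.
  - exact: bigcapT_measurable.
  - exact: measurableC.
  move=> w Hw Gw; have := XX w Gw => /cvgrPdist_lt /(_ e e0) [n _ Hn].
  have [j /= nj] := Hw n I; rewrite /F /far /= leNgt => /negP; apply.
  by rewrite distrC; exact: (Hn j nj).
rewrite H0 in cH.
have cst0 : (fun _ : nat => 0%E : \bar R) @ \oo --> 0%E by exact: cvg_cst.
apply: (squeeze_cvge _ cst0 cH); apply: nearW => n; rewrite measure_ge0/= setTI.
by apply: le_measure; rewrite ?inE//; [exact: mF|move=> w Fw; exists n => /=].
Qed.

Section brownian.
Context d (T : measurableType d) (R : realType) (P : probability T R)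
  (L : bool -> T -> T) (X : T -> R).
Hypothesis S : splitting P L X.

Definition scale_at (m : nat) : R := Num.sqrt (2^-1 ^+ m).

Lemma scale_at_sqr m : scale_at m ^+ 2 = 2^-1 ^+ m.
Proof. by rewrite sqr_sqrtr// exprn_ge0// invr_ge0. Qed.

Definition inc m i w : R := scale_at m * eta L X m i w.

Lemma inc_consistent w : consistent (fun m i => inc m i w).
Proof.
move=> m i; rewrite /inc (eta_split S) -mulrDr mulrCA mulrC; congr (_ * _).
rewrite /scale_at exprS sqrtrM ?invr_ge0// sqrtrV//.
by rewrite mulrC.
Qed.

Lemma measurable_inc m i : measurable_fun setT (inc m i).
Proof. by apply: measurable_funM => //; exact: (measurable_eta S). Qed.

Definition overshoot m i : set T := [set w | rho ^+ m < `|inc m i w|].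

Lemma measurable_overshoot m i : measurable (overshoot m i).
Proof.
by apply: measurable_gt; apply: measurableT_comp => //; exact: measurable_inc.
Qed.

(** This is (1/4) / rho^4: the fourth moment of an increment of level m scales as 4^-m. *)
Let ratio : R := 1024 / 2401.

Lemma overshoot_prob m i : (P (overshoot m i) <= (128 * ratio ^+ m)%:E)%E.
Proof.
have E : overshoot m i = eta L X m i @^-1` [set x : measurableTypeR R | (rho ^+ m < `|scale_at m * x|)%R].
  by [].
have [_ /(_ (fun j => if j == i then [set x | rho ^+ m < `|scale_at m * x|] else setT) i.+1)] := eta_iid S m.
have mA : measurable [set x : R | rho ^+ m < `|scale_at m * x|].
  by apply: measurable_gt; apply: measurableT_comp => //; exact: measurable_scale.
move=> /(_ _)/wrap[]; first by move=> j; case: ifP.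
rewrite [X in P X](_ : _ = overshoot m i); last first.
  apply/seteqP; split=> w /=; first by move/(_ i (ltnSn i)); rewrite eqxx.
  by move=> ow j _; case: eqP => // ->.
rewrite big_ord_recr/= eqxx big1 ?mul1e; last first.
  move=> j _; rewrite ltn_eqF//; exact: probability_setT.
move=> ->; apply: le_trans (gaussian_tail _ _) _; first by rewrite exprn_gt0// rho_gt0.
rewrite lee_fin le_eqVlt; apply/orP; left; apply/eqP.
rewrite -mulrA; congr (_ * _).
rewrite (_ : scale_at m ^+ 4 = (scale_at m ^+ 2) ^+ 2); last by rewrite -exprM.
rewrite scale_at_sqr -!exprM mulnC [(m * 4)%N]mulnC !exprM -expr_div_n; congr (_ ^+ _).
by rewrite /rho /ratio; field.
Qed.

(** The horizon grows with the level: m 2^m increments cover [0, m], so that one use of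
    Borel-Cantelli controls every bounded time interval. *)
Definition bad m : set T := \bigcup_(i in `I_(m * 2 ^ m)) overshoot m i.

Lemma measurable_bad m : measurable (bad m).
Proof. by apply: bigcup_measurable => i _; exact: measurable_overshoot. Qed.

Let grow m (z : R) : 1 <= z -> m%:R <= 8 * z -> m.+1%:R <= 8 * (9 / 8 * z).
Proof. by move=> z1; rewrite -[m.+1%:R]natr1; move: (m%:R : R) => n; lra. Qed.

(** The union bound gives m 2^m ratio^m up to a constant, and the factor m is absorbed by m <= 8
    (9/8)^m. The resulting quotient 2 (9/8) (1024/2401) = 2304/2401 is below 1. *)
Let bad_prob m : (P (bad m) <= (1024 * (2304 / 2401) ^+ m)%:E)%E.
Proof.
rewrite /bad bigcup_mkord.
apply: le_trans (Boole_inequality _ _) _; first by move=> i _; exact: measurable_overshoot.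
apply: (@le_trans _ _ (\sum_(i < m * 2 ^ m) (128 * ratio ^+ m)%:E)%E).
  by apply: lee_sum => i _; exact: overshoot_prob.
rewrite sumEFin lee_fin sumr_const card_ord -[_ *+ _]mulr_natr natrM natrX.
have mle : m%:R <= 8 * (9 / 8) ^+ m :> R.
  elim: m => [|m IH]; first by rewrite expr0 mulr1.
  rewrite exprS.
  have z1 : 1 <= (9 / 8 : R) ^+ m by apply: exprn_ege1; lra.
  exact: grow.
have -> : 1024 * (2304 / 2401) ^+ m = 128 * ratio ^+ m * (8 * (9 / 8) ^+ m * 2 ^+ m) :> R.
  have -> : 2304 / 2401 = ratio * (9 / 8) * 2 :> R by rewrite /ratio; field.
  by rewrite !exprMn; ring.
apply: ler_wpM2l; first by rewrite mulr_ge0// exprn_ge0// /ratio; lra.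
by apply: ler_wpM2r => //; rewrite exprn_ge0.
Qed.

Definition good : set T := ~` lim_sup_set bad.

Lemma measurable_good : measurable good.
Proof.
apply: measurableC; apply: bigcapT_measurable => n.
by apply: bigcup_measurable => j _; exact: measurable_bad.
Qed.

Lemma good_full : P (~` good) = 0%E.
Proof.
rewrite setCK; apply: lim_sup_set_cvg0; first exact: measurable_bad.
apply: (@le_lt_trans _ _ (1024 / (1 - 2304 / 2401))%:E); last by rewrite ltry.
apply: lime_le; first by apply: is_cvg_nneseries.
apply: nearW => n.
apply: (@le_trans _ _ (\sum_(0 <= k < n) (1024 * (2304 / 2401) ^+ k)%:E)%E).
  by apply: lee_sum => i _; exact: bad_prob.
rewrite sumEFin lee_fin -mulr_sumr.
have x0 : 0 <= 2304 / 2401 :> R by lra.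
have x1 : 0 < 1 - 2304 / 2401 :> R by lra.
move: (2304 / 2401 : R) x0 x1 (ler0n R 1024) => x x0 x1; move: (1024%:R) => c c0.
apply: ler_wpM2l; first exact: c0.
have E : (\sum_(0 <= i < n) x ^+ i) * (1 - x) = 1 - x ^+ n.
  elim: n => [|n IH]; first by rewrite big_geq// expr0; ring.
  by rewrite big_nat_recr//= mulrDl IH exprS; ring.
rewrite -[leRHS]mul1r ler_pdivlMr// E.
by rewrite lerBlDr lerDl exprn_ge0.
Qed.

Lemma term_le_sum (n k : nat) (f : nat -> R) : (forall i, 0 <= f i) -> (k < n)%N ->
  f k <= \sum_(0 <= i < n) f i.
Proof.
move=> f0 kn; rewrite big_mkord (bigD1 (Ordinal kn))//= lerDl.
by apply: sumr_ge0.
Qed.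

(** Beyond some level, depending on the path, all increments over [0, M] are at most rho^m; the
    finitely many earlier ones are put into the constant as a sum of their quotients by rho^m. *)
Lemma good_controlled w M : good w ->
  exists2 C, 0 <= C & controlled (fun m i => inc m i w) M C.
Proof.
move=> gw.
have [m0 H] : exists m0, forall m i, (m0 <= m)%N -> (i < m * 2 ^ m)%N -> `|inc m i w| <= rho ^+ m.
  apply: contrapT => no; apply: gw => n _.
  apply: contrapT => no'; apply: no; exists n => m i nm im.
  rewrite leNgt; apply/negP => o; apply: no'; exists m => //.
  by exists i.
pose N := maxn m0 M.
have qp m : 0 < rho ^+ m :> R by rewrite exprn_gt0// rho_gt0.
exists (1 + \sum_(0 <= m < N) \sum_(0 <= i < M * 2 ^ m) `|inc m i w| / rho ^+ m).
  by rewrite addr_ge0// sumr_ge0// => m _; rewrite sumr_ge0// => i _; rewrite divr_ge0// ltW.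
move=> m i iM.
have [Nm|mN] := leqP N m.
  apply: le_trans (H m i _ _) _.
  - exact: leq_trans (leq_maxl _ _) Nm.
  - by apply: leq_trans iM _; rewrite leq_mul2r (leq_trans (leq_maxr _ _) Nm) orbT.
  rewrite -[leLHS]mul1r; apply: ler_wpM2r; first exact: ltW.
  rewrite lerDl sumr_ge0// => k _.
  by rewrite sumr_ge0// => j _; rewrite divr_ge0// ltW.
rewrite -ler_pdivrMr//.
have t0 k j : 0 <= `|inc k j w| / rho ^+ k by rewrite divr_ge0// ltW.
apply: (@le_trans _ _ (\sum_(0 <= j < M * 2 ^ m) `|inc m j w| / rho ^+ m)).
  exact: (@term_le_sum _ i (fun j => `|inc m j w| / rho ^+ m)).
apply: (@le_trans _ _ (\sum_(0 <= k < N) \sum_(0 <= j < M * 2 ^ k) `|inc k j w| / rho ^+ k)).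
  apply: (@term_le_sum _ m (fun k => \sum_(0 <= j < M * 2 ^ k) `|inc k j w| / rho ^+ k)) => // k.
  by apply: sumr_ge0 => j _.
by rewrite lerDr.
Qed.

(* Setting the increments to 0 off the full event [good] makes every path continuous. *)
Definition ginc m i w : R := \1_good w * inc m i w.

Lemma ginc_consistent w : consistent (fun m i => ginc m i w).
Proof. by move=> m i; rewrite /ginc (inc_consistent w m i) mulrDr. Qed.

Lemma ginc_good w : good w -> (fun m i => ginc m i w) = (fun m i => inc m i w).
Proof. by move=> gw; apply/funext => m; apply/funext => i; rewrite /ginc indicE mem_set// mul1r. Qed.

Lemma ginc_controlled w M : exists2 C, 0 <= C & controlled (fun m i => ginc m i w) M C.
Proof.
have [gw|ngw] := pselect (good w).
  by rewrite ginc_good//; exact: good_controlled.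
exists 0 => // m i _; rewrite /ginc indicE memNset// mul0r normr0 mul0r//.
Qed.

Lemma measurable_ginc m i : measurable_fun setT (ginc m i).
Proof.
apply: measurable_funM; last exact: measurable_inc.
by apply: measurable_indic; exact: measurable_good.
Qed.

Definition bm (t : R) (w : T) : R := path_lim (fun m i => ginc m i w) t.

Lemma nat_above (t : R) : exists M : nat, t <= M%:R.
Proof. by exists (Num.truncn t).+1; rewrite ltW// truncnS_gt. Qed.

Lemma bm_cvg (t : R) w : 0 <= t -> psum (fun m i => ginc m i w) m t @[m --> \oo] --> bm t w.
Proof.
move=> t0; have [M tM] := nat_above t.
have [C C0 CC] := ginc_controlled w M.
by have [] := path_lim_approx 0 (ginc_consistent w) CC t0 tM C0.
Qed.

Lemma measurable_bm t : 0 <= t -> measurable_fun setT (bm t).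
Proof.
move=> t0; apply: (measurable_fun_cvg (h := fun m w => psum (fun m i => ginc m i w) m t)).
  by move=> m; apply: measurable_sum => i; exact: measurable_ginc.
by move=> w _; exact: bm_cvg.
Qed.

Lemma bm0 w : bm 0 w = 0.
Proof.
have := @bm_cvg 0 w (lexx _); rewrite /psum /ticks.
under eq_fun do rewrite mulr0 truncn0 big_geq//.
by move=> /(cvg_unique (@Rhausdorff R))/(_ (cvg_cst 0)).
Qed.

Lemma bm_modulus w (M : nat) : exists2 C, 0 <= C &
  forall m s t, 0 <= s <= M%:R -> 0 <= t <= M%:R -> `|t - s| <= 2^-1 ^+ m ->
    `|bm t w - bm s w| <= C * rho ^+ m.
Proof.
have [C C0 CC] := ginc_controlled w M.
exists (17 * C); first by rewrite mulr_ge0.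
move=> m s t /andP[s0 sM] /andP[t0 tM].
exact: (path_lim_modulus (ginc_consistent w) CC).
Qed.

Lemma bm_continuous w : {within `[0, +oo[, continuous (bm ^~ w)}.
Proof. exact: path_lim_continuous (ginc_consistent w) (ginc_controlled w). Qed.

(** The limiting law is realised on the same space by fixed independent normal variables with
    converging coefficients, so that [law_lim] compares two convergent sequences of vectors. *)
Lemma gauss_law_lim n (Y_ : nat -> nat -> T -> R) Y (s_ : nat -> nat -> R) s :
  (forall m i, measurable_fun setT (Y_ m i)) -> (forall i, measurable_fun setT (Y i)) ->
  (forall i, cvg_in_measure P setT (Y_ ^~ i) (Y i : T -> R)) ->
  (forall i, s_ m i @[m --> \oo] --> s i) ->
  (forall m A, (forall i, measurable (A i)) ->
    P [set w | forall i, (i < n)%N -> A i (Y_ m i w)] =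
    (\prod_(i < n) gauss_law (s_ m i) (A i))%E) ->
  forall A, (forall i, measurable (A i)) ->
    P [set w | forall i, (i < n)%N -> A i (Y i w)] = (\prod_(i < n) gauss_law (s i) (A i))%E.
Proof.
move=> mY_ mY cY cs YA A mA.
have mZ c i : measurable_fun setT (fun w => c * eta L X 0 i w).
  by apply: measurable_funM => //; exact: (measurable_eta S).
have lawZ (c : nat -> R) B : (forall i, measurable (B i)) ->
    P [set w | forall i, (i < n)%N -> B i (c i * eta L X 0 i w)] =
    (\prod_(i < n) gauss_law (c i) (B i))%E.
  move=> mB; have [_ H] := eta_iid S 0.
  apply: (etrans (H (fun i => (fun r => c i * r) @^-1` B i) n _)).
    by move=> i; apply: (measurable_preimage (measurable_scale _)).
  by [].
rewrite -lawZ//; apply: (law_lim (Y_ := Y_) (Z_ := fun m i w => s_ m i * eta L X 0 i w)) => //.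
  move=> i; apply: (ae_cvg_in_measure (G := setT)) => //.
    by rewrite setCT measure0.
  by move=> w _; apply: cvgM => //; exact: cvg_cst.
by move=> m B mB; rewrite YA// lawZ.
Qed.

Lemma ticks_cvg (t : R) : 0 <= t -> (ticks m t)%:R * 2^-1 ^+ m @[m --> \oo] --> t.
Proof.
move=> t0; apply/cvgrPdist_le => e e0.
have c0 : (2^-1 : R) ^+ m @[m --> \oo] --> (0 : R) by exact: half_pow_cvg0.
have /cvgr_lt/(_ _ e0) := c0; apply: filterS => m me.
have /andP[l u] := ticks_itv m t0.
have h0 : 0 < (2^-1 : R) ^+ m by rewrite exprn_gt0// invr_gt0.
have e1 : 2 ^+ m * t * 2^-1 ^+ m = t by rewrite mulrAC -exprMn mulfV// expr1n mul1r.
have l' := ler_wpM2r (ltW h0) l; have u' := ler_wpM2r (ltW h0) (ltW u).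
rewrite e1 in l' u'; rewrite -natr1 mulrDl mul1r in u'.
by rewrite ger0_norm ?subr_ge0//; lra.
Qed.

(** At level m the increments become blocks of scaled independent normal variables between the ticks
    of the times; the variances converge because the ticks times 2^-m do. *)
Lemma bm_law (t : nat -> R) n (A : nat -> set R) :
  0 <= t 0%N -> {homo t : i j / (i <= j)%N >-> i <= j} -> (forall i, measurable (A i)) ->
  P [set w | forall i, (i < n)%N -> A i (bm (t i.+1) w - bm (t i) w)] =
  (\prod_(i < n) gauss_law (Num.sqrt (t i.+1 - t i)) (A i))%E.
Proof.
move=> t0 th mA.
have tp i : 0 <= t i by apply: le_trans t0 (th _ _ _).
pose Y_ m i w := block (eta L X m) (fun=> scale_at m) (ticks m (t i)) (ticks m (t i.+1)) w.
have mY_ m i : measurable_fun setT (Y_ m i).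
  exact: (measurable_block (eta_iid S m)).
have Y_E m i w : Y_ m i w = psum (fun m i => inc m i w) m (t i.+1) - psum (fun m i => inc m i w) m (t i).
  rewrite /psum (big_cat_nat (n := ticks m (t i)))//=; last by rewrite ticks_mono// th.
  by rewrite [X in X - _]addrC addrK.
pose s_ m i : R := block_sd (fun=> scale_at m) (ticks m (t i)) (ticks m (t i.+1)).
apply: (gauss_law_lim (Y_ := Y_) (s_ := s_) (Y := fun i w => bm (t i.+1) w - bm (t i) w)
   (s := fun i => Num.sqrt (t i.+1 - t i))) => //.
- by move=> i; apply: measurable_funB; exact: measurable_bm.
- move=> i; apply: (ae_cvg_in_measure (G := good)) => //.
  + by apply: measurable_funB; exact: measurable_bm.
  + exact: measurable_good.
  + exact: good_full.
  move=> w gw; under eq_fun do rewrite Y_E -(ginc_good gw).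
  by apply: cvgB; exact: bm_cvg.
- move=> i; apply: continuous_cvg; first exact: sqrt_continuous.
  rewrite (_ : (fun m => _) = (fun m => (ticks m (t i.+1))%:R * 2^-1 ^+ m - (ticks m (t i))%:R * 2^-1 ^+ m)).
    by apply: cvgB; exact: ticks_cvg.
  apply/funext => m; rewrite (eq_bigr _ (fun _ _ => scale_at_sqr m)) sumr_const_nat.
  by rewrite mulrnBr ?mulr_natl// ticks_mono// th.
- move=> m B mB; apply: (blocks_law (eta_iid S m) (fun=> scale_at m) (k := fun i => ticks m (t i)) n) => //.
  by move=> i j ij; rewrite ticks_mono// th.
Qed.

End brownian.

(** * Dyadic averages of square-integrable functions *)

Section dyadic.
Context {R : realType}.
Implicit Types (f g : R -> R) (m j : nat) (x c : R).
Local Notation mu := (@lebesgue_measure R).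

Definition square_integrable g : Prop :=
  [/\ measurable_fun setT g, (\int[mu]_x (g x ^+ 2)%:E < +oo)%E &
      forall x, ~~ (0 < x < 1) -> g x = 0].

Definition cell m j : set R := `[j%:R * 2^-1 ^+ m, j.+1%:R * 2^-1 ^+ m[%classic.

Definition coef m j g : R := 2 ^+ m * \int[mu]_(x in cell m j) g x.

(** The squared L^2 norm of the conditional expectation of g given the dyadic cells of level m; it
    is also the variance of the discrete Wiener integral of that level. *)
Definition sqnorm m g : R := 2^-1 ^+ m * \sum_(0 <= j < 2 ^ m) coef m j g ^+ 2.

Lemma half_gt0 m : 0 < (2^-1 : R) ^+ m.
Proof. by rewrite exprn_gt0// invr_gt0. Qed.

Lemma half_mul m : (2 : R) ^+ m * 2^-1 ^+ m = 1.
Proof. by rewrite -exprMn mulfV// expr1n. Qed.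

Local Notation Rm := (g_sigma_algebraType (R.-ocitv.-measurable)).

Lemma measurable_cell m j : measurable (cell m j : set Rm).
Proof. exact: measurable_itv. Qed.
Hint Resolve measurable_cell : core.

Lemma cell_measure m j : mu (cell m j) = (2^-1 ^+ m)%:E.
Proof.
rewrite lebesgue_measure_itv/= lte_fin -[j.+1%:R]natr1 mulrDl mul1r ltrDl half_gt0.
by rewrite -EFinB addrC addKr.
Qed.

Lemma mem_cell m j x : 0 <= x -> cell m j x <-> ticks m x = j.
Proof.
move=> x0; have /andP[l u] := ticks_itv m x0.
have h0 := half_gt0 m; have e1 : 2 ^+ m * x * 2^-1 ^+ m = x by rewrite mulrAC half_mul mul1r.
have E k : (k%:R * 2^-1 ^+ m <= x) = (k%:R <= 2 ^+ m * x).
  by rewrite -[in LHS]e1 ler_pM2r.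
have E' k : (x < k%:R * 2^-1 ^+ m) = (2 ^+ m * x < k%:R).
  by rewrite -[in LHS]e1 ltr_pM2r.
rewrite /cell/= in_itv/= E E'; split=> [/andP[l' u']|<-]; last by rewrite l u.
apply/eqP; rewrite eqn_leq -ltnS -[X in _ && X]ltnS -!(ltr_nat R).
by rewrite (le_lt_trans l u') (le_lt_trans l' u).
Qed.

Lemma cell_split m j : cell m j = cell m.+1 j.*2 `|` cell m.+1 j.*2.+1.
Proof.
have E (k : nat) : k.*2%:R * 2^-1 ^+ m.+1 = k%:R * 2^-1 ^+ m :> R.
  by rewrite -muln2 natrM exprS; field.
apply/seteqP; split=> x; rewrite /cell/= !in_itv/= -!doubleS !E.
  move=> /andP[h1 h2]; rewrite h1 h2 andbT /=.
  by case: (ltP x (j.*2.+1%:R * 2^-1 ^+ m.+1)) => _; [left|right].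
have l0 : j%:R * 2^-1 ^+ m <= j.*2.+1%:R * 2^-1 ^+ m.+1 :> R.
  by rewrite -E ler_pM2r ?half_gt0// ler_nat.
have l1 : j.*2.+1%:R * 2^-1 ^+ m.+1 <= j.+1%:R * 2^-1 ^+ m :> R.
  by rewrite -E ler_pM2r ?half_gt0// ler_nat doubleS.
by case=> /andP[h1 h2]; [rewrite h1 (lt_le_trans h2 l1)|rewrite h2 (le_trans l0 h1)].
Qed.

Lemma cst_integrable (D : set Rm) (k : R) : measurable D -> (mu D < +oo)%E -> mu.-integrable D (fun=> k%:E).
Proof.
move=> mD fD; apply: (@measurable_bounded_integrable _ _ _ mu (cst k) D) => //.
exists `|k|; split; first exact: num_real.
by move=> x kx y _; apply: ltW.
Qed.

Section square_integrable.
Variable g : R -> R.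
Hypothesis sg : square_integrable g.

Lemma sqi_measurable : measurable_fun setT g. Proof. by case: sg. Qed.

Lemma sqi_sq : mu.-integrable setT (EFin \o (fun x => g x ^+ 2)).
Proof.
apply/integrableP; split.
  by apply/measurable_EFinP; apply: measurable_funX; exact: sqi_measurable.
case: sg => _ + _; congr (_ < _)%E.
by apply: eq_integral => x _ /=; rewrite ger0_norm ?sqr_ge0.
Qed.

Lemma sqi_integrable : mu.-integrable setT (EFin \o g).
Proof.
pose D : set R := `]0, 1[%classic.
have mD : measurable (D : set Rm) by exact: measurable_itv.
have -> : EFin \o g = (EFin \o g) \_ D.
  apply/funext => x; rewrite patchE; case: ifPn => //.
  rewrite notin_setE /D/= in_itv/= => /negP nx.
  by case: sg => _ _ ->.
apply: (iffLR (@integrable_mkcond _ _ _ mu D (EFin \o g) mD)).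
have fD : (mu D < +oo)%E by rewrite lebesgue_measure_itv/= lte_fin ltr01 -EFinB ltry.
apply: (@le_integrable _ _ _ mu D mD _ (fun x => 1%:E + (g x ^+ 2)%:E)%E).
- by apply: measurable_funTS; apply/measurable_EFinP; exact: sqi_measurable.
- move=> x _; have -> : (1%:E + (g x ^+ 2)%:E = (1 + g x ^+ 2)%:E)%E by [].
  rewrite !abse_EFin lee_fin [leRHS]ger0_norm ?addr_ge0 ?sqr_ge0//.
  rewrite -(real_normK (num_real (g x))).
  move: `|g x| (normr_ge0 (g x)) => z z0.
  have : 0 <= (z - 1) ^+ 2 by rewrite sqr_ge0.
  by rewrite !expr2; nra.
- apply: (integrableD mD); first exact: cst_integrable.
  exact: (integrableS measurableT mD (@subsetT _ _) sqi_sq).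
Qed.

Lemma sqi_integrableS (D : set Rm) : measurable D -> mu.-integrable D (EFin \o g).
Proof. by move=> mD; apply: (integrableS measurableT mD (@subsetT _ _) sqi_integrable). Qed.

Lemma sqi_sqS (D : set Rm) : measurable D -> mu.-integrable D (EFin \o (fun x => g x ^+ 2)).
Proof. by move=> mD; apply: (integrableS measurableT mD (@subsetT _ _) sqi_sq). Qed.

Lemma coef_split m j : coef m j g = (coef m.+1 j.*2 g + coef m.+1 j.*2.+1 g) / 2.
Proof.
rewrite /coef cell_split Rintegral_setU; first by rewrite exprS; field.
- exact: measurable_cell.
- exact: measurable_cell.
- by apply: sqi_integrableS; apply: measurableU; exact: measurable_cell.
- apply/disj_setPS => x []; rewrite /cell/= !in_itv/= => /andP[_ lt] /andP[le _].
  by move: lt; rewrite ltNge le.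
Qed.

(** Jensen's inequality on a cell, obtained by integrating 2 c g - c^2 <= g^2 with c the average. *)
Lemma sq_coef_le m j : 2^-1 ^+ m * coef m j g ^+ 2 <= \int[mu]_(x in cell m j) (g x ^+ 2).
Proof.
set c := coef m j g.
have EI : \int[mu]_(x in cell m j) g x = 2^-1 ^+ m * c by rewrite /c mulrA [_ * 2 ^+ m]mulrC half_mul mul1r.
have mC := measurable_cell m j; have muc : (mu (cell m j) < +oo)%E by rewrite cell_measure ltry.
have ic (k : R) : mu.-integrable (cell m j) (EFin \o (cst k : R -> R)).
  exact: (cst_integrable _ (measurable_cell _ _)).
have -> : 2^-1 ^+ m * c ^+ 2 = \int[mu]_(x in cell m j) (2 * c * g x - c ^+ 2).
  rewrite RintegralB//=; last 2 first.
  - exact: (@integrableZl _ _ _ mu _ mC (2 * c) (EFin \o g) (sqi_integrableS mC)).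
  - exact: ic.
  rewrite (RintegralZl _ mC); last exact: sqi_integrableS.
  have EM : fine (mu (cell m j)) = 2^-1 ^+ m by rewrite cell_measure.
  by rewrite EI (Rintegral_cst _ mC) [fine _]EM; ring.
apply: (le_Rintegral mC).
- apply: (@integrableB _ _ _ mu _ mC (fun x => (2 * c * g x)%:E) (fun=> (c ^+ 2)%:E)).
  + exact: (@integrableZl _ _ _ mu _ mC (2 * c) (EFin \o g) (sqi_integrableS mC)).
  + exact: ic.
- exact: sqi_sqS.
move=> x _; rewrite -subr_ge0.
have -> : g x ^+ 2 - (2 * c * g x - c ^+ 2) = (g x - c) ^+ 2 by ring.
exact: sqr_ge0.
Qed.

End square_integrable.

Lemma coef_linear m j c f g : square_integrable f -> square_integrable g ->
  coef m j (fun x => c * f x + g x) = c * coef m j f + coef m j g.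
Proof.
have mC := measurable_cell m j; move=> sf sg.
have iC k : square_integrable k -> mu.-integrable (cell m j) (EFin \o k).
  by move=> sk; exact: sqi_integrableS.
rewrite /coef (RintegralD mC); last 2 first.
- exact: (integrableZl mC c (iC _ sf)).
- exact: iC.
by rewrite (RintegralZl _ mC (iC _ sf)); ring.
Qed.

(** Pythagoras for the martingale of dyadic averages: j %/ 2^k is the ancestor of cell j, each
    average is the mean of those of its two children, and increments of successive levels are
    orthogonal. *)
Lemma coef_diff_sq m k g : square_integrable g ->
  2^-1 ^+ (m + k) * \sum_(0 <= j < 2 ^ (m + k)) (coef (m + k) j g - coef m (j %/ 2 ^ k) g) ^+ 2 =
  sqnorm (m + k) g - sqnorm m g.
Proof.
move=> sg; elim: k => [|k IH].
  rewrite addn0 subrr big1 ?mulr0// => j _.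
  by rewrite divn1 subrr expr0n.
have E (F : nat -> R) : \sum_(0 <= j < 2 ^ (m + k).+1) F j = \sum_(0 <= j < 2 ^ (m + k)) (F j.*2 + F j.*2.+1).
  by rewrite expnS mul2n sum_double.
have S0 : sqnorm (m + k.+1) g - sqnorm m g = (sqnorm (m + k.+1) g - sqnorm (m + k) g) + (sqnorm (m + k) g - sqnorm m g) by ring.
rewrite S0 -IH addnS {S0 IH} /sqnorm !E exprS.
rewrite -addrA -mulrN -mulrDr.
rewrite [2^-1 * _]mulrC -!mulrA -mulrDr; congr (_ * _).
rewrite -sumrN -big_split/= !mulr_sumr -big_split/=; apply: eq_bigr => j _.
have -> : (j.*2 %/ 2 ^ k.+1 = j %/ 2 ^ k)%N by rewrite expnS divnMA -muln2 mulnK.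
have -> : (j.*2.+1 %/ 2 ^ k.+1 = j %/ 2 ^ k)%N by rewrite expnS divnMA -addn1 -muln2 divnMDl// addn0.
by rewrite (coef_split sg (m + k)); field.
Qed.

Lemma sqnorm_mono m k g : square_integrable g -> sqnorm m g <= sqnorm (m + k) g.
Proof.
move=> sg; rewrite -subr_ge0 -coef_diff_sq// mulr_ge0 ?(ltW (half_gt0 _))//.
by rewrite sumr_ge0// => j _; rewrite sqr_ge0.
Qed.

Definition sqint g : R := \int[mu]_x (g x ^+ 2).

Lemma sqintE g : square_integrable g -> (\int[mu]_x (g x ^+ 2)%:E = (sqint g)%:E)%E.
Proof.
by move=> sg; rewrite /sqint /Rintegral fineK//; apply: integrable_fin_num => //; exact: sqi_sq.
Qed.

Lemma cell_disjoint m i j x : cell m i x -> cell m j x -> i = j.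
Proof.
move=> xi xj; have x0 : 0 <= x.
  by move: xi; rewrite /cell/= in_itv/= => /andP[+ _]; apply: le_trans; rewrite mulr_ge0// ltW// half_gt0.
by move/(mem_cell _ _ x0): xi <-; apply/mem_cell.
Qed.

Lemma bessel m g : square_integrable g -> sqnorm m g <= sqint g.
Proof.
move=> sg; rewrite -lee_fin -sqintE// /sqnorm mulr_sumr -sumEFin.
have mg2 : measurable_fun setT (fun x => (g x ^+ 2)%:E).
  by apply/measurable_EFinP; apply: measurable_funX; exact: sqi_measurable.
apply: (@le_trans _ _ (\sum_(0 <= j < 2 ^ m) \int[mu]_(x in cell m j) (g x ^+ 2)%:E)%E).
  apply: lee_sum => j _; have mC := measurable_cell m j.
  have <- : (fine (\int[mu]_(x in cell m j) (g x ^+ 2)%:E)%E)%:E = (\int[mu]_(x in cell m j) (g x ^+ 2)%:E)%E.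
    by rewrite fineK//; exact: (integrable_fin_num mC (sqi_sqS sg mC)).
  by rewrite lee_fin; exact: sq_coef_le.
rewrite -(@ge0_integral_bigsetU _ _ _ mu nat (cell m) (fun x => (g x ^+ 2)%:E) (index_iota 0 (2 ^ m))).
- apply: ge0_subset_integral => //.
  + by apply: bigsetU_measurable => j _; exact: measurable_cell.
  + by move=> x _; rewrite lee_fin sqr_ge0.
- by move=> j; exact: measurable_cell.
- exact: iota_uniq.
- apply/trivIsetP => i j _ _ ij; apply/seteqP; split=> x //= [xi xj].
  by move/eqP: ij; apply; exact: cell_disjoint xi xj.
- exact: measurable_funTS.
- by move=> x _; rewrite lee_fin sqr_ge0.
Qed.

Definition avgsq m g x : R := \sum_(j < 2 ^ m) coef m j g ^+ 2 * \1_(cell m j) x.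

Lemma avgsq_integral m g : (\int[mu]_x (avgsq m g x)%:E = (sqnorm m g)%:E)%E.
Proof.
under eq_integral do rewrite /avgsq -sumEFin.
have mi (j : 'I_(2 ^ m)) : measurable_fun setT (fun x => (coef m j g ^+ 2 * \1_(cell m j) x)%:E).
  apply/measurable_EFinP; apply: measurable_funM => //.
  by apply: measurable_indic; exact: measurable_cell.
rewrite ge0_integral_sum//; last first.
  by move=> j x _; rewrite lee_fin mulr_ge0 ?sqr_ge0.
rewrite /sqnorm mulr_sumr big_mkord -sumEFin; apply: eq_bigr => j _.
under eq_integral do rewrite EFinM.
rewrite ge0_integralZl//.
- have -> : (\int[mu]_x (\1_(cell m j) x)%:E = (2^-1 ^+ m)%:E)%E.
    apply: etrans (integral_indic _ _ (measurable_cell m j)) _ => //.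
    by rewrite setIT; exact: cell_measure.
  by rewrite -EFinM mulrC.
- by apply/measurable_EFinP; apply: measurable_indic; exact: measurable_cell.
- by rewrite lee_fin sqr_ge0.
Qed.

(** The left end of the cell of x. For negative x the value x itself keeps x in an interval of
    length 2^-m, because the differentiation theorem asks for a shrinking family at every point. *)
Definition corner m x : R := if 0 <= x then (ticks m x)%:R * 2^-1 ^+ m else x.

Lemma cornerP m x : corner m x <= x < corner m x + 2^-1 ^+ m.
Proof.
rewrite /corner; case: ifPn => [x0|_]; last by rewrite lexx ltrDl half_gt0.
have /(mem_cell m _ x0) : ticks m x = ticks m x by [].
by rewrite /cell/= in_itv/= -[(ticks m x).+1%:R]natr1 mulrDl mul1r.
Qed.

Lemma corner_nicely_shrinking x :
  nicely_shrinking x (fun m => `[corner m x, corner m x + 2^-1 ^+ m[%classic).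
Proof.
split; first by move=> m; exact: measurable_itv.
exists (2, fun m => PosNum (half_gt0 m)); split=> //=.
- exact: half_pow_cvg0.
- move=> m y /=; have /andP[c1 c2] := cornerP m x; rewrite in_itv/= => /andP[y1 y2].
  by rewrite /ball/= ltr_norml; apply/andP; split; lra.
- move=> m; rewrite lebesgue_measure_ball ?(ltW (half_gt0 _))//.
  rewrite lebesgue_measure_itv/= lte_fin ltrDl half_gt0 -EFinB -EFinM lee_fin mulr_natl.
  by rewrite [X in X *+ 2](_ : _ = 2^-1 ^+ m)// addrC addKr.
Qed.

Lemma avgsq_cvg g x : square_integrable g -> 0 < x < 1 -> lebesgue_pt g x ->
  avgsq m g x @[m --> \oo] --> g x ^+ 2.
Proof.
move=> sg /andP[x0 x1] gx.
have lg : locally_integrable setT g by apply: open_integrable_locally; [exact: openT|exact: sqi_integrable].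
have := nice_lebesgue_differentiation corner_nicely_shrinking lg gx.
have E m : ((lebesgue_measure `[corner m x, (corner m x + 2^-1 ^+ m)%R[%classic)^-1 *
   (\int[lebesgue_measure]_(y in `[corner m x, (corner m x + 2^-1 ^+ m)%R[%classic) (g y)%:E) = (coef m (ticks m x) g)%:E)%E.
  have -> : `[corner m x, corner m x + 2^-1 ^+ m[%classic = cell m (ticks m x).
    by rewrite /corner (ltW x0) /cell -[(ticks m x).+1%:R]natr1 mulrDl mul1r.
  have mC := measurable_cell m (ticks m x).
  rewrite cell_measure inver gt_eqF ?half_gt0// -exprVn invrK.
  rewrite /coef /Rintegral EFinM fineK//.
  exact: (integrable_fin_num mC (sqi_integrableS sg mC)).
under eq_fun do rewrite E.
move=> /fine_cvgP[_] /= cg.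
have -> : (fun m => avgsq m g x) = (fun m => coef m (ticks m x) g ^+ 2).
  apply/funext => m.
  have tm : (ticks m x < 2 ^ m)%N.
    have /andP[l _] := ticks_itv m (ltW x0).
    rewrite -(ltr_nat R) natrX; apply: le_lt_trans l _.
    by rewrite -[ltRHS]mulr1 ltr_pM2l// exprn_gt0.
  rewrite /avgsq (bigD1 (Ordinal tm))//= big1 ?addr0.
    by rewrite indicE mem_set ?mulr1//; apply/(mem_cell _ _ (ltW x0)).
  move=> j jt; rewrite indicE memNset ?mulr0// => /(mem_cell _ _ (ltW x0)) e.
  by move/eqP: jt; apply; apply/val_inj.
by rewrite expr2; under eq_fun do rewrite expr2; apply: cvgM.
Qed.

(** Bessel's inequality bounds the limit from above. Conversely the averages converge to g at
    Lebesgue points, hence almost everywhere, and Fatou's lemma applies to their squares. *)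
Lemma parseval g : square_integrable g -> sqnorm m g @[m --> \oo] --> sqint g.
Proof.
move=> sg.
have nd : nondecreasing_seq (sqnorm ^~ g).
  by move=> m n mn; rewrite -(subnKC mn); exact: sqnorm_mono.
have ub : has_ubound (range (sqnorm ^~ g)).
  by exists (sqint g) => _ [m _ <-]; exact: bessel.
have cu : sqnorm m g @[m --> \oo] --> limn (sqnorm ^~ g).
  by apply/cvg_ex; exists (sup (range (sqnorm ^~ g))); exact: nondecreasing_cvgn.
suff -> : sqint g = limn (sqnorm ^~ g) by [].
apply/eqP; rewrite eq_le; apply/andP; split; last first.
  by apply: limr_le; [apply/cvg_ex; eexists; exact: cu|apply: nearW => m; exact: bessel].
rewrite -lee_fin -sqintE//.
have mavg m : measurable_fun setT (fun x => (avgsq m g x)%:E).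
  apply/measurable_EFinP; apply: measurable_sum => j; apply: measurable_funM => //.
  by apply: measurable_indic; exact: measurable_cell.
have avg0 m x : (0 <= (avgsq m g x)%:E)%E.
  by rewrite lee_fin sumr_ge0// => j _; rewrite mulr_ge0 ?sqr_ge0.
have lg : locally_integrable setT g by apply: open_integrable_locally; [exact: openT|exact: sqi_integrable].
have mg2 : measurable_fun setT (fun x => (g x ^+ 2)%:E).
  by apply/measurable_EFinP; apply: measurable_funX; exact: sqi_measurable.
have [N [mN N0 subN]] := lebesgue_differentiation lg.
pose D : set Rm := `]0, 1[%classic `\` N.
have mD : measurable D by apply: measurableD => //; exact: measurable_itv.
have -> : (\int[mu]_x (g x ^+ 2)%:E = \int[mu]_(x in D) (g x ^+ 2)%:E)%E.
  rewrite [RHS]integral_mkcond; apply: ae_eq_integral => //.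
    by apply/(measurable_restrictT _ mD); exact: measurable_funTS.
  exists N; split=> // x /= nx; apply: contrapT => xN; apply: nx => _.
  rewrite patchE; case: ifPn => //; rewrite notin_setE /D/= in_itv/= => nD.
  case: sg => _ _ ->; first by rewrite expr0n.
  by apply/negP => x01; apply: nD.
have -> : (\int[mu]_(x in D) (g x ^+ 2)%:E = \int[mu]_(x in D) limn_einf (fun m => (avgsq m g x)%:E))%E.
  apply: eq_integral => x; rewrite inE /D/= in_itv/= => -[x01 xN].
  have gx : lebesgue_pt g x by apply: contrapT => nx; apply: xN; apply: subN.
  apply/esym; have cx := avgsq_cvg sg x01 gx.
  by apply: (cvg_limn_einf_sup _).1; apply: cvg_EFin; [exact: nearW|exact: cx].
apply: le_trans (fatou mu mD (fun m => measurable_funTS (mavg m)) (fun n x _ => avg0 n x)) _.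
rewrite limn_einf_lim; apply: lime_le; first exact: is_cvg_einfs.
apply: nearW => m; apply: (@le_trans _ _ (\int[mu]_(x in D) (avgsq m g x)%:E)%E).
  by apply: ereal_inf_lbound; exists m => /=.
apply: (@le_trans _ _ (sqnorm m g)%:E); last first.
  rewrite lee_fin; apply: nondecreasing_cvgn_le; [exact: nd|by apply/cvg_ex; eexists; exact: cu].
rewrite -avgsq_integral.
apply: ge0_subset_integral => //; first exact: mavg.
Qed.

End dyadic.

(** * The Wiener integral *)

Section convergence_in_measure.
Context d (T : measurableType d) (R : realType) (P : probability T R).
Implicit Types (X Y : T -> R).

Lemma cvg_measure_lin c (X_ Y_ : nat -> T -> R) X Y :
  (forall n, measurable_fun setT (X_ n)) -> (forall n, measurable_fun setT (Y_ n)) ->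
  measurable_fun setT X -> measurable_fun setT Y ->
  cvg_in_measure P setT X_ X -> cvg_in_measure P setT Y_ Y ->
  cvg_in_measure P setT (fun n w => c * X_ n w + Y_ n w : R) (fun w => c * X w + Y w : R).
Proof.
move=> mX_ mY_ mX mY XX YY e e0.
pose e1 : R := e / (2 * (`|c| + 1)); pose e2 : R := e / 2.
have c1 : 0 < `|c| + 1 by rewrite ltr_wpDl.
have e10 : 0 < e1 by rewrite divr_gt0// mulr_gt0.
have e20 : 0 < e2 by rewrite divr_gt0.
have cs : (P (far (X_ n) X e1) + P (far (Y_ n) Y e2))%E @[n --> \oo] --> 0%E.
  rewrite -[X in _ --> X]adde0; apply: cvgeD => //.
    by have := XX e1 e10; under eq_fun do rewrite setTI.
  by have := YY e2 e20; under eq_fun do rewrite setTI.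
apply: (squeeze_cvge _ (cvg_cst 0%E) cs); apply: nearW => n; rewrite measure_ge0/= setTI.
have mF := measurable_far e1 (mX_ n) mX; have mG := measurable_far e2 (mY_ n) mY.
apply: le_trans (measureU2 _ mF mG); apply: le_measure; rewrite ?inE.
- apply: (measurable_far e (U := fun w => c * X_ n w + Y_ n w) (V := fun w => c * X w + Y w)).
    by apply: measurable_funD => //; apply: measurable_funM.
  by apply: measurable_funD => //; apply: measurable_funM.
- exact: measurableU.
move=> w /= h; apply: contrapT => /not_orP[]; rewrite /far/= => /negP; rewrite -ltNge => h1 /negP; rewrite -ltNge => h2.
move: h; apply/negP; rewrite -ltNge.
have -> : c * X_ n w + Y_ n w - (c * X w + Y w) = c * (X_ n w - X w) + (Y_ n w - Y w) by ring.
apply: le_lt_trans (ler_normD _ _) _; rewrite normrM.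
have : `|c| * `|X_ n w - X w| <= (`|c| + 1) * e1.
  by apply: ler_pM => //; [lra|exact: ltW].
have -> : (`|c| + 1) * e1 = e / 2 by rewrite /e1; field; rewrite lt0r_neq0.
by move: h2; rewrite /e2; lra.
Qed.

Lemma cvg_measure_unique (X_ : nat -> T -> R) X Y :
  (forall n, measurable_fun setT (X_ n)) -> measurable_fun setT X -> measurable_fun setT Y ->
  cvg_in_measure P setT X_ X -> cvg_in_measure P setT X_ Y ->
  {ae P, forall w, X w = Y w}.
Proof.
move=> mX_ mX mY XX XY.
have far0 (e : R) : 0 < e -> P (far X Y e) = 0%E.
  move=> e0; have e20 : 0 < e / 2 by rewrite divr_gt0.
  have cs : (P (far (X_ n) X (e / 2)) + P (far (X_ n) Y (e / 2)))%E @[n --> \oo] --> 0%E.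
    rewrite -[X in _ --> X]adde0; apply: cvgeD => //.
      by have := XX _ e20; under eq_fun do rewrite setTI.
    by have := XY _ e20; under eq_fun do rewrite setTI.
  apply/eqP; rewrite eq_le measure_ge0 andbT -(cvg_lim _ cs)//.
  apply: lime_ge; first by apply: cvgP; exact: cs.
  apply: nearW => n.
  have mF := measurable_far (e / 2) (mX_ n) mX; have mG := measurable_far (e / 2) (mX_ n) mY.
  apply: le_trans (measureU2 _ mF mG); apply: le_measure; rewrite ?inE.
  - exact: measurable_far.
  - exact: measurableU.
  move=> w /= h; apply: contrapT => /not_orP[]; rewrite /far/= => /negP; rewrite -ltNge => h1 /negP; rewrite -ltNge => h2.
  move: h; apply/negP; rewrite -ltNge.
  have -> : X w - Y w = (X_ n w - Y w) - (X_ n w - X w) by ring.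
  by apply: le_lt_trans (ler_normB _ _) _; lra.
exists (\bigcup_k far X Y k.+1%:R^-1); split.
- by apply: bigcup_measurable => k _; exact: measurable_far.
- apply/eqP; rewrite eq_le measure_ge0 andbT.
  apply: le_trans (measure_sigma_subadditive _ _ _ _) _.
  + by move=> k; exact: (measurable_far k.+1%:R^-1 mX mY).
  + by apply: bigcup_measurable => k _; exact: measurable_far.
  + by [].
  by rewrite eseries0// => k _ _; apply: far0; rewrite invr_gt0.
move=> w /= /eqP nXY; have gt : 0 < `|X w - Y w| by rewrite normr_gt0 subr_eq0.
have [k _ Hk] := near_infty_natSinv_lt (PosNum gt).
by exists k => //; rewrite /far/=; apply/ltW/(Hk k) => /=.
Qed.

(** Completeness of convergence in probability: a fast subsequence converges almost everywhere by
    Borel-Cantelli, and the Cauchy condition carries the whole sequence along. *)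
Lemma measure_cauchy_limit (X_ : nat -> T -> R) : (forall n, measurable_fun setT (X_ n)) ->
  (forall e : R, 0 < e -> exists N, forall m n, (N <= m)%N -> (N <= n)%N ->
     (P (far (X_ m) (X_ n) e) <= e%:E)%E) ->
  exists2 X : T -> R, measurable_fun setT X & cvg_in_measure P setT X_ X.
Proof.
move=> mX_ C.
have h0 k : 0 < (2^-1 : R) ^+ k by exact: half_gt0.
have [N HN] := choice (fun k => C _ (h0 k)).
(* Cumulative sums make the subsequence increase and dominate both [N k] and k. *)
pose s k := (\sum_(0 <= i < k.+1) (N i).+1)%N.
have sS k : (s k <= s k.+1)%N by rewrite /s [X in (_ <= X)%N]big_nat_recr//= leq_addr.
have Ns k : (N k <= s k)%N 
  by rewrite /s big_nat_recr//=; apply: leq_trans (leqnSn _) (leq_addl _ _).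
have ks k : (k <= s k)%N.
  by elim: k => // k IH; rewrite /s big_nat_recr//= -/(s k) -addSnnS; apply: leq_trans (leq_addr _ _); rewrite ltnS.
pose F k := far (X_ (s k.+1)) (X_ (s k)) (2^-1 ^+ k).
have mF k : measurable (F k) by exact: measurable_far.
have PF k : (P (F k) <= (2^-1 ^+ k)%:E)%E.
  by apply: HN => //; exact: leq_trans (Ns k) (sS k).
pose G := ~` lim_sup_set F.
have mG : measurable G.
  apply: measurableC; apply: bigcapT_measurable => n.
  by apply: bigcup_measurable => j _; exact: mF.
have G0 : P (~` G) = 0%E.
  rewrite setCK; apply: lim_sup_set_cvg0; first exact: mF.
  apply: (@le_lt_trans _ _ 2%:E); last by rewrite ltry.
  apply: lime_le; first by apply: is_cvg_nneseries.
  apply: nearW => n.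
  apply: (@le_trans _ _ (\sum_(0 <= k < n) (2^-1 ^+ k)%:E)%E); first by apply: lee_sum => i _; exact: PF.
  rewrite sumEFin lee_fin.
  suff -> : \sum_(0 <= k < n) 2^-1 ^+ k = 2 - 2 * 2^-1 ^+ n :> R.
    by rewrite lerBlDr lerDl mulr_ge0// ltW.
  elim: n => [|n IH]; first by rewrite big_geq// expr0; ring.
  by rewrite big_nat_recr//= IH exprS; field.
(* Set to 0 off the full event [G], the subsequence converges at every point and its limit is
   measurable. *)
pose Z k w : R := \1_G w * X_ (s k) w.
have mZ k : measurable_fun setT (Z k).
  by apply: measurable_funM => //; exact: measurable_indic.
have cZ w : cvgn (Z ^~ w).
  have [Gw|nGw] := pselect (G w); last first.
    rewrite (_ : Z ^~ w = fun=> 0); first exact: is_cvg_cst.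
    by apply/funext => k; rewrite /Z indicE memNset// mul0r.
  have [n0 H] : exists n0, forall k, (n0 <= k)%N -> `|X_ (s k.+1) w - X_ (s k) w| <= 2^-1 ^+ k.
    apply: contrapT => no; apply: Gw => n _.
    apply: contrapT => no'; apply: no; exists n => k nk.
    rewrite leNgt; apply/negP => o; apply: no'; exists k => //.
    by rewrite /F/far/= ltW.
  pose C0 : R := 1 + \sum_(0 <= k < n0) `|X_ (s k.+1) w - X_ (s k) w| / 2^-1 ^+ k.
  have [| | k|//] := @geometric_cauchy R R^o (Z ^~ w) C0 2^-1.
  - by rewrite invr_ge0.
  - by rewrite invf_lt1// ltr1n.
  have -> : Z k.+1 w - Z k w = X_ (s k.+1) w - X_ (s k) w by rewrite /Z indicE mem_set// !mul1r.
  rewrite -ler_pdivrMr//; have [n0k|kn0] := leqP n0 k.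
    apply: (@le_trans _ _ 1); first by rewrite ler_pdivrMr// mul1r H.
    by rewrite lerDl sumr_ge0// => j _; rewrite divr_ge0// ltW.
  apply: (@le_trans _ _ (\sum_(0 <= k < n0) `|X_ (s k.+1) w - X_ (s k) w| / 2^-1 ^+ k)).
    have t0 j : 0 <= `|X_ (s j.+1) w - X_ (s j) w| / 2^-1 ^+ j by rewrite divr_ge0// ltW.
    exact: (@term_le_sum _ n0 k (fun k => `|X_ (s k.+1) w - X_ (s k) w| / 2^-1 ^+ k)).
  by rewrite lerDr.
pose X w := limn (Z ^~ w).
have mX : measurable_fun setT X.
  by apply: (measurable_fun_cvg (h := Z)) => // w _; exact: cZ.
exists X => // e e0.
have sub : cvg_in_measure P setT (fun k => X_ (s k)) (X : T -> R).
  apply: (ae_cvg_in_measure (G := G)) => //.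
  move=> w Gw; have : Z ^~ w @ \oo --> X w by exact: cZ.
  suff -> : Z ^~ w = (fun k => X_ (s k) w) by [].
  by apply/funext => k; rewrite /Z indicE mem_set// mul1r.
have near0 (r : R) : 0 < r -> exists M, forall n, (M <= n)%N -> (P (setT `&` [set w | (e <= `|X_ n w - X w|)%R]) <= r%:E)%E.
  move=> r0; pose r1 : R := Num.min (r / 2) (e / 2).
  have r10 : 0 < r1 by rewrite lt_min !divr_gt0.
  have [M HM] := C r1 r10; exists M => n Mn.
  have r20 : 0 < r / 2 by rewrite divr_gt0.
  have := cvge0_near (sub (e / 2) (divr_gt0 e0 (ltr0n _ 2))) r20.
  move=> [k0 _ Hk]; pose k := maxn k0 M.
  have Mk : (M <= s k)%N.
    exact: leq_trans (leq_maxr _ _) (ks _).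
  have := Hk k (leq_maxl _ _); rewrite /= !setTI => Pk.
  have mA := measurable_far (e / 2) (mX_ n) (mX_ (s k)).
  have mB := measurable_far (e / 2) (mX_ (s k)) mX.
  have PA : (P (far (X_ n) (X_ (s k)) (e / 2)) <= (r / 2)%:E)%E.
    apply: (@le_trans _ _ (P (far (X_ n) (X_ (s k)) r1))).
      apply: le_measure; rewrite ?inE//; first exact: measurable_far.
      by move=> w; rewrite /far/=; apply: le_trans; rewrite ge_min lexx orbT.
    by apply: le_trans (HM _ _ Mn Mk) _; rewrite lee_fin ge_min lexx.
  rewrite (_ : r%:E = (r / 2)%:E + (r / 2)%:E)%E; last by rewrite -EFinD -splitr.
  apply: le_trans (leeD PA (ltW Pk)); apply: le_trans (measureU2 _ mA mB).
  apply: le_measure; rewrite ?inE.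
  - exact: (measurable_far e (mX_ n) mX).
  - exact: measurableU.
  move=> w /= h; apply: contrapT => /not_orP[]; rewrite /far/= => /negP; rewrite -ltNge => h1 /negP; rewrite -ltNge => h2.
  move: h; apply/negP; rewrite -ltNge.
  have -> : X_ n w - X w = (X_ n w - X_ (s k) w) + (X_ (s k) w - X w) by ring.
  by apply: le_lt_trans (ler_normD _ _) _; lra.
apply/fine_cvgP; split.
  by apply: nearW => n; rewrite fin_num_measure// setTI; exact: (measurable_far e (mX_ n) mX).
apply/cvgrPdist_le => r r0; have [M HM] := near0 r r0.
exists M => // n Mn /=; rewrite sub0r normrN ger0_norm ?fine_ge0//.
rewrite -lee_fin fineK ?HM// fin_num_measure// setTI; exact: (measurable_far e (mX_ n) mX).
Qed.

End convergence_in_measure.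

Section wiener.
Context d (T : measurableType d) (R : realType) (P : probability T R)
  (L : bool -> T -> T) (X : T -> R).
Hypothesis S : splitting P L X.
Local Notation inc := (inc L X).
Local Notation bm := (bm L X).
Implicit Types (f g : R -> R).

Definition wsum m g w : R := \sum_(0 <= j < 2 ^ m) coef m j g * inc m j w.

Lemma measurable_wsum m g : measurable_fun setT (wsum m g).
Proof. by apply: measurable_sum => j; apply: measurable_funM => //; exact: (measurable_inc S). Qed.

Lemma wsum_linear m c f g w : square_integrable f -> square_integrable g ->
  wsum m (fun x => c * f x + g x) w = c * wsum m f w + wsum m g w.
Proof.
move=> sf sg; rewrite /wsum mulr_sumr -big_split/=; apply: eq_bigr => j _.
by rewrite coef_linear// mulrDl mulrA.
Qed.

Lemma wsum_refine m k g w :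
  wsum m g w = \sum_(0 <= j < 2 ^ (m + k)) coef m (j %/ 2 ^ k) g * inc (m + k) j w.
Proof.
elim: k => [|k ->].
  by rewrite addn0; apply: eq_bigr => j _; rewrite divn1.
rewrite addnS.
have E (F : nat -> R) : \sum_(0 <= j < 2 ^ (m + k).+1) F j = \sum_(0 <= j < 2 ^ (m + k)) (F j.*2 + F j.*2.+1).
  by rewrite expnS mul2n sum_double.
rewrite E; apply: eq_bigr => j _.
have -> : (j.*2 %/ 2 ^ k.+1 = j %/ 2 ^ k)%N by rewrite expnS divnMA -muln2 mulnK.
have -> : (j.*2.+1 %/ 2 ^ k.+1 = j %/ 2 ^ k)%N by rewrite expnS divnMA -addn1 -muln2 divnMDl// addn0.
by rewrite -mulrDr (inc_consistent S w (m + k) j).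
Qed.

Lemma weighted_law m n (a : nat -> R) A : measurable A ->
  P ((fun w => \sum_(0 <= j < n) a j * inc m j w) @^-1` A) =
  gauss_law (Num.sqrt (2^-1 ^+ m * \sum_(0 <= j < n) a j ^+ 2)) A.
Proof.
move=> mA.
rewrite (_ : (fun w => _) = block (eta L X m) (fun j => a j * scale_at R m) 0 n); last first.
  by apply/funext => w; apply: eq_bigr => j _; rewrite /inc mulrA.
rewrite (block_law (eta_iid S m))//; congr (gauss_law (Num.sqrt _) A).
by rewrite mulr_sumr; apply: eq_bigr => j _; rewrite exprMn scale_at_sqr mulrC.
Qed.

Lemma wsum_law m g A : measurable A ->
  P (wsum m g @^-1` A) = gauss_law (Num.sqrt (sqnorm m g)) A.
Proof. exact: weighted_law. Qed.

(** Written at the finer level, the difference is a single weighted sum of independent increments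
    whose variance is, by [coef_diff_sq], the difference of the squared norms; the fourth moment
    tail bound then applies. *)
Lemma wsum_diff_prob m k g (r : R) : square_integrable g -> 0 < r ->
  (P (far (wsum m g) (wsum (m + k) g) r) <=
   (128 * (sqnorm (m + k) g - sqnorm m g) ^+ 2 / (r / 2) ^+ 4)%:E)%E.
Proof.
move=> sg r0.
pose a j := coef (m + k) j g - coef m (j %/ 2 ^ k) g.
pose D w := \sum_(0 <= j < 2 ^ (m + k)) a j * inc (m + k) j w.
have DE w : wsum (m + k) g w - wsum m g w = D w.
  by rewrite (wsum_refine m k) /wsum -sumrB; apply: eq_bigr => j _; rewrite -mulrBl.
pose s := sqnorm (m + k) g - sqnorm m g.
have s0 : 0 <= s by rewrite subr_ge0 sqnorm_mono.
have r20 : 0 < r / 2 by rewrite divr_gt0.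
(* [far] is a weak inequality and [gaussian_tail] a strict one; halving r bridges the two. *)
pose A : set R := [set x | r / 2 < `|x|].
have mA : measurable A.
  by apply: measurable_gt.
apply: (@le_trans _ _ (P (D @^-1` A))).
  apply: le_measure; rewrite ?inE.
  - by apply: measurable_far; exact: measurable_wsum.
  - apply: measurable_preimage => //; apply: measurable_sum => j.
    by apply: measurable_funM => //; exact: (measurable_inc S).
  move=> w; rewrite /far /A /= -DE distrC => h; apply: lt_le_trans h.
  by rewrite ltr_pdivrMr// ltr_pMr// ltr1n.
rewrite weighted_law// coef_diff_sq// -/s.
have := gaussian_tail (Num.sqrt s) r20.
have -> : Num.sqrt s ^+ 4 = s ^+ 2 by rewrite (exprM _ 2 2) sqr_sqrtr.
by rewrite gauss_lawE.
Qed.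

Lemma wiener_exists : exists2 I : (R -> R) -> T -> R, forall g, measurable_fun setT (I g) &
  forall g, square_integrable g -> measurable_fun setT (I g) /\
    cvg_in_measure P setT (fun m => wsum m g : T -> R) (I g).
Proof.
have H g : exists2 J : T -> R, measurable_fun setT J &
    (square_integrable g -> cvg_in_measure P setT (fun m => wsum m g : T -> R) J).
  (* The value 0 off the square-integrable functions makes [I g] measurable for every g. *)
  have [sg|ng] := pselect (square_integrable g); last by exists (fun=> 0).
  have [||J mJ cJ] := @measure_cauchy_limit _ _ _ P (fun m => wsum m g); last by exists J.
    by move=> m; exact: measurable_wsum.
  move=> e e0.
  pose K : R := 128 / (e / 2) ^+ 4.
  have K0 : 0 < K by rewrite divr_gt0// exprn_gt0// divr_gt0.
  (* For 0 <= s <= r <= 1 the bound K s^2 is at most K s, hence at most e. *)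
  pose r : R := Num.min 1 (e / K).
  have r0 : 0 < r by rewrite lt_min ltr01 divr_gt0.
  have /cvgrPdist_le/(_ _ r0)[N _ HN] := parseval sg.
  exists N.
  have key m k : (N <= m)%N -> (P (far (wsum m g) (wsum (m + k) g) e) <= e%:E)%E.
    move=> Nm; apply: le_trans (wsum_diff_prob m k sg e0) _.
    have s0 : 0 <= sqnorm (m + k) g - sqnorm m g by rewrite subr_ge0 sqnorm_mono.
    have sr : sqnorm (m + k) g - sqnorm m g <= r.
      have := HN m Nm; rewrite /= ger0_norm ?subr_ge0 ?bessel//.
      by have := bessel (m + k) sg; lra.
    rewrite lee_fin mulrAC -/K mulrC -ler_pdivlMr//.
    move: s0 sr; move: (sqnorm _ _ - _) => s s0 sr.
    have r1 : r <= 1 by rewrite /r ge_min lexx.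
    have re : r <= e / K by rewrite /r ge_min lexx orbT.
    rewrite expr2; apply: le_trans re; apply: le_trans (sr).
    by rewrite ler_piMr//; apply: le_trans sr r1.
  move=> m n Nm Nn; have [mn|/ltnW nm] := leqP m n.
    by rewrite -(subnKC mn); exact: key.
  have -> : far (wsum m g) (wsum n g) e = far (wsum n g) (wsum m g) e.
    by apply/seteqP; split=> w; rewrite /far/= distrC.
  by rewrite -(subnKC nm); exact: key.
exists (fun g => s2val (cid2 (H g))) => g; first by case: cid2.
by case: cid2 => J /= mJ cJ sg; split=> //; exact: cJ.
Qed.

Variable I : (R -> R) -> T -> R.
Hypothesis HI : forall g, square_integrable g -> measurable_fun setT (I g) /\
  cvg_in_measure P setT (fun m => wsum m g : T -> R) (I g).

Lemma wiener_law g A : square_integrable g -> measurable A ->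
  P (I g @^-1` A) = gauss_law (Num.sqrt (sqint g)) A.
Proof.
move=> sg mA; have [mI cI] := HI sg.
have := @gauss_law_lim _ _ _ _ _ _ S 1 (fun m _ => wsum m g) (fun=> I g)
  (fun m _ => Num.sqrt (sqnorm m g)) (fun=> Num.sqrt (sqint g)).
move=> /(_ _ _ _ _ _ (fun=> A)); rewrite big_ord_recl big_ord0 mule1 => <- //.
- by congr (P _); apply/seteqP; split=> w /=; [move=> ? []|move/(_ 0%N isT)].
- by move=> m _; exact: measurable_wsum.
- by move=> _; apply: continuous_cvg; [exact: sqrt_continuous|exact: parseval].
- move=> m B mB; rewrite big_ord_recl big_ord0 mule1 -wsum_law//.
  by congr (P _); apply/seteqP; split=> w /=; [move/(_ 0%N isT)|move=> ? []].
Qed.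

Lemma square_integrable_linear c f g : square_integrable f -> square_integrable g ->
  square_integrable (fun x => c * f x + g x).
Proof.
move=> sf sg; split.
- apply: measurable_funD; last exact: sqi_measurable.
  by apply: measurable_funM => //; exact: sqi_measurable.
- apply: (@le_lt_trans _ _ (\int[lebesgue_measure]_x ((2 * c ^+ 2)%:E * (f x ^+ 2)%:E + 2%:E * (g x ^+ 2)%:E))%E).
    apply: ge0_le_integral => //.
    + by move=> x _; rewrite lee_fin sqr_ge0.
    + apply/measurable_EFinP; apply: measurable_funX; apply: measurable_funD; last exact: sqi_measurable.
      by apply: measurable_funM => //; exact: sqi_measurable.
    + apply: emeasurable_funD; apply: measurable_funeM; apply/measurable_EFinP;
       by apply: measurable_funX; exact: sqi_measurable.
    move=> x _; rewrite -!EFinM -EFinD lee_fin -subr_ge0.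
    have -> : 2 * c ^+ 2 * f x ^+ 2 + 2 * g x ^+ 2 - (c * f x + g x) ^+ 2 = (c * f x - g x) ^+ 2 by ring.
    exact: sqr_ge0.
  apply: integrable_lty => //; apply: integrableD => //; apply: integrableZl => //; exact: sqi_sq.
- by move=> x nx; case: sf => _ _ ->//; case: sg => _ _ ->//; rewrite mulr0 addr0.
Qed.

Lemma wiener_linear c f g : square_integrable f -> square_integrable g ->
  {ae P, forall w, I (fun x => c * f x + g x) w = c * I f w + I g w}.
Proof.
move=> sf sg; have [mf cf] := HI sf; have [mg cg] := HI sg.
have [mh ch] := HI (square_integrable_linear c sf sg).
apply: (cvg_measure_unique (X_ := fun m => wsum m (fun x => c * f x + g x))) => //.
- by move=> m; exact: measurable_wsum.
- by apply: measurable_funD => //; exact: measurable_funM.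
rewrite (_ : (fun m => _) = (fun m w => c * wsum m f w + wsum m g w)); last first.
  by apply/funext => m; apply/funext => w; exact: wsum_linear.
apply: cvg_measure_lin => //.
  by move=> m; exact: measurable_wsum.
by move=> m; exact: measurable_wsum.
Qed.

End wiener.

(** * Polarization and the isometry *)

Section polarization.
Context d (T : measurableType d) (R : realType) (mu : {measure set T -> \bar R}).

Variables X Y : T -> R.
Hypothesis iX : mu.-integrable setT (EFin \o (fun w => X w ^+ 2)).
Hypothesis iY : mu.-integrable setT (EFin \o (fun w => Y w ^+ 2)).
Hypothesis iXY : mu.-integrable setT (EFin \o (fun w => (X w + Y w) ^+ 2)).

Let E : (fun w => X w * Y w) = (fun w => 2^-1 * ((X w + Y w) ^+ 2 - X w ^+ 2 - Y w ^+ 2)).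
Proof. by apply/funext => w; field. Qed.

Let i1 : mu.-integrable setT (EFin \o (fun w => (X w + Y w) ^+ 2 - X w ^+ 2)).
Proof. exact: (integrableB measurableT iXY iX). Qed.

Let i2 : mu.-integrable setT (EFin \o (fun w => (X w + Y w) ^+ 2 - X w ^+ 2 - Y w ^+ 2)).
Proof. exact: (integrableB measurableT i1 iY). Qed.

Lemma product_integrable : mu.-integrable setT (EFin \o (fun w => X w * Y w)).
Proof. by rewrite E; exact: (integrableZl measurableT 2^-1 i2). Qed.

Lemma polarization :
  (\int[mu]_w (X w * Y w)%:E = ((\int[mu]_w ((X w + Y w) ^+ 2)%R
    - \int[mu]_w (X w ^+ 2)%R - \int[mu]_w (Y w ^+ 2)%R) / 2)%:E)%E.
Proof.
have -> : (\int[mu]_w (X w * Y w)%:E = (\int[mu]_w (X w * Y w)%R)%:E)%E.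
  by rewrite /Rintegral fineK//; apply: integrable_fin_num => //; exact: product_integrable.
rewrite E RintegralZl// RintegralB// RintegralB//.
by rewrite mulrC.
Qed.

End polarization.

Section wiener_isometry.
Context d (T : measurableType d) (R : realType) (P : probability T R)
  (L : bool -> T -> T) (X : T -> R).
Hypothesis S : splitting P L X.
Local Notation inc := (inc L X).
Local Notation bm := (bm L X).
Local Notation wsum := (wsum L X).
Implicit Types (f g : R -> R).
Variable I : (R -> R) -> T -> R.
Hypothesis HI : forall g, square_integrable g -> measurable_fun setT (I g) /\
  cvg_in_measure P setT (fun m => wsum m g : T -> R) (I g).
Let mI g (sg : square_integrable g) : measurable_fun setT (I g) := proj1 (HI sg).

Lemma wiener_second_moment g : square_integrable g ->
  (\int[P]_w (I g w ^+ 2)%:E = (sqint g * gauss_var)%:E)%E.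
Proof.
move=> sg; rewrite (law_second_moment (mI sg) (fun A => wiener_law S HI sg (A := A))).
by rewrite sqr_sqrtr// /sqint Rintegral_ge0// => x _; exact: sqr_ge0.
Qed.

Lemma wiener_sq_integrable g : square_integrable g ->
  P.-integrable setT (EFin \o (fun w => I g w ^+ 2)).
Proof.
move=> sg; apply/integrableP; split.
  by apply/measurable_EFinP; apply: measurable_funX; exact: mI.
apply: (@le_lt_trans _ _ (\int[P]_w (I g w ^+ 2)%:E)%E).
  by under eq_integral do rewrite /= ger0_norm ?sqr_ge0//.
by rewrite wiener_second_moment// ltry.
Qed.

Section pair.
Variables f g : R -> R.
Hypotheses (sf : square_integrable f) (sg : square_integrable g).

Let h x := 1 * f x + g x.
Let sh : square_integrable h. Proof. exact: square_integrable_linear. Qed.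

Let Efg : (\int[P]_w ((I f w + I g w) ^+ 2)%:E = (sqint h * gauss_var)%:E)%E.
Proof.
have ah : {ae P, forall w, setT w -> ((I h w) ^+ 2)%:E = ((I f w + I g w) ^+ 2)%:E}.
  by have := wiener_linear S HI 1 sf sg; apply: filterS => w E _; rewrite /h E mul1r.
rewrite -wiener_second_moment//; apply/esym; apply: ae_eq_integral => //.
  by apply/measurable_EFinP; apply: measurable_funX; exact: mI.
by apply/measurable_EFinP; apply: measurable_funX; apply: measurable_funD; exact: mI.
Qed.

Let ifg : P.-integrable setT (EFin \o (fun w => (I f w + I g w) ^+ 2)).
Proof.
apply/integrableP; split.
  by apply/measurable_EFinP; apply: measurable_funX; apply: measurable_funD; exact: mI.
apply: (@le_lt_trans _ _ (\int[P]_w ((I f w + I g w) ^+ 2)%:E)%E).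
  by under eq_integral do rewrite /= ger0_norm ?sqr_ge0//.
by rewrite Efg ltry.
Qed.

Lemma wiener_product_integrable : P.-integrable setT (EFin \o (fun w => I f w * I g w)).
Proof. by apply: product_integrable; [exact: wiener_sq_integrable..|]. Qed.

(** The law of [I g] gives second moments; almost sure linearity and polarization on both sides give
    the products. The factor [gauss_var] is the second moment of the standard normal law, kept
    unevaluated. *)
Lemma wiener_isometry :
  (\int[P]_w (I f w * I g w)%:E = gauss_var%:E * \int[lebesgue_measure]_x (f x * g x)%:E)%E.
Proof.
rewrite polarization//; [|exact: wiener_sq_integrable..].
have hE : (fun x => (f x + g x) ^+ 2) = (fun x => h x ^+ 2) by apply/funext => x; rewrite /h mul1r.
rewrite polarization; [|exact: sqi_sq sf|exact: sqi_sq sg|by rewrite hE; exact: sqi_sq sh].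
rewrite hE -EFinM /Rintegral Efg !wiener_second_moment//= -!/(Rintegral _ _ _) -!/(sqint _).
by congr (_%:E); ring.
Qed.

End pair.

Lemma square_integrable0 : square_integrable (fun=> 0 : R).
Proof.
by split=> //; under eq_integral do rewrite expr0n/=; rewrite integral0 ltry.
Qed.

(** Linearity at 1 * 0 + 0 makes [I] of the zero function vanish almost surely; the rest is
    linearity with zero second argument. *)
Lemma wiener_scale c f : square_integrable f ->
  {ae P, forall w, I (fun x => c * f x) w = c * I f w}.
Proof.
move=> sf; have s0 := square_integrable0.
have := wiener_linear S HI 1 s0 s0; have := wiener_linear S HI c sf s0.
rewrite (_ : (fun x : R => 1 * 0 + 0) = (fun=> 0)); last by apply/funext => x; rewrite mulr0 addr0.
rewrite (_ : (fun x : R => c * f x + 0) = (fun x => c * f x)); last by apply/funext => x; rewrite addr0.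
apply: filterS2 => w -> E.
suff -> : I (fun=> 0) w = 0 by rewrite addr0.
by move: E; move: (I _ _ : R) => z; lra.
Qed.

Definition cut (t : R) f : R -> R := fun x => if 0 < x < t then f x else 0.

Definition upto (t b : R) : R -> R := cut t (fun x => (x <= b)%R%:R).

Lemma uptoE t b x : upto t b x = \1_(`]0, t[ `&` `]-oo, b]) x.
Proof.
rewrite /upto /cut indicE; case: ifPn => h.
  case: (leP x b) => xb; [rewrite mem_set//|rewrite memNset//=] => /=; rewrite !in_itv/= h//= => -[_].
  by rewrite leNgt xb.
by rewrite memNset//= => -[]; rewrite in_itv/= (negbTE h).
Qed.

Lemma upto_square_integrable t b : t <= 1 -> square_integrable (upto t b).
Proof.
move=> t1.
have mD : measurable (`]0, t[ `&` `]-oo, b] : set R).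
  by apply: measurableI; exact: measurable_itv.
split.
- by rewrite (_ : upto t b = \1_(`]0, t[ `&` `]-oo, b])); [exact: measurable_indic|apply/funext => x; exact: uptoE].
- under eq_integral => x _ do rewrite uptoE indicE expr2 -natrM mulnb andbb -[X in X%:E]indicE.
  rewrite integral_indic// setIT; apply: (@le_lt_trans _ _ (lebesgue_measure (`]0, t[ : set R))).
    by apply: le_measure; rewrite ?inE//; exact: measurable_itv.
  by rewrite lebesgue_measure_itv/=; case: ifP => _; rewrite ?ltry// -EFinB ltry.
- move=> x nx; rewrite /upto /cut; case: ifPn => // /andP[x0 xt]; move: nx.
  by rewrite x0 (lt_le_trans xt t1).
Qed.

Lemma coef_upto m j (t b : R) : 0 <= b -> b <= t -> t <= 1 ->
  [/\ (j < ticks m b)%N -> coef m j (upto t b) = 1,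
      (ticks m b < j)%N -> coef m j (upto t b) = 0 & `|coef m j (upto t b)| <= 1].
Proof.
move=> b0 bt t1; have h0 := half_gt0 m (R := R).
have mC := measurable_cell m j (R := R).
have su := upto_square_integrable b t1.
have /andP[l u] := ticks_itv m b0.
have e1 : (2 : R) ^+ m * 2^-1 ^+ m = 1 by exact: half_mul.
have fE : fine (lebesgue_measure (cell m j : set R)) = 2^-1 ^+ m by rewrite cell_measure.
split=> [jt|jt|].
- rewrite /coef /cell -Rintegral_itv_obnd_cbnd; last first.
    by apply: sqi_integrableS => //; exact: measurable_itv.
  rewrite (@eq_Rintegral _ _ _ _ _ (cst 1)); last first.
    move=> x; rewrite inE/= in_itv/= => /andP[x1 x2].
    have xb : x < b.
      apply: lt_le_trans x2 _; rewrite -(ler_pM2l (exprn_gt0 m (ltr0n R 2))) mulrCA e1 mulr1.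
      by apply: le_trans l; rewrite ler_nat.
    rewrite /upto /cut (lt_le_trans xb bt) andbT (ltW xb).
    by rewrite (le_lt_trans _ x1)// mulr_ge0// ltW.
  rewrite Rintegral_cst//= mul1r lebesgue_measure_itv/= lte_fin ltr_pM2r// ltr_nat ltnSn -EFinB/=.
  by rewrite -mulrBl -natrB// subSnn mul1r.
- rewrite /coef (@eq_Rintegral _ _ _ _ _ (cst 0)); first by rewrite Rintegral_cst//= mul0r mulr0.
  move=> x; rewrite inE /cell/= in_itv/= => /andP[x1 x2].
  have bx : b < x.
    apply: lt_le_trans x1; rewrite -(ltr_pM2l (exprn_gt0 m (ltr0n R 2))) mulrCA e1 mulr1.
    by apply: lt_le_trans u _; rewrite ler_nat.
  by rewrite /upto /cut [x <= b]leNgt bx/=; case: ifP.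
rewrite /coef normrM ger0_norm ?exprn_ge0//.
rewrite -(@ler_pM2r _ (2^-1 ^+ m))// mul1r mulrAC e1 mul1r.
apply: le_trans (le_normr_Rintegral mC (sqi_integrableS su mC)) _.
rewrite -[leRHS]mul1r -fE -(Rintegral_cst _ mC).
apply: le_Rintegral => //.
- exact: integrable_norm (sqi_integrableS su mC).
- by apply: (cst_integrable _ mC); rewrite cell_measure ltry.
by move=> x _; rewrite uptoE indicE; case: (x \in _); rewrite ?normr1 ?normr0.
Qed.

(** The averages of the indicator are 1 before the cell of b and 0 after it, so the discrete
    integral differs from the partial sum of the path by at most one increment, of size C rho^m. *)
Lemma wiener_upto (t b : R) : 0 <= b -> b <= t -> t <= 1 ->
  {ae P, forall w, I (upto t b) w = bm b w}.
Proof.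
move=> b0 bt t1; have su := upto_square_integrable b t1.
have [mu cu] := HI su.
apply: (cvg_measure_unique (X_ := fun m => wsum m (upto t b))) => //.
- by move=> m; exact: (measurable_wsum S).
- exact: (measurable_bm S).
apply: (ae_cvg_in_measure (G := good L X)) => //.
- by move=> m; exact: (measurable_wsum S).
- exact: (measurable_bm S).
- exact: (measurable_good S).
- exact: (good_full S).
move=> w gw.
have cp : psum (fun m i => inc m i w) m b @[m --> \oo] --> bm b w.
  by rewrite -(ginc_good gw); exact: (bm_cvg S).
have [C C0 CC] := good_controlled 1 gw.
have cq : C * rho ^+ m @[m --> \oo] --> (0 : R) by apply: scaled_cvg0; exact: rho_cvg0.
have cd : wsum m (upto t b) w - psum (fun m i => inc m i w) m b @[m --> \oo] --> (0 : R).
  apply/cvgr0Pnorm_le => e e0; have /cvgr_lt/(_ _ e0) := cq; apply: filterS => m /ltW; apply: le_trans.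
  have tm : (ticks m b <= 2 ^ m)%N by have := @ticks_le _ m b 1 b0 (le_trans bt t1); rewrite mul1n.
  rewrite /wsum /psum (big_cat_nat (n := ticks m b))//=.
  rewrite [X in X + _ - _](eq_big_nat _ _ (F2 := fun i => inc m i w)); last first.
    by move=> i /andP[_ it]; have [-> // _ _] := coef_upto m i b0 bt t1; rewrite mul1r.
  rewrite addrAC subrr add0r.
  move: tm; rewrite leq_eqVlt => /orP[/eqP <-|tm].
    by rewrite big_geq// normr0 mulr_ge0// exprn_ge0// rho_ge0.
  rewrite big_ltn// big_nat big1 ?addr0; last first.
    by move=> i /andP[it _]; have [_ -> // _] := coef_upto m i b0 bt t1; rewrite mul0r.
  have [_ _ c1] := coef_upto m (ticks m b) b0 bt t1.
  rewrite normrM -[leRHS]mul1r; apply: ler_pM => //.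
  by apply: CC; rewrite mul1n.
rewrite (_ : (fun m => _) = (fun m => (wsum m (upto t b) w - psum (fun m i => inc m i w) m b)
  + psum (fun m i => inc m i w) m b)); last by apply/funext => m; rewrite subrK.
by rewrite -[bm b w]add0r; exact: cvgD cd cp.
Qed.

End wiener_isometry.

(** * The reproducing kernel space of the noise and its cylindrical Brownian motion *)

Section cylindrical.
Context d (T : measurableType d) (R : realType) (P : probability T R)
  (L : bool -> T -> T) (X : T -> R).
Hypothesis S : splitting P L X.
Variables (E : normedModType R) (phi : E).
Local Notation bm := (bm L X).

Definition dot (h k : R^o) : R := h * k.

Lemma dot_hilbert : hilbert_product (dot : R^o -> R^o -> R).
Proof.
split=> [h k|k a u v|h]; rewrite /dot.
- exact: mulrC.
- by rewrite mulrDl -mulrA.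
- by rewrite real_normK ?num_real.
Qed.

(** The kernel space of B(1) phi is the real line, and the factor makes [embed] composed with its
    adjoint the covariance operator x' |-> gauss_var x'(phi) phi. *)
Definition embed (h : R^o) : E := (Num.sqrt gauss_var * h) *: phi.

Lemma sqrt_var_gt0 : 0 < Num.sqrt gauss_var :> R.
Proof. by rewrite sqrtr_gt0 gauss_var_gt0. Qed.

Lemma embed_bounded : bounded_operator embed.
Proof.
split=> [a u v|].
  by rewrite /embed mulrDr scalerDl scalerA; congr (_ *: _ + _); rewrite mulrCA.
move=> x; apply: cvgZr_tmp; apply: cvgM; [exact: cvg_cst|exact: cvg_id].
Qed.

Lemma functional_scale (x' : E -> R) c u : functional x' -> x' (c *: u) = c * x' u.
Proof.
move=> [lx _]; have := lx c u 0; rewrite addr0 => ->.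
by have := lx 1 0 0; rewrite scaler0 addr0 mul1r; move: (x' 0) => z; lra.
Qed.

Lemma adjoint_embed (x' : E -> R) (k : R^o) : functional x' ->
  adjoint_at dot embed x' k <-> k = Num.sqrt gauss_var * x' phi.
Proof.
move=> fx; split=> [/(_ 1)|-> h]; rewrite /dot /embed functional_scale//.
  by rewrite mul1r mulr1.
by rewrite mulrCA mulrA.
Qed.

Lemma simple_measurable (f : R -> R^o) : simple_fun f -> measurable_fun setT (f : R -> R).
Proof.
move=> [fr fm] _ A mA; rewrite setTI.
have -> : f @^-1` A = \bigcup_(h in range f `&` A) f @^-1` [set h].
  apply/seteqP; split=> [x Ax|x [h [_ Ah] /= ->]//].
  by exists (f x) => //; split=> //; exists x.
by apply: fin_bigcup_measurable => [|h _]; [exact: finite_setIl|exact: fm].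
Qed.

Lemma L2_cut (t : R) (f : R -> R^o) : t <= 1 -> L2 t f -> square_integrable (cut t f).
Proof.
move=> t1 [[f_ [sf cf]] ff].
have mD : measurable (`]0, t[%classic : set R) by exact: measurable_itv.
have cE : cut t f = (f : R -> R) \_ `]0, t[.
  apply/funext => x; rewrite /cut patchE; case: ifPn => h.
    by rewrite mem_set//= in_itv/= h.
  by rewrite memNset//= in_itv/=; exact/negP.
have mf : measurable_fun `]0, t[ (f : R -> R).
  apply: (measurable_fun_cvg (h := f_)) => [n|x xt]; last exact: cf.
  by apply: measurable_funTS; exact: simple_measurable.
split.
- by rewrite cE; apply/(measurable_restrictT _ mD).
- move: ff; rewrite integral_mkcond; congr (_ < _)%E; apply: eq_integral => x _.
  rewrite cE !patchE; case: ifPn => _; first by rewrite real_normK ?num_real.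
  by rewrite expr0n.
- move=> x nx; rewrite /cut; case: ifPn => // /andP[x0 xt]; move: nx.
  by rewrite x0 (lt_le_trans xt t1).
Qed.

(** Dividing the Wiener integral by the root of [gauss_var] restores the isometry and cancels the
    same factor in i^* x' = sqrt gauss_var x'(phi), so that steps are sent to increments of x'(W).
    Measurability of [WH f] for all f is recorded for later sums over lists. *)
Lemma cylindrical_bm_exists (t : R) : t <= 1 ->
  exists2 WH : (R -> R^o) -> T -> R, forall f, measurable_fun setT (WH f) &
    induced_cylindrical_bm P (fun s w => bm s w *: phi) dot embed t WH.
Proof.
move=> t1; have [I mI HI] := wiener_exists S.
pose v : R := Num.sqrt gauss_var; have v0 : 0 < v := sqrt_var_gt0.
exists (fun f w => v^-1 * I (cut t f) w) => [f|]; first exact: measurable_funM.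
split.
- move=> f /(L2_cut t1) sf; split; first by apply: measurable_funM => //; exact: mI.
  exists (v^-1 * Num.sqrt (sqint (cut t f))) => A mA.
  have := wiener_law S HI sf (measurable_preimage (measurable_scale v^-1) mA).
  rewrite gauss_lawE => E0; apply: (etrans E0); congr (normal_prob _ _ _).
  by apply/funext => r; rewrite /preimage/= mulrA.
- move=> c f g /(L2_cut t1) sf /(L2_cut t1) sg.
  have := wiener_linear S HI c sf sg; apply: filterS => w.
  have -> : cut t (fun s => c *: f s + g s) = (fun x => c * cut t f x + cut t g x).
    by apply/funext => x; rewrite /cut; case: ifP => // _; rewrite mulr0 addr0.
  by move=> ->; rewrite mulrDr mulrCA.
- move=> f g /(L2_cut t1) sf /(L2_cut t1) sg.
  rewrite unlock.
  under eq_integral => w _.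
    rewrite (_ : v^-1 * I (cut t f) w * (v^-1 * I (cut t g) w) =
      gauss_var^-1 * (I (cut t f) w * I (cut t g) w)); last first.
      by rewrite -[in RHS](sqr_sqrtr (ltW gauss_var_gt0)) -/v; field; rewrite lt0r_neq0.
    rewrite EFinM; over.
  rewrite integralZl//; last exact: wiener_product_integrable S _ HI _ _ sf sg.
  rewrite (wiener_isometry S HI sf sg) muleA -EFinM mulVf ?lt0r_neq0 ?gauss_var_gt0// mul1e.
  rewrite [RHS]integral_mkcond; apply: eq_integral => x _.
  rewrite patchE /cut; case: ifPn => h; first by rewrite mem_set//= in_itv/= h.
  by rewrite memNset ?mulr0//= in_itv/=; exact/negP.
- move=> a b x' k a0 ab bt fx /(adjoint_embed _ fx) ->.
  have b0 := le_trans a0 ab.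
  have sa := upto_square_integrable a t1; have sb := upto_square_integrable b t1.
  have := wiener_upto S HI a0 (le_trans ab bt) t1.
  have := wiener_upto S HI b0 bt t1.
  have := wiener_linear S HI (-1) sa sb.
  have := wiener_scale S HI (v * x' phi) (square_integrable_linear (-1) sa sb).
  rewrite (_ : (fun x => _ * _) = cut t (step a b (v * x' phi : R^o))); last first.
    apply/funext => x; rewrite /upto /cut; case: ifPn => _; last by rewrite mulr0 addr0 mulr0.
    rewrite /step indicE mulrC; congr (_ * _).
    have [xb|bx] := leP x b; have [xa|ax] := leP x a.
    + by rewrite memNset ?mulr1 ?addNr//= in_itv/= => /andP[]; rewrite ltNge xa.
    + by rewrite mem_set ?mulr0 ?add0r//= in_itv/= ax.
    + by have := le_trans xa ab; rewrite leNgt bx.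
    + by rewrite memNset ?mulr0 ?add0r//= in_itv/= => /andP[_]; rewrite leNgt bx.
  move=> h1 h2 h3 h4.
  have h34 : {ae P, forall w, I (upto t b) w = bm b w /\ I (upto t a) w = bm a w}.
    by move: h3 h4; apply: filterS2 => w.
  move: h1 h2 h34; apply: filterS3 => w -> -> [-> ->].
  rewrite -scalerBl functional_scale//.
  by rewrite -/v; field; rewrite lt0r_neq0.
Qed.

End cylindrical.

(** * The Banach space and the shift group *)

Definition domain (R : realType) : Type := (nat * (nat -> bool) * R)%type.

Definition bounded_fun (R : realType) (f : domain R -> R) : Prop :=
  exists M, forall z, `|f z| <= M.

(** One modulus of continuity serves all indices: this is what makes the shift strongly continuous
    for the supremum norm. *)
Definition equicontinuous_fun (R : realType) (f : domain R -> R) : Prop :=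
  forall e, 0 < e -> exists2 r, 0 < r &
    forall k x y, `|x - y| < r -> `|f (k, x) - f (k, y)| <= e.

Definition buc_pred (R : realType) : {pred domain R -> R^o} :=
  fun f => `[< bounded_fun f /\ equicontinuous_fun f >].

Section buc.
Context {R : realType}.

Lemma buc_predP (f : domain R -> R^o) :
  reflect (bounded_fun f /\ equicontinuous_fun f) (f \in @buc_pred R).
Proof. exact: asboolP. Qed.

Lemma buc_submod_closed : submod_closed (@buc_pred R).
Proof.
split=> [|c f g /buc_predP[[M bf] ef] /buc_predP[[N bg] eg]].
  apply/buc_predP; split=> [|e e0].
    by exists 0 => z; rewrite normr0.
  by exists 1 => // k x y _; rewrite subrr normr0 ltW.
apply/buc_predP; split=> [|e e0].
  exists (`|c| * M + N) => z; apply: le_trans (ler_normD _ _) _.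
  by apply: lerD => //; rewrite normrM; apply: ler_wpM2l.
have c1 : 0 < 2 * (`|c| + 1) by rewrite mulr_gt0// ltr_wpDl.
have [r r0 Hr] := ef (e / (2 * (`|c| + 1))) (divr_gt0 e0 c1).
have [s s0 Hs] := eg (e / 2) (divr_gt0 e0 (ltr0n _ 2)).
exists (Num.min r s); first by rewrite lt_min r0.
move=> k x y; rewrite lt_min => /andP[xr xs].
rewrite !fctE.
have -> : c *: f (k, x) + g (k, x) - (c *: f (k, y) + g (k, y)) =
  c * (f (k, x) - f (k, y)) + (g (k, x) - g (k, y)) by rewrite /GRing.scale/=; ring.
apply: le_trans (ler_normD _ _) _; rewrite normrM [leRHS](splitr e).
apply: lerD; last exact: Hs.
have := Hr k x y xr; move: `|f (k, x) - f (k, y)| (normr_ge0 (f (k, x) - f (k, y))) => u u0 ue.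
apply: (@le_trans _ _ ((`|c| + 1) * u)); first by apply: ler_wpM2r => //; lra.
by move: ue; rewrite ler_pdivlMr//; lra.
Qed.

HB.instance Definition _ := GRing.isSubmodClosed.Build R (domain R -> R^o) (@buc_pred R) buc_submod_closed.

Record buc : Type := Buc { buc_fun :> domain R -> R^o; _ : buc_fun \in @buc_pred R }.

HB.instance Definition _ := [isSub for buc_fun].
HB.instance Definition _ := [Choice of buc by <:].
HB.instance Definition _ := [SubChoice_isSubLmodule of buc by <:].

Implicit Types f g : buc.

Lemma buc_bounded f : bounded_fun f. Proof. by case: f => f /= /buc_predP[]. Qed.

Lemma buc_equicontinuous f : equicontinuous_fun f. Proof. by case: f => f /= /buc_predP[]. Qed.

Lemma buc_ext f g : (forall z, f z = g z) -> f = g.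
Proof. by move=> fg; apply/val_inj/funext. Qed.

Lemma bucD f g z : (f + g) z = f z + g z. Proof. by []. Qed.
Lemma bucB f g z : (f - g) z = f z - g z. Proof. by []. Qed.
Lemma bucZ c f z : (c *: f) z = c * f z. Proof. by []. Qed.
Lemma buc0 z : (0 : buc) z = 0. Proof. by []. Qed.
Lemma buc_sum (I : Type) (s : seq I) (F : I -> buc) z : (\sum_(j <- s) F j) z = \sum_(j <- s) F j z.
Proof. exact: (big_morph (fun f : buc => f z : R) (fun f g => bucD f g z) (buc0 z)). Qed.

Definition buc_norm f : R := sup [set `|f z| | z in setT].

Lemma buc_norm_sup f : has_sup [set `|f z| | z in setT].
Proof.
split; first by exists `|f (0%N, fun=> true, 0)|; exists (0%N, fun=> true, 0).
by have [M bf] := buc_bounded f; exists M => _ [z _ <-].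
Qed.

Lemma le_buc_norm f z : `|f z| <= buc_norm f.
Proof. by apply: ub_le_sup; [case: (buc_norm_sup f)|exists z]. Qed.

Lemma buc_norm_le f M : (forall z, `|f z| <= M) -> buc_norm f <= M.
Proof. by move=> fM; apply: ge_sup; [case: (buc_norm_sup f)|move=> _ [z _ <-]]. Qed.

Lemma buc_normD f g : buc_norm (f + g) <= buc_norm f + buc_norm g.
Proof.
apply: buc_norm_le => z; rewrite bucD; apply: le_trans (ler_normD _ _) _.
by apply: lerD; exact: le_buc_norm.
Qed.

Lemma buc_normZ (c : R) f : buc_norm (c *: f) = `|c| * buc_norm f.
Proof.
apply/eqP; rewrite eq_le; apply/andP; split.
  by apply: buc_norm_le => z; rewrite bucZ normrM; apply: ler_wpM2l => //; exact: le_buc_norm.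
have [->|c0] := eqVneq c 0.
  by rewrite normr0 mul0r; apply: le_trans (normr_ge0 _) (le_buc_norm _ (0%N, fun=> true, 0)).
rewrite mulrC -ler_pdivlMr ?normr_gt0//; apply: buc_norm_le => z.
by rewrite ler_pdivlMr ?normr_gt0// mulrC -normrM -bucZ; exact: le_buc_norm.
Qed.

Lemma buc_norm_eq0 f : buc_norm f = 0 -> f = 0.
Proof.
move=> f0; apply: buc_ext => z; apply/eqP; rewrite -normr_eq0 eq_le normr_ge0 andbT.
by rewrite -f0; exact: le_buc_norm.
Qed.

HB.instance Definition _ := @Lmodule_isNormed.Build R buc buc_norm buc_normD buc_normZ buc_norm_eq0.

Lemma le_norm f z : `|f z| <= `|f|. Proof. exact: le_buc_norm. Qed.
Lemma norm_le f M : (forall z, `|f z| <= M) -> `|f| <= M. Proof. exact: buc_norm_le. Qed.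

(** A Cauchy filter is reduced to a sequence with geometrically small steps; its pointwise limit is
    uniform, and boundedness and the common modulus survive uniform limits. *)
Lemma buc_complete (F : set_system buc) : ProperFilter F -> cauchy F -> cvg F.
Proof.
move=> FF Fc; have h0 n : 0 < (2^-1 : R) ^+ n by rewrite exprn_gt0// invr_gt0.
have [f_ Ff] : exists f_ : nat -> buc, forall n, F (ball (f_ n) (2^-1 ^+ n)).
  have ex n : exists f : buc, F (ball f (2^-1 ^+ n)).
    by have /cauchyP /(_ (2^-1 ^+ n) (h0 n)) := Fc.
  by exists (fun n => sval (cid (ex n))) => n; case: cid.
have dist n : `|f_ n.+1 - f_ n| <= 2 * 2^-1 ^+ n.
  have [g [/= g1 g2]] := filter_ex (filterI (Ff n.+1) (Ff n)).
  have -> : f_ n.+1 - f_ n = (f_ n.+1 - g) - (f_ n - g) by rewrite opprB addrA subrK.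
  apply: le_trans (ler_normB _ _) _; rewrite mulr_natl mulr2n; apply: lerD; last exact: ltW.
  apply: le_trans (ltW g1) _; rewrite exprS ler_piMl ?(ltW (h0 _))//.
  by rewrite invf_le1// ler1n.
have lim z : f_ n z @[n --> \oo] --> limn (fun n => f_ n z : R) /\
    forall n, `|limn (fun n => f_ n z : R) - f_ n z| <= 4 * 2^-1 ^+ n.
  have [||n|c H] := @geometric_cauchy R R^o (fun n => f_ n z) 2 2^-1.
  - by rewrite invr_ge0.
  - by rewrite invf_lt1// ltr1n.
  - by rewrite -bucB; apply: le_trans (le_norm _ _) (dist n).
  split=> // n; apply: le_trans (H n) _.
  by rewrite le_eqVlt; apply/orP; left; apply/eqP; field.
pose l z : R^o := limn (fun n => f_ n z : R).
have bl : bounded_fun (l : domain R -> R).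
  have [M HM] := buc_bounded (f_ 0%N).
  exists (4 + M) => z; have -> : l z = (l z - f_ 0%N z) + f_ 0%N z by rewrite subrK.
  apply: le_trans (ler_normD _ _) _; apply: lerD => //.
  by have [_ /(_ 0%N)] := lim z; rewrite expr0 mulr1.
have small e : 0 < e -> exists n, 5 * (2^-1 : R) ^+ n < e.
  move=> e0; have : 5 * (2^-1 : R) ^+ n @[n --> \oo] --> (0 : R) by apply: scaled_cvg0; exact: half_pow_cvg0.
  by move=> /cvgr_lt/(_ _ e0)[n _ H]; exists n; apply: (H n) => /=.
have el : equicontinuous_fun (l : domain R -> R).
  move=> e e0; have e3 : 0 < e / 3 by rewrite divr_gt0.
  have [n Hn] := small _ e3; have [r r0 Hr] := buc_equicontinuous (f_ n) e3.
  exists r => // k x y xy.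
  have -> : l (k, x) - l (k, y) = (l (k, x) - f_ n (k, x)) + (f_ n (k, x) - f_ n (k, y)) - (l (k, y) - f_ n (k, y)) by ring.
  apply: le_trans (ler_normB _ _) _; apply: le_trans (lerD (ler_normD _ _) (lexx _)) _.
  have [_ /(_ n)] := lim (k, x); have [_ /(_ n)] := lim (k, y); rewrite -!/(l _).
  by have := Hr k x y xy; have := h0 n; move: (2^-1 ^+ n) Hn => u; lra.
have lP : l \in @buc_pred R by apply/buc_predP.
apply/cvg_ex; exists (Buc lP); apply/cvgrPdist_lt => e e0.
have [n Hn] := small _ e0; apply: filterS (Ff n) => g gn.
have -> : Buc lP - g = (Buc lP - f_ n) + (f_ n - g) by rewrite addrA subrK.
apply: le_lt_trans (ler_normD _ _) _.
have : `|Buc lP - f_ n| <= 4 * 2^-1 ^+ n.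
  by apply: norm_le => z; rewrite bucB; have [_] := lim z.
have : `|f_ n - g| < 2^-1 ^+ n by [].
by move: (2^-1 ^+ n) Hn => u; lra.
Qed.

HB.instance Definition _ := Uniform_isComplete.Build buc buc_complete.

End buc.
Arguments buc R : clear implicits.

Section shift.
Context {R : realType}.
Implicit Types (f g : buc R) (s t e : R).

Lemma shift_in t f : (fun z : domain R => f (z.1, z.2 + t) : R^o) \in @buc_pred R.
Proof.
apply/buc_predP; split; first by have [M HM] := buc_bounded f; exists M.
move=> e e0; have [r r0 Hr] := buc_equicontinuous f e0.
exists r => // k x y xy /=; apply: Hr.
by have -> : x + t - (y + t) = x - y by ring.
Qed.

Definition shift (t : R) f : buc R := Buc (shift_in t f).

Lemma shiftE t f k x : shift t f (k, x) = f (k, x + t). Proof. by []. Qed.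

Lemma norm_shift t f : `|shift t f| <= `|f|.
Proof. by apply: norm_le => -[k x]; rewrite shiftE; exact: le_norm. Qed.

Lemma shift_linear t : linear (shift t). Proof. by move=> a f g; apply: buc_ext => -[k x]. Qed.

Lemma shiftB t f g : shift t f - shift t g = shift t (f - g).
Proof. by apply: buc_ext => -[k x]. Qed.

Lemma shiftZ t c f : shift t (c *: f) = c *: shift t f.
Proof. by apply: buc_ext => -[k x]. Qed.

Lemma shift_continuous t : continuous (shift t : buc R -> buc R).
Proof.
move=> f; have FF : Filter (nbhs f) := nbhs_filter f.
apply/(@cvgrPdist_lt R (buc R) (buc R) (nbhs f) FF (shift t) (shift t f)) => e e0.
have /cvgrPdist_lt/(_ _ e0) : id @ f --> f by exact: cvg_id.
by apply: filterS => g; rewrite shiftB; apply: le_lt_trans (norm_shift _ _).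
Qed.

Lemma shift0 f : shift 0 f = f.
Proof. by apply: buc_ext => -[k x]; rewrite shiftE addr0. Qed.

Lemma shiftD s t f : shift (s + t) f = shift s (shift t f).
Proof. by apply: buc_ext => -[k x]; rewrite !shiftE addrA. Qed.

Lemma shift_equicontinuous f e : 0 < e -> exists2 r, 0 < r &
  forall s t, `|s - t| < r -> `|shift s f - shift t f| <= e.
Proof.
move=> e0; have [r r0 Hr] := buc_equicontinuous f e0.
exists r => // s t st; apply: norm_le => -[k x]; rewrite bucB !shiftE; apply: Hr.
by have -> : x + s - (x + t) = s - t by ring.
Qed.

Lemma shift_semigroup : C0_semigroup shift.
Proof.
split=> [t _|f|s t f _ _|f].
- by split; [exact: shift_linear|exact: shift_continuous].
- exact: shift0.
- exact: shiftD.
apply/cvgrPdist_le => e e0; have [r r0 Hr] := shift_equicontinuous f e0.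
near=> t; rewrite -[X in X - _]shift0; apply: Hr.
have t0 : 0 < t by near: t; exact: nbhs_right_gt.
by rewrite sub0r normrN gtr0_norm//; near: t; exact: nbhs_right_lt.
Unshelve. all: by end_near. Qed.

End shift.

Lemma generator_exists (R : realType) (E : normedModType R) (S : R -> E -> E) :
  exists (DA : set E) (A : E -> E), generator S DA A.
Proof.
pose DA := [set x : E | exists y : E, t^-1 *: (S t x - x) @[t --> 0^'+] --> y].
exists DA, (fun x => if pselect (DA x) is left h then sval (cid h) else 0).
move=> x y; case: pselect => [h|nh]; last by split=> [[]//|c]; case: nh; exists y.
case: cid => z /= cz; split=> [[_ <-]//|cy]; split=> //.
exact: (cvg_unique (@norm_hausdorff _ E) cz cy).
Qed.

(** * The direction of the noise *)

Section tent.
Context {R : realType}.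
Implicit Types (u v x y : R) (K N : nat).

Definition clamp u : R := Num.max 0 (Num.min 1 u).

Lemma clamp_ge0 u : 0 <= clamp u. Proof. by rewrite /clamp le_max lexx. Qed.

Lemma clamp_le1 u : clamp u <= 1.
Proof. by rewrite /clamp ge_max ler01 ge_min lexx. Qed.

Lemma clamp_lo u : u <= 0 -> clamp u = 0.
Proof. by move=> u0; apply/max_idPl; rewrite ge_min u0 orbT. Qed.

Lemma clamp_hi u : 1 <= u -> clamp u = 1.
Proof. by move=> u1; rewrite /clamp; move/min_idPl: u1 => ->; apply/max_idPr. Qed.

Lemma clamp_mid u : 0 <= u -> u <= 1 -> clamp u = u.
Proof. by move=> u0 u1; rewrite /clamp; move/min_idPr: u1 => ->; apply/max_idPr. Qed.

Lemma clamp_mono u v : u <= v -> clamp u <= clamp v.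
Proof.
move=> uv; have [u0|u0] := leP u 0; first by rewrite clamp_lo// clamp_ge0.
have [v1|v1] := leP 1 v; first by rewrite [leRHS]clamp_hi// clamp_le1.
by rewrite !clamp_mid//; lra.
Qed.

Lemma clamp_lipschitz u v : u <= v -> clamp v - clamp u <= v - u.
Proof.
move=> uv; have [v0|v0] := leP v 0.
  by rewrite !clamp_lo//; lra.
have [u1|u1] := leP 1 u; first by rewrite !clamp_hi//; lra.
have [u0|u0] := leP u 0.
  rewrite (clamp_lo u0); have [v1|v1] := leP 1 v; first by rewrite clamp_hi//; lra.
  by rewrite clamp_mid//; lra.
rewrite [clamp u]clamp_mid//; try lra.
have [v1|v1] := leP 1 v; first by rewrite clamp_hi//; lra.
by rewrite clamp_mid//; lra.
Qed.

Lemma clamp_dist u v : `|clamp u - clamp v| <= `|u - v|.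
Proof.
have [uv|/ltW vu] := leP u v.
  rewrite distrC [leRHS]distrC !ger0_norm ?subr_ge0 ?clamp_mono//.
  exact: clamp_lipschitz.
by rewrite !ger0_norm ?subr_ge0 ?clamp_mono//; exact: clamp_lipschitz.
Qed.

Definition monotone_seq (a : nat -> R) : Prop :=
  (forall j, a j <= a j.+1) \/ (forall j, a j.+1 <= a j).

Lemma clamp_variation (a : nat -> R) N : monotone_seq a ->
  \sum_(0 <= j < N) `|clamp (a j.+1) - clamp (a j)| <= 1.
Proof.
case=> aS.
  under eq_bigr => j _ do rewrite ger0_norm ?subr_ge0 ?clamp_mono//.
  rewrite telescope_sumr//; have := clamp_le1 (a N); have := clamp_ge0 (a 0%N); lra.
under eq_bigr => j _ do rewrite distrC ger0_norm ?subr_ge0 ?clamp_mono// -opprB.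
rewrite sumrN telescope_sumr//; have := clamp_ge0 (a N); have := clamp_le1 (a 0%N); lra.
Qed.

(** As a difference of two monotone functions with values in [0, 1], a tent has variation at most 2
    along any monotone sequence, and its translates by multiples of its half-width 2^-K
    telescope. *)
Definition tent K y : R := clamp (2 ^+ K * y + 1) - clamp (2 ^+ K * y).

Lemma pow2_gt0 K : 0 < (2 : R) ^+ K. Proof. exact: exprn_gt0. Qed.

Lemma tent_ge0 K y : 0 <= tent K y.
Proof. by rewrite subr_ge0 clamp_mono// lerDl. Qed.

Lemma tent_le1 K y : tent K y <= 1.
Proof. by rewrite /tent; have := clamp_le1 (2 ^+ K * y + 1); have := clamp_ge0 (2 ^+ K * y); lra. Qed.

Lemma tent_eq0 K y : 2^-1 ^+ K <= `|y| -> tent K y = 0.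
Proof.
have p0 := pow2_gt0 K; rewrite exprVn => h.
have {h} : 1 <= `|2 ^+ K * y|.
  by rewrite normrM gtr0_norm// -ler_pdivrMl// mulr1.
rewrite /tent; move: (2 ^+ K * y) => z; rewrite ler_normr => /orP[z1|z1].
  by rewrite !clamp_hi ?subrr//; lra.
by rewrite !clamp_lo ?subrr//; lra.
Qed.

Lemma tent0 K : tent K 0 = 1.
Proof. by rewrite /tent mulr0 add0r clamp_hi// clamp_lo// subr0. Qed.

Lemma tent_lipschitz K x y : `|tent K x - tent K y| <= 2 * 2 ^+ K * `|x - y|.
Proof.
have -> : tent K x - tent K y = (clamp (2 ^+ K * x + 1) - clamp (2 ^+ K * y + 1))
  - (clamp (2 ^+ K * x) - clamp (2 ^+ K * y)) by rewrite /tent; ring.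
apply: le_trans (ler_normB _ _) _; apply: le_trans (lerD (clamp_dist _ _) (clamp_dist _ _)) _.
have -> : 2 ^+ K * x + 1 - (2 ^+ K * y + 1) = 2 ^+ K * (x - y) by ring.
rewrite -mulrBr normrM ger0_norm ?(ltW (pow2_gt0 _))//.
by rewrite le_eqVlt; apply/orP; left; apply/eqP; ring.
Qed.

Lemma tent_variation K (a : nat -> R) N : monotone_seq a ->
  \sum_(0 <= j < N) `|tent K (a j.+1) - tent K (a j)| <= 2.
Proof.
move=> am; have p0 := pow2_gt0 K.
have am1 : monotone_seq (fun j => 2 ^+ K * a j + 1).
  by case: am => aS; [left|right] => j; rewrite lerD2r ler_pM2l.
have am2 : monotone_seq (fun j => 2 ^+ K * a j).
  by case: am => aS; [left|right] => j; rewrite ler_pM2l.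
apply: (@le_trans _ _ (\sum_(0 <= j < N) (`|clamp (2 ^+ K * a j.+1 + 1) - clamp (2 ^+ K * a j + 1)|
  + `|clamp (2 ^+ K * a j.+1) - clamp (2 ^+ K * a j)|))).
  apply: ler_sum => j _; apply: le_trans (ler_normB _ _).
  by rewrite le_eqVlt; apply/orP; left; apply/eqP; congr `|_|; rewrite /tent; ring.
rewrite big_split/=; have := clamp_variation N am1; have := clamp_variation N am2; lra.
Qed.

(* Shifted copies of the tent at the spacing of its width form a partition of unity. *)
Lemma tent_partition K (alpha sigma : R) N : sigma = 1 \/ sigma = -1 ->
  \sum_(0 <= j < N) tent K (alpha + sigma * (j%:R * 2^-1 ^+ K)) <= 1.
Proof.
have e1 : (2 : R) ^+ K * 2^-1 ^+ K = 1 by rewrite -exprMn mulfV// expr1n.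
case=> ->.
  rewrite (eq_bigr (fun j => clamp (2 ^+ K * alpha + j.+1%:R) - clamp (2 ^+ K * alpha + j%:R))).
    rewrite (telescope_sumr (fun j => clamp (2 ^+ K * alpha + j%:R)))//.
    have := clamp_le1 (2 ^+ K * alpha + N%:R); have := clamp_ge0 (2 ^+ K * alpha + 0%:R); lra.
  move=> j _; rewrite /tent mul1r mulrDr mulrCA e1 mulr1 -[j.+1%:R]natr1.
  by congr (clamp _ - clamp _); ring.
rewrite (eq_bigr (fun j => - (clamp (2 ^+ K * alpha + 1 - j.+1%:R) - clamp (2 ^+ K * alpha + 1 - j%:R)))).
  rewrite sumrN (telescope_sumr (fun j => clamp (2 ^+ K * alpha + 1 - j%:R)))//.
  have := clamp_ge0 (2 ^+ K * alpha + 1 - N%:R); have := clamp_le1 (2 ^+ K * alpha + 1 - 0%:R); lra.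
move=> j _; rewrite /tent opprB mulN1r mulrBr mulrCA e1 mulr1 -[j.+1%:R]natr1.
by congr (clamp _ - clamp _); ring.
Qed.

End tent.

Section bump.
Context {R : realType}.
Implicit Types (x y : R) (m j : nat) (eps : nat -> bool).

(* [rho ^ 11 <= 1 / 4], and the supports of the tents of a bump are disjoint. *)
Definition level m : nat := (11 * m).+1.

Definition sgn eps j : R := if eps j then 1 else -1.

Definition spike m j : R := j.+1%:R / 4 ^+ m.

Definition bump m eps x : R :=
  2^-1 ^+ m * \sum_(0 <= j < 4 ^ m) sgn eps j * tent (level m) (x - spike m j).

Lemma sgn_norm eps j : `|sgn eps j| = 1.
Proof. by rewrite /sgn; case: ifP; rewrite ?normrN normr1. Qed.

Lemma spike_sep m i j : i != j -> 4^-1 ^+ m <= `|spike m i - spike m j|.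
Proof.
move=> ij; have p0 : 0 < (4 : R) ^+ m by rewrite exprn_gt0.
rewrite /spike -mulrBl normrM [`|_^-1|]gtr0_norm ?invr_gt0// exprVn -[leLHS]mul1r ler_pM2r ?invr_gt0//.
have [lt|lt|e] := ltngtP i j; last by rewrite e eqxx in ij.
  rewrite distrC -natrB; last by rewrite ltnS ltnW.
  by rewrite normr_nat ler1n subn_gt0 ltnS.
rewrite -natrB; last by rewrite ltnS ltnW.
by rewrite normr_nat ler1n subn_gt0 ltnS.
Qed.

Lemma level_small m : 2 * (2^-1 : R) ^+ level m <= 4^-1 ^+ m.
Proof.
rewrite /level exprS mulrA mulfV// mul1r mulnC exprM.
have -> : (4 : R)^-1 = 2^-1 ^+ 2 by rewrite expr2 -invfM -natrM.
rewrite -!exprM ler_wiXn2l ?invr_ge0 ?invf_le1 ?ler1n//.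
by rewrite mulnC leq_mul2l orbT.
Qed.

(** The centres are at least 4^-m apart and the half-widths are at most half of that, so at most one
    tent is nonzero at x. *)
Lemma bump_tents_le1 m x : \sum_(0 <= j < 4 ^ m) tent (level m) (x - spike m j) <= 1.
Proof.
rewrite big_mkord.
have [[i it]|no] := pselect (exists i : 'I_(4 ^ m), tent (level m) (x - spike m i) != 0).
  rewrite (bigD1 i)//= big1 ?addr0 ?tent_le1// => j ji.
  apply/eqP/negPn/negP => jt.
  have near k : tent (level m) (x - spike m k) != 0 -> `|x - spike m k| < 2^-1 ^+ level m.
    by move=> kt; rewrite ltNge; apply: contra kt => /tent_eq0 ->.
  have ij : (i : nat) != j by rewrite eq_sym.
  have := spike_sep m ij; have := level_small m.
  have := near _ it; have := near _ jt.
  have : `|spike m i - spike m j| <= `|x - spike m j| + `|x - spike m i|.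
    have -> : spike m i - spike m j = (x - spike m j) - (x - spike m i) by ring.
    exact: ler_normB.
  lra.
rewrite big1 ?ler01// => j _; apply/eqP/negPn/negP => jt; apply: no; by exists j.
Qed.

Lemma bump_le m eps x : `|bump m eps x| <= 2^-1 ^+ m.
Proof.
have h0 : 0 <= (2^-1 : R) ^+ m by rewrite exprn_ge0// invr_ge0.
rewrite /bump normrM ger0_norm// -[leRHS]mulr1; apply: ler_wpM2l => //.
apply: le_trans (ler_norm_sum _ _ _) _; apply: le_trans (bump_tents_le1 m x).
by apply: ler_sum => j _; rewrite normrM sgn_norm mul1r ger0_norm ?tent_ge0.
Qed.

Lemma bump_lipschitz m eps x y :
  `|bump m eps x - bump m eps y| <= 4 ^+ m * (2 * 2 ^+ level m) * `|x - y|.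
Proof.
rewrite /bump -mulrBr -sumrB normrM ger0_norm ?exprn_ge0 ?invr_ge0//.
apply: (@le_trans _ _ (1 * \sum_(0 <= j < 4 ^ m) 2 * 2 ^+ level m * `|x - y|)).
  apply: ler_pM => //; rewrite ?exprn_ge0 ?invr_ge0//.
    by rewrite exprn_ile1 ?invr_ge0// invf_le1// ler1n.
  apply: le_trans (ler_norm_sum _ _ _) _; apply: ler_sum => j _.
  rewrite -mulrBr normrM sgn_norm mul1r; apply: le_trans (tent_lipschitz _ _ _) _.
  by have -> : x - spike m j - (y - spike m j) = x - y by ring.
by rewrite mul1r sumr_const_nat subn0 -[_ *+ _]mulr_natl natrX mulrA.
Qed.

Lemma bump_spike m eps i : (i < 4 ^ m)%N -> bump m eps (spike m i) = 2^-1 ^+ m * sgn eps i.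
Proof.
move=> im; rewrite /bump big_mkord (bigD1 (Ordinal im))//= subrr tent0 mulr1.
rewrite big1 ?addr0// => j ji; rewrite tent_eq0 ?mulr0//.
have ij : i != j by rewrite eq_sym.
by apply: le_trans (spike_sep m ij); apply: le_trans (level_small m); rewrite ler_peMl ?ler1n// exprn_ge0// invr_ge0.
Qed.

(** The predicate selects the components that are kept, so that one membership proof covers [phi]
    and its truncations. *)
Definition bumps (p : pred nat) (z : domain R) : R^o :=
  if p z.1.1 then bump z.1.1 z.1.2 z.2 else 0.

(** For large m the heights 2^-m are below the tolerance; the finitely many remaining m are
    Lipschitz with a common constant, uniformly in the signs. *)
Lemma bumps_in p : bumps p \in @buc_pred R.
Proof.
apply/buc_predP; split.
  exists 1 => -[[m eps] x]; rewrite /bumps/=; case: ifP => _; last by rewrite normr0.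
  apply: le_trans (bump_le _ _ _) _.
  by rewrite exprn_ile1 ?invr_ge0// invf_le1// ler1n.
move=> e e0.
have [M HM] : exists M, forall m, (M <= m)%N -> 2 * (2^-1 : R) ^+ m <= e.
  have : 2 * (2^-1 : R) ^+ n @[n --> \oo] --> (0 : R) by apply: scaled_cvg0; exact: half_pow_cvg0.
  by move=> /cvgr_lt/(_ _ e0)[n _ H]; exists n => m nm; apply: ltW; exact: H.
pose D : R := 4 ^+ M * (2 * 2 ^+ level M).
have D0 : 0 < D by rewrite !mulr_gt0// exprn_gt0.
exists (e / D); first by rewrite divr_gt0.
move=> [m eps] x y xy; rewrite /bumps/=; case: ifP => _; last by rewrite subrr normr0 ltW.
have [mM|mM] := leqP M m.
  apply: le_trans (ler_normB _ _) _; apply: le_trans (lerD (bump_le _ _ _) (bump_le _ _ _)) _.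
  by have := HM m mM; move: (2^-1 ^+ m : R) => z; lra.
apply: le_trans (bump_lipschitz _ _ _ _) _.
apply: (@le_trans _ _ (D * `|x - y|)).
  apply: ler_wpM2r => //; apply: ler_pM.
  - by rewrite exprn_ge0.
  - by rewrite mulr_ge0// exprn_ge0.
  - by rewrite ler_weXn2l// ?ler1n// ltnW.
  - rewrite ler_pM2l// ler_weXn2l// ?ler1n// ltnS leq_mul2l ltnW//.
by rewrite mulrC -ler_pdivlMr// ltW.
Qed.

Definition phi_on p : buc R := Buc (bumps_in p).

Definition phi : buc R := phi_on predT.

(** Riemann sums of [phi] itself could sample the narrow tents of high components at their peaks,
    just as the splitting scheme does. Keeping only the components below M allows a mesh that
    resolves every tent present. *)
Definition phi_below M : buc R := phi_on [pred m | (m < M)%N].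

Lemma phi_belowP M : `|phi - phi_below M| <= 2^-1 ^+ M.
Proof.
apply: norm_le => -[[m eps] x]; rewrite bucB /phi /phi_below /= /bumps/=.
case: ltnP => mM; first by rewrite subrr normr0 exprn_ge0// invr_ge0.
rewrite subr0; apply: le_trans (bump_le _ _ _) _.
by rewrite ler_wiXn2l ?invr_ge0// invf_le1// ler1n.
Qed.

End bump.

(** * Pathwise integrals *)

Section path_integral.
Context {R : realType}.
Variables (B : R -> R) (C t : R).
Hypotheses (C0 : 0 <= C) (t01 : 0 <= t <= 1).
Hypothesis HB : forall (K : nat) (r s : R), 0 <= r <= 1 -> 0 <= s <= 1 -> `|s - r| <= 2^-1 ^+ K ->
  `|B s - B r| <= C * rho ^+ K.
Implicit Types (psi : R -> R) (K N j : nat).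

Definition dyad K j : R := j%:R * 2^-1 ^+ K.

(** Increments of the path stopped at t, so that the same dyadic grid of [0, 1] serves all t. *)
Definition dB K j : R := B (Num.min (dyad K j.+1) t) - B (Num.min (dyad K j) t).

Definition pint K psi : R := \sum_(0 <= j < 2 ^ K) dB K j * psi (dyad K j).

Lemma dyad_ge0 K j : 0 <= dyad K j.
Proof. by rewrite mulr_ge0// exprn_ge0// invr_ge0. Qed.

Lemma dyad_double K j : dyad K.+1 j.*2 = dyad K j.
Proof. by rewrite /dyad -muln2 natrM exprS; field. Qed.

Lemma dyadS K j : dyad K j.+1 = dyad K j + 2^-1 ^+ K.
Proof. by rewrite /dyad -[j.+1%:R]natr1 mulrDl mul1r. Qed.

Lemma dB_le K j : `|dB K j| <= C * rho ^+ K.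
Proof.
have /andP[t0 t1] := t01; have h0 : 0 < (2^-1 : R) ^+ K by rewrite exprn_gt0// invr_gt0.
have mem i : 0 <= Num.min (dyad K i) t <= 1.
  by rewrite le_min dyad_ge0 t0/= ge_min t1 orbT.
apply: HB => //; rewrite dyadS; move: (dyad K j) h0 => r; move: (2^-1 ^+ K) => h h0.
have [tr|rt] := leP t r; have [trh|rht] := leP t (r + h).
- by rewrite subrr normr0 ltW.
- by rewrite ger0_norm; lra.
- by rewrite ger0_norm; lra.
- by rewrite addrC addKr ger0_norm// ltW.
Qed.

Lemma dB_split K j : dB K j = dB K.+1 j.*2 + dB K.+1 j.*2.+1.
Proof. by rewrite /dB -doubleS !dyad_double; ring. Qed.

(** Refinement changes the sample of psi only on the right halves of the cells, by an increment of
    psi times an increment of B. The total is at most the modulus of B times the variation of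
    psi. *)
Lemma pint_step K psi V :
  \sum_(0 <= j < 2 ^ K.+1) `|psi (dyad K.+1 j.+1) - psi (dyad K.+1 j)| <= V ->
  `|pint K.+1 psi - pint K psi| <= C * rho ^+ K.+1 * V.
Proof.
have q0 : 0 <= C * rho ^+ K.+1 by rewrite mulr_ge0// exprn_ge0// rho_ge0.
move=> HV; rewrite /pint expnS mul2n sum_double -sumrB.
apply: le_trans (ler_norm_sum _ _ _) _.
apply: (@le_trans _ _ (\sum_(0 <= j < 2 ^ K) C * rho ^+ K.+1 *
   `|psi (dyad K.+1 j.*2.+1) - psi (dyad K.+1 j.*2)|)).
  apply: ler_sum => j _.
  rewrite (dB_split K j) -(dyad_double K j).
  have E (a b x y : R) : a * x + b * y - (a + b) * x = b * (y - x) by ring.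
  rewrite E.
  by rewrite normrM; apply: ler_wpM2r => //; exact: dB_le.
rewrite -mulr_sumr; apply: ler_wpM2l => //; apply: le_trans HV.
rewrite expnS mul2n sum_double; apply: ler_sum => j _.
by rewrite lerDl.
Qed.

Lemma pint_le K psi V : \sum_(0 <= j < 2 ^ K) `|psi (dyad K j)| <= V ->
  `|pint K psi| <= C * rho ^+ K * V.
Proof.
have q0 : 0 <= C * rho ^+ K by rewrite mulr_ge0// exprn_ge0// rho_ge0.
move=> HV; apply: le_trans (ler_norm_sum _ _ _) _.
apply: (@le_trans _ _ (C * rho ^+ K * \sum_(0 <= j < 2 ^ K) `|psi (dyad K j)|)); last exact: ler_wpM2l.
rewrite mulr_sumr; apply: ler_sum => j _; rewrite normrM.
by apply: ler_wpM2r => //; exact: dB_le.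
Qed.

Variables (alpha sigma : R).
Hypothesis sigma1 : sigma = 1 \/ sigma = -1.
Local Notation tau r := (alpha + sigma * r).

Lemma monotone_dyad K x : monotone_seq (fun j => tau (dyad K j) + x).
Proof.
have h0 : 0 < (2^-1 : R) ^+ K by rewrite exprn_gt0// invr_gt0.
by case: sigma1 => ->; [left|right] => j; rewrite dyadS; lra.
Qed.

Lemma tent_pint_step K0 K x :
  `|pint K.+1 (fun r => tent K0 (tau r + x)) - pint K (fun r => tent K0 (tau r + x))| <=
  2 * C * rho ^+ K.+1.
Proof.
have -> : 2 * C * rho ^+ K.+1 = C * rho ^+ K.+1 * 2 by ring.
by apply: pint_step; apply: tent_variation; exact: monotone_dyad.
Qed.

(** At mesh equal to the half-width the samples of the tent belong to a partition of unity, so their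
    sum is at most 1. *)
Lemma tent_pint_le K x : `|pint K (fun r => tent K (tau r + x))| <= C * rho ^+ K.
Proof.
rewrite -[leRHS]mulr1; apply: pint_le.
under eq_bigr => j _ do rewrite ger0_norm ?tent_ge0// addrAC.
exact: tent_partition.
Qed.

Lemma tent_pint_dist K0 K k x :
  `|pint (K + k) (fun r => tent K0 (tau r + x)) - pint K (fun r => tent K0 (tau r + x))| <=
  14 * C * rho ^+ K.
Proof.
have q0 := @rho_ge0 R.
(* The constant 14 is 2 rho / (1 - rho); subtracting the tail of the geometric series makes the
   bound inductive. *)
suff : `|pint (K + k) (fun r => tent K0 (tau r + x)) - pint K (fun r => tent K0 (tau r + x))| <=
   14 * C * rho ^+ K - 14 * C * rho ^+ (K + k).
  by move/le_trans; apply; rewrite gerBl !mulr_ge0// exprn_ge0.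
elim: k => [|k IH]; first by rewrite addn0 !subrr normr0.
rewrite addnS; set u := pint _ _; set v := pint K _; move: IH; set w := pint _ _ => IH.
have -> : u - v = (u - w) + (w - v) by ring.
apply: le_trans (ler_normD _ _) _; apply: le_trans (lerD (tent_pint_step _ _ _) IH) _.
rewrite exprS; move: (rho ^+ (K + k)) (rho ^+ K) => a b.
by rewrite le_eqVlt; apply/orP; left; apply/eqP; rewrite /rho; field.
Qed.

Lemma pint_sum K (I : Type) (s : seq I) (c : I -> R) (F : I -> R -> R) :
  pint K (fun r => \sum_(i <- s) c i * F i r) = \sum_(i <- s) c i * pint K (F i).
Proof.
rewrite /pint; under eq_bigr => j _ do rewrite mulr_sumr.
rewrite exchange_big/=; apply: eq_bigr => i _; rewrite mulr_sumr.
by apply: eq_bigr => j _; rewrite mulrCA.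
Qed.

Lemma bump_pint m eps K x : pint K (fun r => bump m eps (tau r + x)) =
  \sum_(0 <= j < 4 ^ m) (2^-1 ^+ m * sgn eps j) * pint K (fun r => tent (level m) (tau r + (x - spike m j))).
Proof.
rewrite -pint_sum; apply: eq_bigr => j _; congr (_ * _).
rewrite /bump mulr_sumr; apply: eq_bigr => i _.
by rewrite mulrA addrA.
Qed.

(** There are 4^m terms of weight 2^-m. Taking absolute values gives the factor 2^m, the price of a
    bound that holds for all signs at once. *)
Lemma sum_sgn_le m eps (F : nat -> R) D : (forall j, `|F j| <= D) ->
  `|\sum_(0 <= j < 4 ^ m) (2^-1 ^+ m * sgn eps j) * F j| <= 2 ^+ m * D.
Proof.
move=> HF; apply: le_trans (ler_norm_sum _ _ _) _.
apply: (@le_trans _ _ (\sum_(0 <= j < 4 ^ m) 2^-1 ^+ m * D)).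
  apply: ler_sum => j _; rewrite !normrM sgn_norm mulr1 ger0_norm ?exprn_ge0 ?invr_ge0//.
  by apply: ler_wpM2l; rewrite ?exprn_ge0 ?invr_ge0.
rewrite sumr_const_nat subn0 -[_ *+ _]mulr_natl natrX mulrA -exprMn.
by rewrite (_ : 4 * 2^-1 = 2 :> R)//; field.
Qed.

Lemma bump_pint_dist m eps K k x :
  `|pint (K + k) (fun r => bump m eps (tau r + x)) - pint K (fun r => bump m eps (tau r + x))| <=
  2 ^+ m * (14 * C * rho ^+ K).
Proof.
rewrite !bump_pint -sumrB.
under eq_bigr => j _ do rewrite -mulrBr.
by apply: sum_sgn_le => j; exact: tent_pint_dist.
Qed.

Lemma bump_pint_le m eps k x :
  `|pint (level m + k) (fun r => bump m eps (tau r + x))| <= 2 ^+ m * (15 * C * rho ^+ level m).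
Proof.
rewrite bump_pint; apply: sum_sgn_le => j; set F := fun r => _.
have -> : pint (level m + k) F = (pint (level m + k) F - pint (level m) F) + pint (level m) F by rewrite subrK.
apply: le_trans (ler_normD _ _) _.
apply: le_trans (lerD (tent_pint_dist _ _ _ _) (tent_pint_le _ _)) _.
by rewrite le_eqVlt; apply/orP; left; apply/eqP; ring.
Qed.

(** The exponent 11 is the least one that works: a decay of 4^-m turns the factor 2^m of
    [sum_sgn_le] into 2^-m. *)
Lemma rho_pow11 : rho ^+ 11 <= 4^-1 :> R.
Proof.
have q0 := @rho_ge0 R; have qE : rho = 7 / 8 :> R by [].
have e2 : rho ^+ 2 <= 77 / 100 :> R by rewrite qE expr2; lra.
have e4 : rho ^+ 4 <= 6 / 10 :> R.
  rewrite (exprM _ 2 2); apply: (@le_trans _ _ ((77 / 100) ^+ 2)); last by rewrite expr2; lra.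
  by apply: lerXn2r => //; rewrite nnegrE ?exprn_ge0//; lra.
have e8 : rho ^+ 8 <= 36 / 100 :> R.
  rewrite (exprM _ 4 2); apply: (@le_trans _ _ ((6 / 10) ^+ 2)); last by rewrite expr2; lra.
  by apply: lerXn2r => //; rewrite nnegrE ?exprn_ge0//; lra.
have -> : rho ^+ 11 = rho ^+ 8 * (rho ^+ 2 * rho) :> R by rewrite -exprSr -exprD.
apply: (@le_trans _ _ (36 / 100 * (77 / 100 * (7 / 8)))); last by lra.
by apply: ler_pM; rewrite ?mulr_ge0 ?exprn_ge0//; apply: ler_pM; rewrite ?exprn_ge0.
Qed.

Lemma level_decay m i : (i <= m)%N -> 2 ^+ i * rho ^+ level m <= 2^-1 ^+ m :> R.
Proof.
move=> im; have q0 := @rho_ge0 R; have q1 := @rho_lt1 R.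
apply: (@le_trans _ _ (2 ^+ m * 4^-1 ^+ m)).
  apply: ler_pM; rewrite ?exprn_ge0//.
    by rewrite ler_weXn2l// ler1n.
  rewrite /level exprS; apply: (@le_trans _ _ (rho ^+ (11 * m))).
    by rewrite ler_piMl ?exprn_ge0// ltW.
  by rewrite exprM; apply: lerXn2r; rewrite ?nnegrE ?exprn_ge0 ?invr_ge0//; exact: rho_pow11.
have E : 2 * 4^-1 = 2^-1 :> R by field.
by rewrite -exprMn E.
Qed.

Definition Vsum m : buc R :=
  \sum_(0 <= j < 2 ^ level m) dB (level m) j *: shift (tau (dyad (level m) j)) (phi_below m).

Lemma VsumE m i eps x : Vsum m ((i, eps), x) =
  if (i < m)%N then pint (level m) (fun r => bump i eps (tau r + x)) else 0.
Proof.
rewrite /Vsum buc_sum; case: ltnP => im; last first.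
  by rewrite big1// => j _; rewrite bucZ shiftE /phi_below/= /bumps/= ltnNge im mulr0.
apply: eq_bigr => j _.
by rewrite bucZ shiftE /phi_below/= /bumps/= im addrC.
Qed.

(** Components below m only feel the refinement of the mesh by 11 dyadic levels; component m is new,
    and small because the new mesh resolves its tents; the others vanish in both sums. *)
Lemma Vsum_step m : `|Vsum m.+1 - Vsum m| <= 15 * C * 2^-1 ^+ m.
Proof.
have q0 := @rho_ge0 R.
have h0 : 0 <= 15 * C * (2^-1 : R) ^+ m by rewrite !mulr_ge0// exprn_ge0// invr_ge0.
have key i D : (i <= m)%N -> D <= 15 * C * rho ^+ level m -> 2 ^+ i * D <= 15 * C * 2^-1 ^+ m.
  move=> im DD; apply: (@le_trans _ _ (15 * C * (2 ^+ i * rho ^+ level m))).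
    by rewrite mulrCA; apply: ler_wpM2l => //; rewrite exprn_ge0.
  by apply: ler_wpM2l; rewrite ?mulr_ge0//; exact: level_decay.
have lS : level m.+1 = (level m + 11)%N by rewrite /level mulnS [(11 + _)%N]addnC.
apply: norm_le => -[[i eps] x]; rewrite bucB !VsumE ltnS.
case: (ltngtP i m) => im.
- rewrite lS; apply: le_trans (bump_pint_dist _ _ _ _ _) _; apply: key; first exact: ltnW.
  by rewrite ler_wpM2r ?exprn_ge0// ler_wpM2r// ler_nat.
- by rewrite subrr normr0.
rewrite subr0 im lS; apply: le_trans (bump_pint_le _ _ _ _) _; exact: key.
Qed.

Definition Vlim : buc R := lim (Vsum m @[m --> \oo]).

Lemma Vlim_approx : Vsum m @[m --> \oo] --> Vlim /\
  forall m, `|Vlim - Vsum m| <= 30 * C * 2^-1 ^+ m.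
Proof.
have [||m|c H] := @geometric_cauchy R (buc R) Vsum (15 * C) 2^-1.
- by rewrite invr_ge0.
- by rewrite invf_lt1// ltr1n.
- exact: Vsum_step.
split=> // m; apply: le_trans (H m) _.
by rewrite le_eqVlt; apply/orP; left; apply/eqP; field.
Qed.

(** The counterpart of the failure: component m of the true convolution is O(2^-m) uniformly in the
    signs, whereas the scheme with 4^m steps makes it of order 1 for suitable signs. *)
Lemma Vlim_spike m eps x : `|Vlim ((m, eps), x)| <= 15 * C * 2^-1 ^+ m.
Proof.
have q0 := @rho_ge0 R.
have [_ H] := Vlim_approx; apply/ler_addgt0Pr => e e0.
have : 30 * C * (2^-1 : R) ^+ n @[n --> \oo] --> (0 : R) by apply: scaled_cvg0; exact: half_pow_cvg0.
move=> /cvgr_lt/(_ _ e0)[n _ Hn]; pose k := maxn n m.+1.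
have := Hn k (leq_maxl _ _) => /= lt.
have -> : Vlim ((m, eps), x) = Vsum k ((m, eps), x) + (Vlim - Vsum k) ((m, eps), x).
  by rewrite bucB addrC subrK.
apply: le_trans (ler_normD _ _) _; apply: lerD; last first.
  by apply: le_trans (le_norm _ _) _; apply: le_trans (H k) _; exact: ltW.
have mk : (m < k)%N by rewrite leq_max ltnSn orbT.
rewrite VsumE mk; have lk : (level m <= level k)%N by rewrite ltnS leq_mul2l ltnW.
rewrite -(subnKC lk); apply: le_trans (bump_pint_le _ _ _ _) _.
apply: (@le_trans _ _ (15 * C * (2 ^+ m * rho ^+ level m))).
  by rewrite le_eqVlt; apply/orP; left; apply/eqP; ring.
by apply: ler_wpM2l; rewrite ?mulr_ge0//; exact: level_decay.
Qed.

End path_integral.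

(** * Borel and Radon random variables *)

Section borel_rv.
Context d (T : measurableType d) (R : realType) (E : normedModType R).
Implicit Types (X Y : T -> E).

Lemma borel_rv_open X : (forall O, open O -> measurable (X @^-1` O)) -> borel_rv X.
Proof.
move=> XO B; apply: (@smallest_sub _ (sigma_algebra setT) _ [set B | measurable (X @^-1` B)]) => //.
split=> [|A /= mA|F /= mF].
- by rewrite /= preimage_set0.
- by rewrite setTD preimage_setC; exact: measurableC.
- by rewrite preimage_bigcup; exact: bigcupT_measurable.
Qed.

Lemma open_borel (O : set E) : open O -> borel O.
Proof. by move=> oO; exact: sub_gen_smallest. Qed.

Lemma closed_borel (K : set E) : closed K -> borel K.
Proof.
move=> cK; rewrite -(setCK K) -setTD; apply: (@sigma_algebraCD _ setT).
by apply: sub_gen_smallest; exact: closed_openC.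
Qed.

(** The limit lies in the open set O exactly when, for some p, the sequence eventually stays in
    [G p], the points around which a ball of radius greater than 1/(p+1) fits into O. *)
Lemma borel_rv_lim (X_ : nat -> T -> E) X : (forall k, borel_rv (X_ k)) ->
  (forall w, X_ k w @[k --> \oo] --> X w) -> borel_rv X.
Proof.
move=> bX_ cX; apply: borel_rv_open => O oO.
pose G (p : nat) : set E := [set x | exists2 r, p.+1%:R^-1 < r & ball x r `<=` O].
have oG p : open (G p).
  rewrite openE => x [r pr xO].
  pose s : R := (r - p.+1%:R^-1) / 2.
  have s0 : 0 < s by rewrite divr_gt0// subr_gt0.
  apply/nbhs_ballP; exists s => //= y xy; exists (r - s).
    by rewrite /s; move: pr; set u := p.+1%:R^-1; lra.
  move=> z yz; apply: xO; have := ball_triangle xy yz.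
  by rewrite addrC subrK.
have -> : X @^-1` O = \bigcup_p \bigcup_N \bigcap_(k in [set k | (N <= k)%N]) (X_ k @^-1` G p).
  apply/seteqP; split=> [w /= Ow|w [p _ [N _ H]]]; last first.
    have p0 : 0 < p.+1%:R^-1 :> R by rewrite invr_gt0.
    have /cvgrPdist_lt/(_ _ p0)[M _ HM] := cX w.
    pose k := maxn N M.
    have [r pr rO] := H k (leq_maxl _ _).
    apply: rO; rewrite -ball_normE/=; apply: lt_trans pr.
    by rewrite distrC; apply: HM; exact: leq_maxr.
  have /nbhs_ballP[r /= r0 rO] : nbhs (X w) O by apply: open_nbhs_nbhs.
  have r30 : 0 < r / 3 by rewrite divr_gt0.
  have [p _ Hp] := near_infty_natSinv_lt (PosNum r30).
  have /cvgrPdist_lt/(_ _ r30)[N _ HN] := cX w.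
  exists p => //; exists N => // k /= Nk; exists (r / 2).
    by have h : p.+1%:R^-1 < r / 3 := Hp p (leqnn _); move: h; set u := p.+1%:R^-1; lra.
  move=> z; rewrite -ball_normE/= => zk; apply: rO; rewrite -ball_normE/=.
  have -> : X w - z = (X w - X_ k w) + (X_ k w - z) by rewrite addrA subrK.
  apply: le_lt_trans (ler_normD _ _) _.
  by have := HN k Nk; rewrite /=; lra.
apply: bigcupT_measurable => p; apply: bigcupT_measurable => N.
by apply: bigcap_measurable => [|k _]; [exists N => /=|apply: bX_; exact: open_borel].
Qed.

(** [E] may be nonseparable, and then sums of Borel maps into it can fail to be Borel. Countably
    valued maps are stable under sums and approximate those that occur. *)
Definition countably_valued X : Prop := exists (c : T -> nat) (g : nat -> E),
  (forall n, measurable (c @^-1` [set n])) /\ forall w, X w = g (c w).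

Lemma countably_valued_borel X : countably_valued X -> borel_rv X.
Proof.
move=> [c [g [mc XE]]]; apply: borel_rv_open => O _.
have -> : X @^-1` O = \bigcup_(n in [set n | O (g n)]) c @^-1` [set n].
  apply/seteqP; split=> [w /=|w [n /= On cn]]; last by rewrite XE cn.
  by rewrite XE => Ow; exists (c w).
by apply: bigcup_measurable => n _; exact: mc.
Qed.

Lemma countably_valuedD X Y : countably_valued X -> countably_valued Y ->
  countably_valued (fun w => X w + Y w).
Proof.
move=> [c [g [mc XE]]] [c' [g' [mc' YE]]].
exists (fun w => pickle (c w, c' w)).
exists (fun n => if unpickle n is Some p then g p.1 + g' p.2 else 0).
split=> [n|w]; last by rewrite pickleK/= XE YE.
have -> : (fun w => pickle (c w, c' w)) @^-1` [set n] =
    \bigcup_i \bigcup_(j in [set j | pickle (i, j) = n]) (c @^-1` [set i] `&` c' @^-1` [set j]).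
  apply/seteqP; split=> [w /= cn|w [i _ [j /= <- [/= -> ->]]]//].
  by exists (c w) => //; exists (c' w).
by apply: bigcupT_measurable => i; apply: bigcup_measurable => j _; exact: measurableI.
Qed.

Lemma floor_approx (a : R) k : `|2^-1 ^+ k * (Num.floor (2 ^+ k * a))%:~R - a| <= 2^-1 ^+ k.
Proof.
have h0 := half_gt0 k (R := R); have e1 := half_mul k (R := R).
have /andP[l u] := floor_itv (2 ^+ k * a).
have -> : 2^-1 ^+ k * (Num.floor (2 ^+ k * a))%:~R - a = 2^-1 ^+ k * ((Num.floor (2 ^+ k * a))%:~R - 2 ^+ k * a).
  by rewrite mulrBr mulrA [2^-1 ^+ k * 2 ^+ k]mulrC e1 mul1r.
rewrite normrM gtr0_norm// ler_piMr ?(ltW h0)//.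
rewrite intrD in u; rewrite distrC ger0_norm ?subr_ge0//; lra.
Qed.

Lemma countably_valued_floor (a : T -> R) k v : measurable_fun setT a ->
  countably_valued (fun w => (2^-1 ^+ k * (Num.floor (2 ^+ k * a w))%:~R) *: v).
Proof.
move=> ma; exists (fun w => pickle (Num.floor (2 ^+ k * a w))).
exists (fun n => if unpickle n is Some z then (2^-1 ^+ k * (z : int)%:~R) *: v else 0).
split=> [n|w]; last by rewrite pickleK.
have [[z zn]|no] := pselect (exists z : int, pickle z = n); last first.
  by rewrite (_ : _ @^-1` _ = set0)//; apply/seteqP; split=> w //= wn; apply: no; exists (Num.floor (2 ^+ k * a w)).
have -> : (fun w => pickle (Num.floor (2 ^+ k * a w))) @^-1` [set n] =
    (fun w => 2 ^+ k * a w) @^-1` `[z%:~R, (z + 1)%:~R[.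
  apply/seteqP; split=> w /=; rewrite in_itv/= -zn => h.
    by rewrite -(pcan_inj pickleK h) floor_itv.
  by rewrite (floor_def h).
by apply: measurable_preimage; [exact: measurable_funM|exact: measurable_itv].
Qed.

(** Rounding the coefficients down to multiples of 2^-k gives countably valued maps, which converge
    pointwise. *)
Lemma borel_rv_lincomb (I : Type) (s : seq I) (a : I -> T -> R) (v : I -> E) :
  (forall i, measurable_fun setT (a i)) -> borel_rv (fun w => \sum_(i <- s) a i w *: v i).
Proof.
move=> ma.
apply: (borel_rv_lim (X_ := fun k w => \sum_(i <- s) (2^-1 ^+ k * (Num.floor (2 ^+ k * a i w))%:~R) *: v i)).
  move=> k; apply: countably_valued_borel; elim: s => [|i s IH].
    exists (fun=> 0%N), (fun=> 0); split=> [n|w]; last by rewrite big_nil.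
    by rewrite preimage_cst; case: ifP.
  under eq_fun do rewrite big_cons.
  by apply: countably_valuedD => //; exact: countably_valued_floor.
move=> w; elim: s => [|i s IH].
  by rewrite big_nil; under eq_fun do rewrite big_nil; exact: cvg_cst.
rewrite big_cons; under eq_fun do rewrite big_cons.
apply: cvgD => //; apply: cvgZr_tmp.
apply/cvgrPdist_le => e e0.
have : (2^-1 : R) ^+ k @[k --> \oo] --> (0 : R) by exact: half_pow_cvg0.
move=> /cvgr_lt/(_ _ e0); apply: filterS => k /ltW; apply: le_trans.
by rewrite distrC floor_approx.
Qed.

Lemma borel_rv_norm X : borel_rv X -> measurable_fun setT (fun w => `|X w|).
Proof.
move=> bX; move=> mD; apply: (measurability _ (RGenOInfty.measurableE R)) => // _ [_ [r ->] <-].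
rewrite setTI (_ : _ @^-1` _ = X @^-1` [set x | r < `|x|]).
  apply: bX; apply: open_borel.
  have := @open_comp _ _ (fun x : E => `|x|) `]r, +oo[%classic.
  rewrite (_ : _ @^-1` _ = [set x | r < `|x|]); last by apply/seteqP; split=> x /=; rewrite in_itv/= andbT.
  by apply; [move=> x _; exact: norm_continuous|exact: interval_open].
by apply/seteqP; split=> w /=; rewrite in_itv/= andbT.
Qed.

End borel_rv.

Section gaussian_radon.
Context {R : realType}.
Local Notation mu := (@lebesgue_measure R).

Lemma gaussian_le_lebesgue (D : set (measurableTypeR R)) : measurable D ->
  (gaussian D <= (normal_peak 1)%:E * mu D)%E.
Proof.
move=> mD; have n10 : 1 != 0 :> R by rewrite oner_neq0.
rewrite -integral_cst//; apply: ge0_le_integral => //.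
- by move=> x _; rewrite lee_fin normal_pdf_ge0.
- by apply/measurable_EFinP; apply: measurable_funTS; exact: measurable_normal_pdf.
- by move=> x _; rewrite lee_fin normal_pdf_ub.
Qed.

(** Outside a large interval the normal law has little mass; inside, its bounded density transfers
    the inner regularity of Lebesgue measure. *)
Lemma gaussian_inner_regular (D : set (measurableTypeR R)) (e : R) : measurable D -> 0 < e ->
  exists V : set R, [/\ compact V, V `<=` D & (gaussian (D `\` V) < e%:E)%E].
Proof.
move=> mD e0; have e20 : 0 < e / 2 by rewrite divr_gt0.
pose O n : set (measurableTypeR R) := ~` `[- n%:R, n%:R]%classic.
have mO n : measurable (O n) by apply: measurableC; exact: measurable_itv.
have : gaussian (O n) @[n --> \oo] --> gaussian (\bigcap_n O n : set (measurableTypeR R)).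
  apply: nonincreasing_cvg_mu => //.
  - by apply: le_lt_trans (probability_le1 _ (mO 0%N)) _; rewrite ltry.
  - exact: bigcapT_measurable.
  - move=> n m nm; apply/subsetPset => x; apply: contra_not; rewrite /= !in_itv/= => /andP[h1 h2].
    have nm' : n%:R <= m%:R :> R by rewrite ler_nat.
    by rewrite (le_trans _ h1) ?(le_trans h2)// lerN2.
rewrite (_ : \bigcap_n O n = set0) ?measure0; last first.
  apply/seteqP; split=> x // h; apply: (h (Num.truncn `|x|).+1 I).
  by rewrite /= in_itv/= -ler_norml ltW// truncnS_gt.
move=> /cvge0_near/(_ e20)[n _ Hn]; have {Hn} On := Hn n (leqnn _).
pose D' : set (measurableTypeR R) := D `&` `[- n%:R, n%:R]%classic.
have mD' : measurable D' by apply: measurableI => //; exact: measurable_itv.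
have fD' : (mu D' < +oo)%E.
  apply: (@le_lt_trans _ _ (mu `[- n%:R, n%:R]%classic)).
    by apply: le_measure; rewrite ?inE//; exact: subIsetr.
  by rewrite lebesgue_measure_itv/=; case: ifP => _; rewrite -?EFinB ltry.
have p0 : 0 < normal_peak 1 :> R by rewrite normal_peak_gt0// oner_neq0.
have [V [cV VD hV]] := lebesgue_regularity_inner mD' fD' (divr_gt0 e20 p0).
exists V; split=> //; first by move=> x /VD[].
have mV : measurable (V : set (measurableTypeR R)) by exact: compact_measurable.
have mDV : measurable (D' `\` V) by exact: measurableD.
apply: (@le_lt_trans _ _ (gaussian (D' `\` V) + gaussian (O n))%E).
  apply: le_trans (measureU2 _ _ _) => //; apply: le_measure; rewrite ?inE.
  - exact: measurableD.
  - exact: measurableU.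
  move=> x [Dx Vx]; have [xn|xn] := pselect (`[- n%:R, n%:R]%classic x); last by right.
  by left.
rewrite (splitr e) EFinD; apply: lteD => //.
apply: le_lt_trans (gaussian_le_lebesgue mDV) _.
by rewrite -lte_pdivlMl// -EFinM mulrC.
Qed.

Lemma gaussian_small_ball (c : R) : 0 <= c ->
  (gaussian [set x : measurableTypeR R | (`|x| < c)%R] <= (2 * normal_peak 1 * c)%:E)%E.
Proof.
move=> c0; have -> : [set x : measurableTypeR R | (`|x| < c)%R] = `]- c, c[%classic.
  by apply/seteqP; split=> x /=; rewrite in_itv/= ltr_norml.
apply: le_trans (gaussian_le_lebesgue _) _; first exact: measurable_itv.
rewrite lebesgue_measure_itv/= lte_fin; case: ifPn => _.
  by rewrite -EFinB -EFinM lee_fin; lra.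
by rewrite mule0 lee_fin !mulr_ge0// normal_peak_ge0.
Qed.

(** The law is carried by a line: the compact sets are images of compact sets of reals under r |->
    (s r) v. *)
Lemma scaled_law_radon d (T : measurableType d) (P : probability T R) (E : normedModType R)
    (b : T -> R) (s : R) (v : E) : measurable_fun setT b ->
  (forall A, measurable A -> P (b @^-1` A) = gauss_law s A) ->
  radon_rv P (fun w => b w *: v).
Proof.
move=> mb lb; split.
  have := @borel_rv_lincomb _ _ _ E unit [:: tt] (fun=> b) (fun=> v) (fun=> mb).
  by under eq_fun do rewrite big_seq1.
move=> B e bB e0.
have bid : borel_rv (fun r : R => r *: v).
  have := @borel_rv_lincomb _ R R E unit [:: tt] (fun=> id) (fun=> v) (fun=> @measurable_id _ _ _).
  by under eq_fun do rewrite big_seq1.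
pose D : set R := (fun r => r *: v) @^-1` B.
have mD : measurable D by exact: bid.
have mD' : measurable ((fun r : measurableTypeR R => s * r) @^-1` D : set (measurableTypeR R)).
  exact: (measurable_preimage (measurable_scale s) mD).
have [V [cV VD hV]] := gaussian_inner_regular mD' e0.
have mV : measurable (V : set (measurableTypeR R)) by exact: compact_measurable.
pose K : set E := (fun r => (s * r) *: v) @` V.
have cK : compact K.
  apply: continuous_compact => //; apply: continuous_subspaceT => x.
  by apply: cvgZr_tmp; apply: cvgM; [exact: cvg_cst|exact: cvg_id].
have bK : borel K by apply: closed_borel; apply: compact_closed => //; exact: norm_hausdorff.
exists K; split=> //; first by move=> _ [r Vr <-]; exact: VD.
pose DK : set R := (fun r => r *: v) @^-1` (B `\` K).
have mDK : measurable DK by 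
  rewrite (_ : DK = D `\` (fun r => r *: v) @^-1` K)//; exact: measurableD mD (bid _ bK).
have -> : (fun w => b w *: v) @^-1` (B `\` K) = b @^-1` DK by [].
rewrite lb// gauss_lawE; apply: le_lt_trans hV.
apply: le_measure; rewrite ?inE.
- exact: (measurable_preimage (measurable_scale s) mDK).
- exact: measurableD.
move=> r [/= Bsr nK]; split=> // Vr; apply: nK; by exists r.
Qed.

End gaussian_radon.

(** * Stochastic integration against one-dimensional noise *)

Section one_dimensional_noise.
Context d (T : measurableType d) (R : realType) (P : probability T R)
  (L : bool -> T -> T) (X : T -> R).
Hypothesis S : splitting P L X.
Variables (E : normedModType R) (v : E).
Local Notation B := (bm L X).

Definition noise (t : R) (w : T) : E := B t w *: v.

Let mB t : 0 <= t -> measurable_fun setT (B t) := @measurable_bm _ _ _ _ _ _ S t.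

Lemma bm_incr_law (s t : R) A : 0 <= s -> s <= t -> measurable A ->
  P ((fun w => B t w - B s w) @^-1` A) = gauss_law (Num.sqrt (t - s)) A.
Proof.
move=> s0 st mA.
have := @bm_law _ _ _ _ _ _ S (fun i => if i is 0%N then s else t) 1 (fun=> A).
rewrite big_ord_recl big_ord0 mule1 => <- //; last first.
  by case=> [|i] [|j].
by congr (P _); apply/seteqP; split=> w /=; [move=> ? []|move/(_ 0%N isT)].
Qed.

Lemma noise_incr (s t : R) : (noise t \- noise s) = (fun w => (B t w - B s w) *: v).
Proof. by apply/funext => w; rewrite /noise/= scalerBl. Qed.

Lemma scale_borel : borel_rv (fun r : R => r *: v).
Proof.
have := @borel_rv_lincomb _ R R E unit [:: tt] (fun=> id) (fun=> v) (fun=> @measurable_id _ _ _).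
by under eq_fun do rewrite big_seq1.
Qed.

Lemma noise_brownian : brownian_motion P noise.
Proof.
split.
- by move=> w; rewrite /noise (bm0 S) scale0r.
- move=> w x; have c := @bm_continuous _ _ _ _ _ _ S w x.
  exact: (cvgZr_tmp (a := v) c).
- move=> t n A t0 th bA.
  pose D i : set R := (fun r => r *: v) @^-1` A i.
  have mD i : measurable (D i) by exact: scale_borel.
  have tp i : 0 <= t i by apply: le_trans t0 (th _ _ _).
  have -> : \bigcap_(i < n) ((noise (t i.+1) \- noise (t i)) @^-1` A i) =
      [set w | forall i, (i < n)%N -> D i (B (t i.+1) w - B (t i) w)].
    by apply/seteqP; split=> w /= h i ni; have := h i ni; rewrite /D/= /noise scalerBl.
  rewrite (bm_law S)//; apply: eq_bigr => i _.
  by rewrite -bm_incr_law ?th// noise_incr.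
- move=> s t s0 st; rewrite noise_incr.
  have mI : measurable_fun setT (fun w => B t w - B s w).
    by apply: measurable_funB; apply: mB => //; exact: le_trans (ltW st).
  have lI D (mD : measurable D) := bm_incr_law s0 (ltW st) mD.
  split; first exact: (scaled_law_radon v mI lI).
  move=> x' fx; have xE : x' \o (fun w => (B t w - B s w) *: v) = (fun w => x' v * (B t w - B s w)).
    by apply/funext => w; rewrite /= functional_scale// mulrC.
  rewrite xE; split; first exact: measurable_funM.
  exists (x' v * Num.sqrt (t - s)) => A mA.
  have := lI _ (measurable_preimage (measurable_scale (x' v)) mA).
  rewrite gauss_lawE => E0; apply: (etrans E0); congr (normal_prob _ _ _).
  by apply/funext => r; rewrite /preimage/= mulrA.
- move=> s t s0 st A bA; rewrite noise_incr.
  pose D : set R := (fun r => r *: v) @^-1` A.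
  have mD : measurable D by exact: scale_borel.
  have -> : P ((fun w => (B t w - B s w) *: v) @^-1` A) = gauss_law (Num.sqrt (t - s)) D.
    by rewrite -bm_incr_law// ltW.
  have := bm_incr_law (lexx 0) ler01 (measurable_preimage (measurable_scale (Num.sqrt (t - s))) mD).
  rewrite subr0 sqrtr1 !gauss_lawE => E0.
  transitivity (P ((fun w => B 1 w - B 0 w) @^-1` ((fun r => Num.sqrt (t - s) * r) @^-1` D))).
    by apply/esym; apply: (etrans E0); congr (normal_prob _ _ _); apply/funext => r; rewrite /preimage/= mul1r.
  congr (P _); apply/funext => w; rewrite /preimage/= (bm0 S) subr0 /D/= /noise.
  by rewrite scalerA.
Qed.

Lemma noise_rkhs : v != 0 -> is_rkhs P (noise 1) (@dot R) (embed v).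
Proof.
move=> v0; split.
- exact: dot_hilbert.
- exact: embed_bounded.
- move=> h k /eqP; rewrite /embed -subr_eq0 -scalerBl scaler_eq0 (negbTE v0) orbF -mulrBr.
  by rewrite mulf_eq0 gt_eqF ?sqrt_var_gt0//= subr_eq0 => /eqP.
move=> x' fx; exists (Num.sqrt gauss_var * x' v); first exact/(adjoint_embed _ _ fx).
move=> y' fy; rewrite /embed functional_scale// unlock.
have m1 : measurable_fun setT (B 1) by exact: mB.
have l1 A : measurable A -> P (B 1 @^-1` A) = gauss_law 1 A.
  move=> mA; rewrite -[X in gauss_law X](sqrtr1 R) -[X in Num.sqrt X](subr0 1) -bm_incr_law//.
  by congr (P _); apply/funext => w; rewrite /preimage/= (bm0 S) subr0.
have -> : (\int[P]_w (x' (noise 1 w) * y' (noise 1 w))%:E = \int[P]_w ((x' v * y' v)%:E * (B 1 w ^+ 2)%:E))%E.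
  apply: eq_integral => w _.
  have E1 : x' (noise 1 w) = B 1 w * x' v by exact: functional_scale.
  have E2 : y' (noise 1 w) = B 1 w * y' v by exact: functional_scale.
  rewrite E1 E2 -EFinM; move: (x' v) (y' v) (B 1 w : R) => a b c.
  by have -> : c * a * (c * b) = a * b * c ^+ 2 by ring.
have sq := law_second_moment m1 l1.
rewrite integralZl//; last first.
  apply/integrableP; split; first by apply/measurable_EFinP; exact: measurable_funX.
  apply: (@le_lt_trans _ _ (\int[P]_w (B 1 w ^+ 2)%:E)%E); last by rewrite sq ltry.
  by under eq_integral do rewrite /= ger0_norm ?sqr_ge0//.
rewrite sq -EFinM expr1n mul1r; congr (_%:E).
by rewrite -[in RHS](sqr_sqrtr (ltW (@gauss_var_gt0 R))); ring.
Qed.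

(** The difference is one linear combination over a disjoint union of indices, which avoids
    subtracting Borel maps into a possibly nonseparable space. *)
Lemma borel_rv_lincomb2 (I J : Type) (s : seq I) (s' : seq J) (a : I -> T -> R) (b : J -> T -> R)
    (x : I -> E) (y : J -> E) :
  (forall i, measurable_fun setT (a i)) -> (forall j, measurable_fun setT (b j)) ->
  borel_rv (fun w => \sum_(i <- s) a i w *: x i - \sum_(j <- s') b j w *: y j).
Proof.
move=> ma mb.
have := @borel_rv_lincomb _ T R E (I + J) (map inl s ++ map inr s')
  (fun k w => match k with inl i => a i w | inr j => - b j w end)
  (fun k => match k with inl i => x i | inr j => y j end).
rewrite (_ : (fun w => \sum_(i <- _ ++ _) _) =
  (fun w => \sum_(i <- s) a i w *: x i - \sum_(j <- s') b j w *: y j)); last first.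
  apply/funext => w; rewrite big_cat/= !big_map; congr (_ + _).
  by rewrite -sumrN; apply: eq_bigr => j _; rewrite scaleNr.
by apply; case=> [i|j] //; apply: measurable_funN.
Qed.

(** The vector sqrt gauss_var is i^* x' whenever x'(v) = 1, so the elementary integral of this term
    is almost surely the increment of B times x. *)
Definition term (a b : R) (x : E) : step_term R^o E := StepTerm a b (Num.sqrt gauss_var : R^o) x.

Lemma frstep_integral_ae (t : R) (WH : (R -> R^o) -> T -> R) (x' : E -> R) (s : seq (R * R * E)) :
  functional x' -> x' v = 1 ->
  induced_cylindrical_bm P noise (@dot R) (embed v) t WH ->
  (forall z, List.In z s -> [/\ 0 <= z.1.1, z.1.1 <= z.1.2 & z.1.2 <= t]) ->
  {ae P, forall w, frstep_integral WH [seq term z.1.1 z.1.2 z.2 | z <- s] w =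
    \sum_(z <- s) (B z.1.2 w - B z.1.1 w) *: z.2}.
Proof.
move=> fx x1 HW; elim: s => [_|z s IH zs].
  by apply: nearW => w; rewrite /frstep_integral/= !big_nil.
have [z0 z1 z2] := zs z (or_introl erefl).
have h1 : {ae P, forall w, WH (step z.1.1 z.1.2 (Num.sqrt gauss_var : R^o)) w = B z.1.2 w - B z.1.1 w}.
  have ad : adjoint_at (@dot R) (embed v) x' (Num.sqrt gauss_var).
    by apply/(adjoint_embed _ _ fx); rewrite x1 mulr1.
  have := cbm_induced HW z0 z1 z2 fx ad; apply: filterS => w ->.
  by rewrite /noise -scalerBl functional_scale// x1 mulr1.
have h2 := IH (fun y ys => zs y (or_intror ys)).
move: h1 h2; apply: filterS2 => w e1 e2.
by rewrite /frstep_integral/= !big_cons/= e1; congr (_ + _); exact: e2.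
Qed.

Lemma ae_le_measure (A D : set T) : measurable A -> measurable D ->
  {ae P, forall w, A w -> D w} -> (P A <= P D)%E.
Proof.
move=> mA mD [N [mN N0 AD]].
apply: (@le_trans _ _ (P (D `|` N))).
  apply: le_measure; rewrite ?inE//; first exact: measurableU.
  move=> w Aw; have [Dw|nD] := pselect (D w); [by left|right].
  by apply: AD => /= /(_ Aw).
apply: le_trans (measureU2 _ mD mN) _.
by rewrite [X in (_ + X)%E](_ : _ = 0%E) ?adde0.
Qed.

(* The step functions are given by lists of triples (lo, hi, vector). *)
Lemma stoch_integralI (t : R) (x' : E -> R) (Psi : R -> E -> E) (Z : T -> E) (F_ : nat -> seq (R * R * E)) :
  t <= 1 -> functional x' -> x' v = 1 ->
  (forall s, 0 < s < t -> bounded_operator (Psi s)) ->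
  (forall n z, List.In z (F_ n) -> [/\ 0 <= z.1.1, z.1.1 <= z.1.2 & z.1.2 <= t]) ->
  (forall c : R, cvg_in_measure lebesgue_measure `]0, t[
     (fun n s => \sum_(z <- F_ n) \1_(`]z.1.1, z.1.2]) s *: (c *: z.2)) (fun s => Psi s (c *: v))) ->
  (forall w, \sum_(z <- F_ n) (B z.1.2 w - B z.1.1 w) *: z.2 @[n --> \oo] --> Z w) ->
  is_stoch_integral P noise t Psi Z.
Proof.
move=> t1 fx x1 bPsi tF cF cZ.
have v0 : v != 0.
  apply/eqP => v0; have := functional_scale 0 v fx; rewrite scale0r mul0r -[X in x' X]v0 x1.
  by move/eqP; rewrite oner_eq0.
have [WH mWH HW] := cylindrical_bm_exists S v t1.
(* Measurability of B(t) is known for t >= 0; freezing the path at negative times gives measurable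
   coefficients for every triple. *)
pose Bc (t : R) w := B (Num.max 0 t) w.
have mBc r : measurable_fun setT (Bc r) by apply: mB; rewrite le_max lexx.
have BcE n w : \sum_(z <- F_ n) (B z.1.2 w - B z.1.1 w) *: z.2 =
    \sum_(z <- F_ n) (Bc z.1.2 w - Bc z.1.1 w) *: z.2.
  have : forall z, List.In z (F_ n) -> (B z.1.2 w - B z.1.1 w) *: z.2 = (Bc z.1.2 w - Bc z.1.1 w) *: z.2.
    move=> z /tF[z0 z1 _]; rewrite /Bc.
    by have /max_idPr -> := z0; have /max_idPr -> := le_trans z0 z1.
  elim: (F_ n) => [|z s IH] zs; first by rewrite !big_nil.
  rewrite !big_cons (zs z (or_introl erefl)); congr (_ + _).
  by apply: IH => y ys; apply: zs; right.
pose V n w := \sum_(z <- F_ n) (Bc z.1.2 w - Bc z.1.1 w) *: z.2.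
have cV w : V n w @[n --> \oo] --> Z w.
  by have := cZ w; under eq_fun do rewrite BcE.
have mD (z : R * R * E) : measurable_fun setT (fun w => Bc z.1.2 w - Bc z.1.1 w) by exact: measurable_funB.
have bZ : borel_rv Z.
  by apply: (borel_rv_lim (X_ := V)) => // n; apply: borel_rv_lincomb => z; exact: mD.
have norm_diff (I : Type) (s : seq I) (a : I -> T -> R) (y : I -> E) :
    (forall i, measurable_fun setT (a i)) ->
    measurable_fun setT (fun w => `|\sum_(i <- s) a i w *: y i - Z w|).
  move=> ma; apply: borel_rv_norm.
  apply: (borel_rv_lim (X_ := fun k w => \sum_(i <- s) a i w *: y i - V k w)).
    by move=> k; apply: borel_rv_lincomb2 => // z; exact: mD.
  by move=> w; apply: cvgB => //; exact: cvg_cst.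
exists R^o, (@dot R), (embed v), WH; split=> //; first exact: noise_rkhs.
split=> //.
  move=> s st; have [lP cP] := bPsi s st; have [le ce] := embed_bounded v; split.
    by move=> a x y; rewrite /= le lP.
  by move=> x; apply: continuous_comp; [exact: ce|exact: cP].
exists (fun n => [seq term z.1.1 z.1.2 z.2 | z <- F_ n]); split.
- move=> n; have := tF n; elim: (F_ n) => //= z s IH zs.
  have [z0 z1 z2] := zs z (or_introl erefl); rewrite /step_in/= z0 z1 z2/=.
  by apply: IH => y ys; apply: zs; right.
- move=> h; have := cF (Num.sqrt gauss_var * h); rewrite /frstep /step.
  suff -> : (fun (n : nat) (s : R) => \sum_(z <- F_ n) \1_(`]z.1.1, z.1.2]) s *: ((Num.sqrt gauss_var * h) *: z.2)) =
    (fun (n : nat) (s : R) => \sum_(q <- [seq term z.1.1 z.1.2 z.2 | z <- F_ n])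
       \1_(`]lo q, hi q]) s *: (dot h (vH q) *: vE q)) by [].
  apply/funext => n; apply/funext => s.
  by rewrite big_map; apply: eq_bigr => z _; rewrite /term/= /dot [h * _]mulrC.
move=> e e0.
have mf n : measurable_fun setT (fun w => `|frstep_integral WH [seq term z.1.1 z.1.2 z.2 | z <- F_ n] w - Z w|).
  apply: norm_diff => q; exact: mWH.
have mVn n : measurable_fun setT (fun w => `|V n w - Z w|) by apply: norm_diff => z; exact: mD.
have cn : cvg_in_measure P setT (fun n w => `|V n w - Z w| : R) (fun=> 0 : R).
  apply: (ae_cvg_in_measure (G := setT)) => //; first by rewrite setCT measure0.
  move=> w _; rewrite -[X in _ --> X](@normr0 R E) -(subrr (Z w)).
  by apply: cvg_norm; apply: cvgB => //; exact: cvg_cst.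
have cst0 : (fun _ : nat => 0%E : \bar R) @ \oo --> 0%E by exact: cvg_cst.
apply: (squeeze_cvge _ cst0 (cn e e0)).
apply: nearW => n; rewrite measure_ge0/= !setTI.
(* [WH] and the increments of B agree almost surely only, so the two events are compared up to a
   null set. *)
apply: ae_le_measure.
- exact: measurable_ge (mf n).
- by apply: measurable_ge; apply: measurableT_comp => //; apply: measurable_funB.
have := frstep_integral_ae fx x1 HW (tF n); apply: filterS => w Ew /=.
by rewrite Ew BcE subr0 normr_id.
Qed.

End one_dimensional_noise.

(** * The stochastic convolution and the splitting scheme *)

Lemma uniform_cvg_in_measure d (T : measurableType d) (R : realType) (V : normedModType R)
    (mu : {measure set T -> \bar R}) (D : set T) (f_ : nat -> T -> V) (f : T -> V) :
  (forall e : R, 0 < e -> \forall n \near \oo, forall x, D x -> `|f_ n x - f x| < e) ->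
  cvg_in_measure mu D f_ f.
Proof.
move=> H e e0; apply: cvg_near_cst; have := H e e0; apply: filterS => n Hn.
rewrite (_ : _ `&` _ = set0) ?measure0//; apply/seteqP; split=> x //= [Dx].
by rewrite leNgt Hn.
Qed.

Lemma indic_itv_oc (R : realType) (a b s : R) : a <= b ->
  \1_(`]a, b] : set R) s = (s <= b)%R%:R - (s <= a)%R%:R :> R.
Proof.
move=> ab; have [sb|bs] := leP s b; have [sa|as_] := leP s a; rewrite ?subrr ?subr0.
- by rewrite indicE memNset//= in_itv/= ltNge sa.
- by rewrite indicE mem_set//= in_itv/= as_ sb.
- by have := le_lt_trans sa (le_lt_trans ab bs); rewrite ltxx.
- by rewrite indicE memNset//= in_itv/= as_ leNgt bs.
Qed.

Lemma bounded_operator_sum (R : realType) (E : normedModType R) (I : Type) (s : seq I) (c : I -> R) (F : I -> E -> E) :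
  (forall i, bounded_operator (F i)) -> bounded_operator (fun x => \sum_(i <- s) c i *: F i x).
Proof.
move=> bF; elim: s => [|i s [ls cs]].
  split; first by move=> a x y; rewrite !big_nil scaler0 addr0.
  rewrite (_ : (fun x => _) = (fun=> 0)); first exact: cst_continuous.
  by apply/funext => x; rewrite big_nil.
have [li ci] := bF i; split.
  move=> a x y; rewrite !big_cons ls li !scalerDr !scalerA mulrC.
  by rewrite -!addrA; congr (_ + _); rewrite addrCA.
rewrite (_ : (fun x => _) = (fun x => c i *: F i x + \sum_(j <- s) c j *: F j x)); last first.
  by apply/funext => y; rewrite big_cons.
by move=> x; apply: cvgD; [apply: cvgZl_tmp; exact: ci|exact: cs].
Qed.

Section point.
Context {R : realType}.

Definition ev (z : domain R) (f : buc R) : R := f z.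

Lemma ev_functional z : functional (ev z).
Proof.
split; first by move=> a f g; rewrite /ev bucD bucZ.
move=> f; have FF : Filter (nbhs f) := nbhs_filter f.
apply/(@cvgrPdist_lt R R^o (buc R) (nbhs f) FF (ev z) (ev z f)) => e e0.
have /cvgrPdist_lt/(_ _ e0) : id @ f --> f by exact: cvg_id.
by apply: filterS => g; apply: le_lt_trans; rewrite /ev -bucB; exact: le_norm.
Qed.

(** An evaluation provides the functional with value 1 at the noise direction that [stoch_integralI]
    requires, without Hahn-Banach. *)
Lemma ev_phi : ev ((0%N, fun=> true), 1) phi = 1 :> R.
Proof.
have := @bump_spike R 0 (fun=> true) 0 (ltnSn 0).
by rewrite /spike expr0 divr1 /sgn mul1r.
Qed.

End point.

Section convolution.
Context d (T : measurableType d) (R : realType) (P : probability T R)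
  (L : bool -> T -> T) (X : T -> R).
Hypothesis S : splitting P L X.
Local Notation B := (bm L X).
Local Notation W := (noise L X (@phi R)).
Implicit Types (t s : R) (w : T).

Lemma path_modulus w : exists2 C, 0 <= C & forall (K : nat) (r s : R),
  0 <= r <= 1 -> 0 <= s <= 1 -> `|s - r| <= 2^-1 ^+ K -> `|B s w - B r w| <= C * rho ^+ K.
Proof. exact: (bm_modulus S w 1). Qed.

(* [sigma = -1], [alpha = t] gives the convolution at time [t]; [sigma = 1], [alpha = 0] gives the
   integral of [S] itself. *)
Definition conv (t alpha sigma : R) (w : T) : buc R := Vlim (B ^~ w) t alpha sigma.

(** The step integrands behind [Vsum] converge uniformly to the shift, by equicontinuity and the
    truncation estimate [phi_belowP]; their integrals are the sums [Vsum], which converge for every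
    path. *)
Lemma shift_affine_integral (t alpha sigma : R) : 0 <= t <= 1 -> sigma = 1 \/ sigma = -1 ->
  is_stoch_integral P W t (fun s => shift (alpha + sigma * s)) (conv t alpha sigma).
Proof.
move=> /andP[t0 t1] sigma1; have h0 K : 0 < (2^-1 : R) ^+ K by exact: half_gt0.
pose F_ m : seq (R * R * buc R) := [seq (Num.min (dyad (level m) j) t, Num.min (dyad (level m) j.+1) t,
  shift (alpha + sigma * dyad (level m) j) (phi_below m)) | j <- index_iota 0 (2 ^ level m)].
have minS K j : Num.min (dyad K j) t <= Num.min (dyad K j.+1) t :> R.
  by rewrite le_min2// dyadS lerDl ltW.
apply: (stoch_integralI S t1 (ev_functional _) ev_phi (F_ := F_)).
- by move=> s _; split; [exact: shift_linear|exact: shift_continuous].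
- move=> m z /List.in_map_iff[j [<- _]]/=; split=> //.
    by rewrite le_min dyad_ge0.
  by rewrite ge_min lexx orbT.
- move=> c; apply: uniform_cvg_in_measure => e e0.
  have c1 : 0 < `|c| + 1 by rewrite ltr_wpDl.
  (* Mesh and truncation contribute one such error each, both multiplied by |c|. *)
  have e20 : 0 < e / (2 * (`|c| + 1)) by rewrite divr_gt0// mulr_gt0.
  have [r r0 Hr] := shift_equicontinuous (@phi R) e20.
  have ch : (2^-1 : R) ^+ n @[n --> \oo] --> (0 : R) by exact: half_pow_cvg0.
  have rr0 : 0 < Num.min r (e / (2 * (`|c| + 1))) by rewrite lt_min r0.
  have /cvgr_lt/(_ _ rr0) := ch; apply: filterS => m; rewrite lt_min => /andP[mr me] s.
  rewrite /= in_itv/= => /andP[s0 st].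
  pose N := (2 ^ level m)%N.
  (* The indicators of the cells as differences of thresholds: they telescope to 1 on ]0, t[, so the
     error is a convex combination of the vectors [c *: y j]. *)
  pose I j : R := (s <= Num.min (dyad (level m) j.+1) t)%R%:R - (s <= Num.min (dyad (level m) j) t)%R%:R.
  have I1 : \sum_(0 <= j < N) I j = 1.
    rewrite (telescope_sumr (fun j => (s <= Num.min (dyad (level m) j) t)%R%:R))//.
    have -> : Num.min (dyad (level m) N) t = t.
      by apply/min_idPr; rewrite /dyad /N natrX half_mul.
    rewrite (ltW st) /dyad mul0r (_ : s <= _ = false) ?subr0//.
    by apply/negbTE; rewrite -ltNge gt_min s0.
  have I0 j : 0 <= I j.
    rewrite subr_ge0 ler_nat; case: (leP s (Num.min (dyad (level m) j) t)) => // sj.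
    by rewrite (le_trans sj (minS _ _)).
  pose y j := shift (alpha + sigma * dyad (level m) j) (phi_below m) - shift (alpha + sigma * s) phi.
  have -> : \sum_(z <- F_ m) \1_(`]z.1.1, z.1.2]) s *: (c *: z.2) - shift (alpha + sigma * s) (c *: phi) =
      \sum_(0 <= j < N) I j *: (c *: y j).
    rewrite big_map shiftZ -[X in _ - X]scale1r -I1 scaler_suml -sumrB.
    by apply: eq_bigr => j _ /=; rewrite indic_itv_oc// -/(I j) -scalerBr -scalerBr.
  have yj j : I j != 0 -> `|y j| <= 2 * (e / (2 * (`|c| + 1))) - (e / (2 * (`|c| + 1)) - 2^-1 ^+ m).
    move=> Ij; have js : dyad (level m) j < s <= dyad (level m) j.+1.
      move: Ij; rewrite /I !le_min (ltW st) !andbT ltNge.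
      have mon : (dyad (level m) j : R) <= dyad (level m) j.+1 by rewrite dyadS lerDl ltW.
      by case: (leP s (dyad (level m) j)) => [sj|_]; [rewrite (le_trans sj mon) subrr eqxx|case: leP; rewrite ?subrr ?eqxx].
    have -> : y j = shift (alpha + sigma * dyad (level m) j) (phi_below m - phi) +
        (shift (alpha + sigma * dyad (level m) j) phi - shift (alpha + sigma * s) phi).
      by rewrite /y -shiftB addrA subrK.
    apply: le_trans (ler_normD _ _) _.
    have -> (a b : R) : 2 * a - (a - b) = b + a by ring.
    apply: lerD; first by apply: le_trans (norm_shift _ _) _; rewrite distrC; exact: phi_belowP.
    apply: Hr; apply: le_lt_trans mr.
    have -> : alpha + sigma * dyad (level m) j - (alpha + sigma * s) = sigma * (dyad (level m) j - s) by ring.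
    rewrite normrM (_ : `|sigma| = 1) ?mul1r; last by case: sigma1 => ->; rewrite ?normrN normr1.
    have lm : (2^-1 : R) ^+ level m <= 2^-1 ^+ m.
      rewrite ler_wiXn2l ?invr_ge0 ?invf_le1 ?ler1n// /level.
      by apply: leqW; rewrite -[leqLHS]mul1n leq_mul2r orbT.
    apply: le_trans lm; move: js; rewrite dyadS => /andP[j1 j2].
    by rewrite distrC ger0_norm; lra.
  move: me; set a := e / _ in yj * => me.
  apply: (@le_lt_trans _ _ (\sum_(0 <= j < N) I j * (`|c| * (a + 2^-1 ^+ m)))).
    apply: le_trans (ler_norm_sum _ _ _) _; apply: ler_sum => j _.
    rewrite normrZ ger0_norm//; have [->|Ij] := eqVneq (I j) 0; first by rewrite !mul0r.
    apply: ler_wpM2l => //; rewrite normrZ; apply: ler_wpM2l => //.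
    by apply: le_trans (yj j Ij) _; lra.
  rewrite -mulr_suml I1 mul1r.
  apply: (@le_lt_trans _ _ (`|c| * (a + a))).
    by apply: ler_wpM2l => //; rewrite lerD2l ltW.
  have aE : (`|c| + 1) * (a + a) = e by rewrite /a; field; rewrite gt_eqF.
  by rewrite -[ltRHS]aE ltr_pM2r ?addr_gt0// ltrDl.
move=> w; have [C C0 HC] := path_modulus w.
have t01 : 0 <= t <= 1 by rewrite t0.
have [cV _] := Vlim_approx C0 t01 HC alpha sigma1.
rewrite (_ : (fun n => _) = Vsum (B ^~ w) t alpha sigma); first exact: cV.
by apply/funext => m; rewrite big_map.
Qed.

(** The substitution s |-> t - s reverses the grid: the cell between grid points j and j + 1 becomes
    an interval ending at t minus grid point j; the maxima discard what lies before time 0. *)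
Definition split_sum (n : nat) t w : buc R := \sum_(0 <= j < n)
  (B (Num.max 0 (t - grid 1 n j)) w - B (Num.max 0 (t - grid 1 n j.+1)) w) *: shift (grid 1 n j.+1) phi.

Lemma grid_le (n j : nat) : grid 1 n j <= grid 1 n j.+1 :> R.
Proof.
rewrite /grid !mulr1; apply: ler_wpM2r; first by rewrite invr_ge0.
by rewrite ler_nat.
Qed.

Lemma grid_ge0 (n j : nat) : 0 <= grid 1 n j :> R.
Proof. by rewrite /grid mulr1 divr_ge0. Qed.

(** The integrand is itself a step function, except that reversing time puts the closed ends of the
    cells on the other side; a constant approximating sequence therefore differs from it at finitely
    many times only. *)
Lemma splitting_scheme (n : nat) : (0 < n)%N -> is_splitting_scheme P (@shift R) W 1 n (split_sum n).
Proof.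
move=> n0 t /andP[t0 t1].
pose F_ (k : nat) : seq (R * R * buc R) := [seq (Num.max 0 (t - grid 1 n j.+1), Num.max 0 (t - grid 1 n j),
  shift (grid 1 n j.+1) phi) | j <- index_iota 0 n].
have maxS j : Num.max 0 (t - grid 1 n j.+1) <= Num.max 0 (t - grid 1 n j) :> R.
  by rewrite ge_max !le_max lexx/= lerD2l lerN2 grid_le orbT.
apply: (stoch_integralI S t1 (ev_functional _) ev_phi (F_ := F_)).
- move=> s _; apply: bounded_operator_sum => j.
  by split; [exact: shift_linear|exact: shift_continuous].
- move=> m z /List.in_map_iff[j [<- _]]/=; split=> //.
    by rewrite le_max lexx.
  by rewrite ge_max t0 gerBl grid_ge0.
- move=> c e e0.
  pose D : set R := [set t - grid 1 n j | j in `I_n.+1].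
  have fD : finite_set D by apply: finite_image; exact: finite_II.
  apply: cvg_near_cst; apply: nearW => k.
    apply: countable_lebesgue_measure0; apply: finite_set_countable; apply: sub_finite_set fD.
    move=> s [/=]; rewrite in_itv/= => /andP[s0 st] es; apply: contrapT => nD.
    move: es; apply/negP; rewrite -ltNge big_map /split_semigroup big_nat_recl//=.
    have off j : (j <= n)%N -> s != t - grid 1 n j.
      by move=> jn; apply/eqP => sj; apply: nD; exists j.
    rewrite indicE memNset ?scale0r ?add0r; last by rewrite /grid_cell/= => /eqP; rewrite subr_eq0 gt_eqF.
    rewrite -sumrB big1_seq ?normr0// => j /andP[_]; rewrite mem_index_iota => /andP[_ jn].
    rewrite shiftZ; apply/eqP; rewrite subr_eq0; apply/eqP; congr (_ *: _).
    have o1 := off j (ltnW jn); have o2 := off j.+1 jn.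
    rewrite !indicE /grid_cell/=; congr (_%:R); congr nat_of_bool.
    apply/idP/idP; rewrite !inE/= !in_itv/= gt_max le_max [s <= 0]leNgt s0/= => /andP[h1 h2].
      have h3 : s < t - grid 1 n j by rewrite lt_neqAle o1.
      by apply/andP; split; lra.
    have h3 : t - grid 1 n j.+1 < s by rewrite lt_neqAle eq_sym o2; lra.
    by rewrite h3/=; lra.
by move=> w; rewrite /F_ big_map; exact: cvg_cst.
Qed.

End convolution.

(** * Failure of the splitting scheme *)

(** The p-th moment is at least r^p / 2, which is at least (r/2)^p since p >= 1; the bound does not
    deteriorate with p. The margin from r/2 to r/4 makes the contradiction strict. *)
Lemma Lnorm_lower_bound d (T : measurableType d) (R : realType) (P : probability T R) (Y : T -> R) (p r : R) :
  measurable_fun setT Y -> (forall w, 0 <= Y w) -> 1 <= p -> 0 < r ->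
  ((2^-1)%:E <= P [set w | (r <= Y w)%R])%E -> (~ 'N[P]_p%:E[(fun w => (Y w)%:E)] < (r / 4)%:E)%E.
Proof.
move=> mY Y0 p1 r0 PY lt.
have p0 : 0 < p by apply: lt_le_trans p1.
have mA : measurable [set w | r <= Y w].
  exact: measurable_ge.
have lo : (((r / 2) `^ p)%:E <= \int[P]_w (`|(Y w)%:E| `^ p))%E.
  apply: (@le_trans _ _ (\int[P]_w ((r `^ p)%:E * (\1_[set w | (r <= Y w)%R] w)%:E))%E).
    rewrite ge0_integralZl//; last 2 first.
    - by apply/measurable_EFinP; exact: measurable_indic.
    - by rewrite lee_fin powR_ge0.
    rewrite integral_indic// setIT.
    apply: (@le_trans _ _ ((r `^ p)%:E * (2^-1)%:E)%E); last by apply: lee_wpmul2l => //; rewrite lee_fin powR_ge0.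
    rewrite -EFinM lee_fin powRM ?(ltW r0) ?invr_ge0//; apply: ler_wpM2l; first exact: powR_ge0.
    have h : (2^-1 : R) `^ p <= 2^-1 `^ 1 by apply: ger_powR => //; apply/andP; split; lra.
    by rewrite powRr1 ?invr_ge0 in h.
  apply: ge0_le_integral => //.
  - by move=> w _; rewrite -EFinM lee_fin mulr_ge0// powR_ge0.
  - by apply: measurable_funeM; apply/measurable_EFinP; exact: measurable_indic.
  - apply/measurable_EFinP; apply: (measurableT_comp (f := fun x : R => x `^ p)); first exact: measurable_powR.
    exact: measurableT_comp.
  move=> w _; rewrite -EFinM lee_fin ger0_norm// indicE.
  have [rY|rY] := boolP (w \in _); last by rewrite mulr0 powR_ge0.
  rewrite mulr1; apply: ge0_ler_powR; rewrite ?nnegrE ?(ltW p0) ?(ltW r0)//.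
  by move: rY; rewrite inE.
have N0 : (0 <= 'N[P]_p%:E[(fun w => (Y w)%:E)])%E by exact: Lnorm_ge0.
have : ('N[P]_p%:E[(fun w => (Y w)%:E)] `^ p <= (r / 4)%:E `^ p)%E.
  apply: gt0_ler_poweR; [exact: ltW| | |exact: ltW].
    by rewrite in_itv/= N0 leey.
  by rewrite in_itv/= leey andbT lee_fin divr_ge0// ltW.
rewrite poweR_Lnorm ?gt_eqF// => hi.
have := le_trans lo hi; rewrite poweR_EFin lee_fin leNgt => /negP; apply.
by apply: gt0_ltr_powR; rewrite ?nnegrE ?divr_ge0 ?(ltW r0)//; lra.
Qed.

Section failure.
Context d (T : measurableType d) (R : realType) (P : probability T R)
  (L : bool -> T -> T) (X : T -> R).
Hypothesis S : splitting P L X.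
Local Notation B := (bm L X).
Local Notation W := (noise L X (@phi R)).
Implicit Types (t s : R) (w : T) (m n j : nat).

Definition solution t w : buc R := conv L X t t (-1) w.

Let mB t : 0 <= t -> measurable_fun setT (B t) := @measurable_bm _ _ _ _ _ _ S t.

Definition gridinc m j w : R :=
  B (Num.max 0 (1 - grid 1 (4 ^ m) j)) w - B (Num.max 0 (1 - grid 1 (4 ^ m) j.+1)) w.

Lemma measurable_gridinc m j : measurable_fun setT (gridinc m j).
Proof. by apply: measurable_funB; apply: mB; rewrite le_max lexx. Qed.

Lemma gridinc_law m j A : (j < 4 ^ m)%N -> measurable A ->
  P (gridinc m j @^-1` A) = gauss_law (2^-1 ^+ m) A.
Proof.
move=> jm mA; have n0 : 0 < (4 ^ m)%:R :> R by rewrite ltr0n expn_gt0.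
have g1 i : (i <= 4 ^ m)%N -> 0 <= 1 - grid 1 (4 ^ m) i :> R.
  by move=> im; rewrite subr_ge0 /grid mulr1 ler_pdivrMr// mul1r ler_nat.
rewrite /gridinc; have /max_idPr -> := g1 j (ltnW jm); have /max_idPr -> := g1 j.+1 jm.
rewrite (bm_incr_law S) ?g1//; last by rewrite lerD2l lerN2 grid_le.
congr (gauss_law _ A).
have -> : 1 - grid 1 (4 ^ m) j - (1 - grid 1 (4 ^ m) j.+1) = (2^-1 ^+ m) ^+ 2 :> R.
  rewrite /grid -[j.+1%:R]natr1 natrX -exprM mulnC exprM.
  have -> : (2^-1 : R) ^+ 2 = 4^-1 by rewrite expr2 -invfM -natrM.
  by rewrite exprVn; field; rewrite gt_eqF// exprn_gt0.
by rewrite sqrtr_sqr ger0_norm// exprn_ge0// invr_ge0.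
Qed.

Definition roughness m w : R := 2^-1 ^+ m * \sum_(0 <= j < 4 ^ m) `|gridinc m j w|.

Lemma measurable_roughness m : measurable_fun setT (roughness m).
Proof.
apply: measurable_funM => //; apply: measurable_sum => j.
by apply: measurableT_comp => //; exact: measurable_gridinc.
Qed.

(** Chosen so that the bound of [gaussian_small_ball] at this radius is 1/8. *)
Definition small_const : R := (16 * normal_peak 1)^-1.

Lemma small_const_gt0 : 0 < small_const.
Proof. by rewrite invr_gt0 mulr_gt0// normal_peak_gt0// oner_neq0. Qed.

Let small m j : set T := [set w | `|gridinc m j w| < small_const * 2^-1 ^+ m].

Let measurable_small m j : measurable (small m j).
Proof.
by apply: measurable_lt; apply: measurableT_comp => //; exact: measurable_gridinc.
Qed.

Let small_prob m j : (j < 4 ^ m)%N -> (P (small m j) <= (1 / 8)%:E)%E.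
Proof.
move=> jm; pose A : set R := [set x | `|x| < small_const * 2^-1 ^+ m].
have mA : measurable A.
  by apply: measurable_lt.
have -> : small m j = gridinc m j @^-1` A by [].
rewrite gridinc_law// gauss_lawE.
have -> : (fun r : R => 2^-1 ^+ m * r) @^-1` A = [set x | `|x| < small_const].
  apply/seteqP; split=> x; rewrite /A/= normrM gtr0_norm ?half_gt0// mulrC ltr_pM2r ?half_gt0//.
apply: le_trans (gaussian_small_ball (ltW small_const_gt0)) _.
rewrite lee_fin le_eqVlt; apply/orP; left; apply/eqP; rewrite /small_const.
have : normal_peak 1 != 0 :> R by rewrite gt_eqF// normal_peak_gt0// oner_neq0.
by move: (normal_peak 1 : R) => k k0; field.
Qed.

(** If the roughness is below half of [small_const], at least half of the 4^m normalised increments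
    are below [small_const]. Each is so with probability at most 1/8, and Markov's inequality for
    their number gives 1/4. *)
Lemma roughness_small m : (P [set w | (roughness m w < small_const / 2)%R] <= (4^-1)%:E)%E.
Proof.
set A := [set w | _]; have mA : measurable A.
  by apply: measurable_lt; exact: measurable_roughness.
have c0 := small_const_gt0; have n0 : 0 < (4 : R) ^+ m by rewrite exprn_gt0.
have count w : A w -> 4 ^+ m / 2 <= \sum_(0 <= j < 4 ^ m) \1_(small m j) w :> R.
  move=> Aw; rewrite leNgt; apply/negP => lt.
  have h0 := half_gt0 m (R := R).
  have each j : small_const * 2^-1 ^+ m * (1 - \1_(small m j) w) <= `|gridinc m j w|.
    rewrite indicE; have [sj|nsj] := boolP (w \in small m j).
      by rewrite subrr mulr0.
    rewrite subr0 mulr1 leNgt; apply: contra nsj => lt'; exact: mem_set.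
  have : small_const * 2^-1 ^+ m * (2^-1 ^+ m * (4 ^+ m - \sum_(0 <= j < 4 ^ m) \1_(small m j) w)) <= roughness m w.
    rewrite mulrCA; apply: ler_wpM2l; first exact: ltW.
    apply: le_trans (ler_sum _ (fun j _ => each j)).
    by rewrite -mulr_sumr sumrB sumr_const_nat subn0 natrX.
  have e4 : (2^-1 : R) ^+ m * 2^-1 ^+ m * 4 ^+ m = 1.
    by rewrite -!exprMn (_ : 2^-1 * 2^-1 * 4 = 1 :> R) ?expr1n//; field.
  move: Aw; rewrite /A/=; move: (roughness m w) => Q Qc.
  apply/negP; rewrite -ltNge; apply: lt_le_trans Qc _.
  have : 2^-1 ^+ m * 2^-1 ^+ m * (4 ^+ m / 2) <= 2^-1 ^+ m * 2^-1 ^+ m * (4 ^+ m - \sum_(0 <= j < 4 ^ m) \1_(small m j) w) :> R.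
    by apply: ler_wpM2l; [rewrite mulr_ge0// ltW|lra].
  rewrite mulrA e4 mul1r => /(ler_wpM2l (ltW c0)).
  by rewrite -!mulrA.
have : ((4 ^+ m / 2)%:E * P A <= (4 ^+ m / 8)%:E)%E.
  rewrite -(setIT A) -integral_indic// -ge0_integralZl//; last by apply/measurable_EFinP; exact: measurable_indic.
  apply: (@le_trans _ _ (\int[P]_w (\sum_(0 <= j < 4 ^ m) (\1_(small m j) w)%:E))%E).
    apply: ge0_le_integral => //.
    - by apply: measurable_funeM; apply/measurable_EFinP; exact: measurable_indic.
    - by apply: emeasurable_sum => j; apply/measurable_EFinP; exact: measurable_indic.
    move=> w _; rewrite -EFinM sumEFin lee_fin indicE; have [Aw|nA] := boolP (w \in A).
      by rewrite mulr1; apply: count; rewrite inE in Aw.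
    by rewrite mulr0 sumr_ge0.
  rewrite ge0_integral_sum//; last first.
    by move=> j; apply/measurable_EFinP; exact: measurable_indic.
  apply: (@le_trans _ _ (\sum_(0 <= j < 4 ^ m) (1 / 8)%:E)%E).
    rewrite !big_mkord; apply: lee_sum => j _; rewrite integral_indic// setIT; exact: small_prob.
  by rewrite sumEFin lee_fin sumr_const_nat subn0 -[_ *+ _]mulr_natl natrX; lra.
have pf : P A \is a fin_num by exact: fin_num_measure.
rewrite -(fineK pf) -EFinM !lee_fin; move: (fine (P A)) n0 => x; move: ((4 : R) ^+ m) => y y0 h.
have : y * (x / 2) <= y * 8^-1 by lra.
by rewrite ler_pM2l//; lra.
Qed.

(** The signs are chosen path by path: at component m with these signs and x = 0, the scheme gives
    exactly the roughness, while [Vlim_spike] bounds the convolution. The constant [C] depends on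
    the path. *)
Lemma gap_lower m w C : 0 <= C -> (forall (K : nat) (r s : R),
  0 <= r <= 1 -> 0 <= s <= 1 -> `|s - r| <= 2^-1 ^+ K -> `|B s w - B r w| <= C * rho ^+ K) ->
  roughness m w <= `|split_sum L X (4 ^ m) 1 w - solution 1 w| + 15 * C * 2^-1 ^+ m.
Proof.
move=> C0 HC.
pose eps j : bool := 0 <= gridinc m j w; pose z : domain R := ((m, eps), 0).
have -> : roughness m w = split_sum L X (4 ^ m) 1 w z.
  rewrite /split_sum buc_sum /roughness mulr_sumr; apply: eq_big_nat => j /andP[_ jm].
  have E : shift (grid 1 (4 ^ m) j.+1) phi z = 2^-1 ^+ m * sgn eps j.
    by rewrite /z shiftE add0r -bump_spike// /phi /= /bumps /= /grid mulr1 natrX.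
  rewrite bucZ E mulrCA; congr (_ * _); rewrite -/(gridinc m j w) /sgn /eps.
  case: ifPn => [g0|]; first by rewrite mulr1 ger0_norm.
  by rewrite -ltNge => g0; rewrite mulrN1 ltr0_norm.
have b1 : `|solution 1 w z| <= 15 * C * 2^-1 ^+ m.
  apply: (Vlim_spike (t := 1) C0 _ HC) => //; last by right.
  by rewrite ler01 lexx.
have := le_norm (split_sum L X (4 ^ m) 1 w - solution 1 w) z; rewrite bucB.
by have := ler_norm (split_sum L X (4 ^ m) 1 w z - solution 1 w z); have := ler_norm (solution 1 w z); lra.
Qed.

Lemma measurable_gap n : measurable_fun setT (fun w => `|split_sum L X n 1 w - solution 1 w|).
Proof.
apply: borel_rv_norm.
pose c K j w := dB (B ^~ w) 1 K j.
have mc K j : measurable_fun setT (c K j).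
  by apply: measurable_funB; apply: mB; rewrite le_min dyad_ge0 ler01.
apply: (borel_rv_lim (X_ := fun k w => split_sum L X n 1 w - Vsum (B ^~ w) 1 1 (-1) k)).
  move=> k; apply: borel_rv_lincomb2 => j; last exact: mc.
  by apply: measurable_funB; apply: mB; rewrite le_max lexx.
move=> w; apply: cvgB; first exact: cvg_cst.
have [C C0 HC] := path_modulus S w.
have t01 : 0 <= (1 : R) <= 1 by rewrite ler01 lexx.
by have [cV _] := Vlim_approx C0 t01 HC 1 (or_intror erefl); exact: cV.
Qed.

(** Along n = 4^m. The error 15 C 2^-m depends on the path and no moment of C has been estimated, so
    the positive part [Z] of roughness minus gap is used in probability: with probability at least
    1/2 the roughness is at least small_const/2 and [Z] is below small_const/4, which leaves a gap
    of at least small_const/4. *)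
Lemma no_convergence (p : R) : 1 <= p ->
  ~ ('N[P]_p%:E[(fun w => (`|split_sum L X n 1 w - solution 1 w|)%:E)]%E @[n --> \oo] --> 0%E).
Proof.
move=> p1 cN; have c0 := small_const_gt0.
pose Y m w := `|split_sum L X (4 ^ m) 1 w - solution 1 w|.
have mY m : measurable_fun setT (Y m) by exact: measurable_gap.
pose Z m w := Num.max 0 (roughness m w - Y m w).
have mZ m : measurable_fun setT (Z m).
  by apply: measurable_maxr => //; apply: measurable_funB => //; exact: measurable_roughness.
have cZ : cvg_in_measure P setT (Z : nat -> T -> R) (fun=> 0 : R).
  apply: (ae_cvg_in_measure (G := setT)) => //; first by rewrite setCT measure0.
  move=> w _; have [C C0 HC] := path_modulus S w.
  have c1 : 15 * C * (2^-1 : R) ^+ m @[m --> \oo] --> (0 : R) by apply: scaled_cvg0; exact: half_pow_cvg0.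
  apply: (squeeze_cvgr _ (cvg_cst 0) c1); apply: nearW => m.
  rewrite le_max lexx/= ge_max !mulr_ge0 ?exprn_ge0 ?invr_ge0//=.
  by have := gap_lower m C0 HC; rewrite -/(Y m w); lra.
have e0 : 0 < small_const / 4 by rewrite divr_gt0.
have q0 : 0 < 4^-1 :> R by rewrite invr_gt0.
have [M1 _ HM1] := cvge0_near (cZ _ e0) q0.
(* This is r/4 for r = small_const/4, the threshold that [Lnorm_lower_bound] excludes. *)
have e1 : 0 < small_const / 4 / 4 by rewrite divr_gt0.
have [M2 _ HM2] := cvge0_near cN e1.
pose m := maxn M1 M2.
have Zm := HM1 m (leq_maxl _ _); have Nm : ('N[P]_p%:E[(fun w => (Y m w)%:E)]%E < (small_const / 4 / 4)%:E)%E.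
  apply: (HM2 (4 ^ m)%N) => /=; apply: leq_trans (leq_maxr M1 _) _; rewrite -/m.
  by apply: ltnW; apply: ltn_expl.
apply: (Lnorm_lower_bound (P := P) (mY m) (fun w => normr_ge0 _) p1 e0 _ Nm).
pose A := [set w | small_const / 4 <= Y m w].
have mA : measurable A by exact: measurable_ge.
pose D := [set w | roughness m w < small_const / 2].
have mD : measurable D.
  by apply: measurable_lt; exact: measurable_roughness.
pose F := setT `&` [set w | small_const / 4 <= `|Z m w - 0|].
have mF : measurable F.
  rewrite /F setTI; apply: measurable_ge; apply: measurableT_comp => //; exact: measurable_funB.
have sub : ~` A `<=` D `|` F.
  move=> w /negP; rewrite -ltNge => Yw; have [rw|rw] := ltP (roughness m w) (small_const / 2); first by left.
  right; split=> //; rewrite /= subr0; apply: le_trans (ler_norm _).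
  by rewrite /Z le_max; apply/orP; right; lra.
have : (P (~` A) <= (2^-1)%:E)%E.
  apply: (@le_trans _ _ (P (D `|` F))); first by apply: le_measure; rewrite ?inE//; [exact: measurableC|exact: measurableU].
  apply: le_trans (measureU2 _ mD mF) _.
  apply: le_trans (leeD (roughness_small m) (ltW Zm)) _.
  by rewrite -EFinD lee_fin; lra.
rewrite probability_setC// -/A; have pf : P A \is a fin_num by exact: fin_num_measure.
by rewrite -(fineK pf) -EFinB !lee_fin; lra.
Qed.

End failure.

(** * Trajectories *)

Section trajectory.
Context {R : realType}.
Variables (B : R -> R) (C : R).
Hypotheses (C0 : 0 <= C).
Hypothesis HB : forall (K : nat) (r s : R), 0 <= r <= 1 -> 0 <= s <= 1 -> `|s - r| <= 2^-1 ^+ K ->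
  `|B s - B r| <= C * rho ^+ K.

Definition dist_continuous (V : normedModType R) (f : R -> V) : Prop :=
  forall x, 0 <= x <= 1 -> forall e, 0 < e -> exists2 r, 0 < r &
    forall y, 0 <= y <= 1 -> `|y - x| < r -> `|f y - f x| < e.

Lemma dist_continuous_sum (V : normedModType R) (I : Type) (s : seq I) (f : I -> R -> V) :
  (forall i, dist_continuous (f i)) -> dist_continuous (fun t => \sum_(i <- s) f i t).
Proof.
move=> cf; elim: s => [|i s IH] x x01 e e0.
  by exists 1 => // y _ _; rewrite !big_nil subrr normr0.
have e20 : 0 < e / 2 by rewrite divr_gt0.
have [r r0 Hr] := cf i x x01 _ e20; have [r' r'0 Hr'] := IH x x01 _ e20.
exists (Num.min r r'); first by rewrite lt_min r0.
move=> y y01; rewrite lt_min => /andP[yr yr']; rewrite !big_cons opprD addrACA.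
by apply: le_lt_trans (ler_normD _ _) _; rewrite (splitr e); apply: ltrD; [exact: Hr|exact: Hr'].
Qed.

Lemma min_dist (r x y : R) : `|Num.min r y - Num.min r x| <= `|y - x|.
Proof.
wlog xy : x y / x <= y.
  by move=> H; have [xy|/ltW yx] := leP x y; [exact: H|rewrite distrC [leRHS]distrC; exact: H].
have [ry|yr] := leP r y; have [rx|xr] := leP r x; rewrite ?subrr ?normr0// !ger0_norm//; lra.
Qed.

Lemma dist_continuous_stopped r : 0 <= r -> dist_continuous (fun t => B (Num.min r t)).
Proof.
move=> r0 x x01 e e0.
have : C * rho ^+ m @[m --> \oo] --> (0 : R) by apply: scaled_cvg0; exact: rho_cvg0.
move=> /cvgr_lt/(_ _ e0)[m _ /(_ m (leqnn _)) Hm].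
exists (2^-1 ^+ m); first exact: half_gt0.
have mem t : 0 <= t <= 1 -> 0 <= Num.min r t <= 1.
  by move=> /andP[t0 t1]; rewrite le_min r0 t0 ge_min t1 orbT.
move=> y y01 yx; apply: le_lt_trans Hm; apply: HB; [exact: mem..|].
by apply: le_trans (min_dist _ _ _) (ltW yx).
Qed.

Lemma dist_continuous_dB K j : dist_continuous (fun t => dB B t K j).
Proof.
move=> x x01 e e0; have e20 : 0 < e / 2 by rewrite divr_gt0.
have [r r0 Hr] := dist_continuous_stopped (dyad_ge0 K j.+1) x01 e20.
have [r' r'0 Hr'] := dist_continuous_stopped (dyad_ge0 K j) x01 e20.
exists (Num.min r r'); first by rewrite lt_min r0.
move=> y y01; rewrite lt_min => /andP[yr yr']; rewrite /dB.
have E (a b c d : R) : a - b - (c - d) = (a - c) - (b - d) by ring.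
rewrite E.
by apply: le_lt_trans (ler_normB _ _) _; rewrite (splitr e); apply: ltrD; [exact: Hr|exact: Hr'].
Qed.

(** The bound on the norm of [F] is met by orbits of the shift, which is isometric. *)
Lemma dist_continuous_scale (f : R -> R) (F : R -> buc R) :
  dist_continuous (f : R -> R^o) -> dist_continuous F -> (forall t, `|F t| <= `|F 0|) ->
  dist_continuous (fun t => f t *: F t).
Proof.
move=> cf cF F0 x x01 e e0.
have n1 : 0 < `|F 0| + 1 by rewrite ltr_wpDl.
have f1 : 0 < `|f x| + 1 by rewrite ltr_wpDl.
have a0 : 0 < e / 2 / (`|F 0| + 1) by rewrite !divr_gt0.
have b0 : 0 < e / 2 / (`|f x| + 1) by rewrite !divr_gt0.
have [r r0 Hr] := cf x x01 _ a0; have [r' r'0 Hr'] := cF x x01 _ b0.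
exists (Num.min r r'); first by rewrite lt_min r0.
move=> y y01; rewrite lt_min => /andP[yr yr'].
have -> : f y *: F y - f x *: F x = (f y - f x) *: F y + f x *: (F y - F x).
  by rewrite scalerBl scalerBr addrA subrK.
apply: le_lt_trans (ler_normD _ _) _; rewrite !normrZ (splitr e).
have h1 := Hr y y01 yr; have h2 := Hr' y y01 yr'.
apply: ltrD.
  apply: (@le_lt_trans _ _ (`|f y - f x| * (`|F 0| + 1))).
    by apply: ler_wpM2l => //; apply: le_trans (F0 y) _; lra.
  by rewrite -ltr_pdivlMr.
apply: (@le_lt_trans _ _ ((`|f x| + 1) * `|F y - F x|)).
  by apply: ler_wpM2r => //; lra.
by rewrite mulrC -ltr_pdivlMr.
Qed.

Lemma norm_shift_eq (t : R) (f : buc R) : `|shift t f| = `|f|.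
Proof.
apply/eqP; rewrite eq_le norm_shift/=.
by rewrite -[X in `|X| <= _](shift0 f) -(addNr t) shiftD norm_shift.
Qed.

Lemma dist_continuous_Vsum m : dist_continuous (fun t => Vsum B t t (-1) m).
Proof.
apply: dist_continuous_sum => j; apply: dist_continuous_scale; first exact: dist_continuous_dB.
  move=> x _ e e0; have e20 : 0 < e / 2 by rewrite divr_gt0.
  have [r r0 Hr] := shift_equicontinuous (phi_below m) e20.
  exists r => // y _ yx; apply: (@le_lt_trans _ _ (e / 2)); last by lra.
  by apply: Hr; rewrite opprD addrACA subrr addr0.
by move=> t; rewrite !norm_shift_eq.
Qed.

(** The estimate 30 C 2^-m is uniform in t, and each [Vsum] is continuous although t enters both as
    the stopping time and as the shift. *)
Lemma Vlim_continuous : {within `[0, 1], continuous (fun t => Vlim B t t (-1))}.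
Proof.
apply: within_continuous_dist => x; rewrite /= in_itv/= => x01 e e0.
have e30 : 0 < e / 3 by rewrite divr_gt0.
have : 30 * C * (2^-1 : R) ^+ m @[m --> \oo] --> (0 : R) by apply: scaled_cvg0; exact: half_pow_cvg0.
move=> /cvgr_lt/(_ _ e30)[m _ /(_ m (leqnn _)) /= Hm].
have [r r0 Hr] := dist_continuous_Vsum m x01 e30.
exists r => // y; rewrite in_itv/= => y01 yx.
have s1 : (-1 : R) = 1 \/ (-1 : R) = -1 by right.
have [_ Hy] := Vlim_approx C0 y01 HB y s1; have [_ Hx] := Vlim_approx C0 x01 HB x s1.
have -> : Vlim B y y (-1) - Vlim B x x (-1) = (Vlim B y y (-1) - Vsum B y y (-1) m) +
   (Vsum B y y (-1) m - Vsum B x x (-1) m) - (Vlim B x x (-1) - Vsum B x x (-1) m).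
  by rewrite addrA subrK opprB addrA subrK.
apply: le_lt_trans (ler_normB _ _) _; apply: le_lt_trans (lerD (ler_normD _ _) (lexx _)) _.
have -> : e = e / 3 + e / 3 + e / 3 by field.
by apply: ltrD; [apply: ltrD; [exact: le_lt_trans (Hy m) Hm|exact: Hr]|exact: le_lt_trans (Hx m) Hm].
Qed.

End trajectory.

Theorem mainTheorem5 (R : realType) :
  exists (E : completeNormedModType R) (S : R -> E -> E)
         (DA : set E) (A : E -> E)
         (d : measure_display) (Omega : measurableType d)
         (P : probability Omega R) (W : R -> Omega -> E),
    [/\ C0_semigroup S, generator S DA A, brownian_motion P W &
      exists (U : R -> Omega -> E) (Un : nat -> R -> Omega -> E),
        [/\ is_solution P DA A W 1 U,
            continuous_trajectories 1 U,
            forall n : nat, (0 < n)%N -> is_splitting_scheme P S W 1 n (Un n) &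
            forall p : R, 1 <= p ->
              ~ ('N[P]_p%:E[(fun w => (`|Un n 1 w - U 1 w|)%:E)]%E
                 @[n --> \oo] --> 0%E) ] ].
Proof.
case: (splitting_space_exists R) => d []Omega []P []L []X S.
have [DA [A gA]] := generator_exists (@shift R).
exists (buc R), (@shift R), DA, A, d, Omega, P, (noise L X phi).
split=> //; [exact: shift_semigroup|exact: (noise_brownian S)|].
exists (solution L X), (split_sum L X); split.
- exists (@shift R); split=> //; first exact: shift_semigroup.
    exists (conv L X 1 0 1).
    have := shift_affine_integral S (t := 1) 0 (sigma := 1).
    rewrite (_ : (fun s => shift (0 + 1 * s)) = @shift R); last first.
      by apply/funext => s; rewrite add0r mul1r.
    by apply; [rewrite ler01 lexx|left].
  move=> t t01; have := shift_affine_integral S t (sigma := -1) t01 (or_intror erefl).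
  rewrite (_ : (fun s => shift (t + -1 * s)) = (fun s => shift (t - s)))//.
  by apply/funext => s; rewrite mulN1r.
- move=> w; have [C C0 HC] := path_modulus S w.
  exact: (Vlim_continuous C0 HC).
- by move=> n n0; exact: (splitting_scheme S).
- by move=> p p1; exact: (no_convergence S p1).
Qed.
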